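(* Let $\Phi_K(q)$ and $\Phi_{-K}(q)$ be the $q$-series attached to an alternating knot $K$ and its mirror image $-K$, and let $h_b=h_b(q)$, all as defined in the context. Then the following identities hold (each entry reads $K:\ \Phi_K(q),\ \Phi_{-K}(q)$). $3_1:\ \Phi_K=h_3,\ \Phi_{-K}=1$; $4_1:\ \Phi_K=h_3,\ \Phi_{-K}=h_3$; $5_1:\ \Phi_K=h_5,\ \Phi_{-K}=1$; $5_2:\ \Phi_K=h_4,\ \Phi_{-K}=h_3$; $6_1:\ \Phi_K=h_5,\ \Phi_{-K}=h_3$; $6_2:\ \Phi_K=h_3h_4,\ \Phi_{-K}=h_3$; $6_3:\ \Phi_K=h_3^2,\ \Phi_{-K}=h_3^2$; $7_1:\ \Phi_K=h_7,\ \Phi_{-K}=1$; $7_2:\ \Phi_K=h_6,\ \Phi_{-K}=h_3$; $7_3:\ \Phi_K=h_5,\ \Phi_{-K}=h_4$; $7_4:\ \Phi_K=h_4^2,\ \Phi_{-K}=h_3$; $7_5:\ \Phi_K=h_3h_4,\ \Phi_{-K}=h_4$; $7_6:\ \Phi_K=h_3h_4,\ \Phi_{-K}=h_3^2$; $7_7:\ \Phi_K=h_3^3,\ \Phi_{-K}=h_3^2$; $8_1:\ \Phi_K=h_7,\ \Phi_{-K}=h_3$; $8_2:\ \Phi_K=h_3h_6,\ \Phi_{-K}=h_3$; $8_3:\ \Phi_K=h_5,\ \Phi_{-K}=h_5$; $8_4:\ \Phi_K=h_3,\ \Phi_{-K}=h_4h_5$; $8_5:\ \Phi_{-K}=h_3$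 (no evaluation of $\Phi_{8_5}$ is asserted); the twist knot $K_p$ for every integer $p>0$: $\Phi_{K_p}=h_{2p},\ \Phi_{-K_p}=h_3$; the twist knot $K_p$ for every integer $p<0$: $\Phi_{K_p}=h_{2|p|+1},\ \Phi_{-K_p}=h_3$; the torus knot $T(2,2p+1)$ for every integer $p>0$: $\Phi_{T(2,2p+1)}=h_{2p+1},\ \Phi_{-T(2,2p+1)}=1$.
   Context: **$q$-notation.** $(a)_n=(a;q)_n=\prod_{k=1}^n(1-aq^{k-1})$ for $n\in\mathbb N\cup\{\infty\}$; in particular $(q)_n=\prod_{k=1}^n(1-q^k)$. Also $1/(q)_n=0$ for $n<0$. Identities are between power series in $q$ (equivalently for $|q|<1$). **The series $h_b$.** For a positive integer $b$, $$h_b=h_b(q)=\sum_{n\in\mathbb Z}\epsilon_b(n)\,q^{\frac{bn(n+1)}2-n},$$ where $\epsilon_b(n)=(-1)^n$ if $b$ is odd; $\epsilon_b(n)=1$ if $b$ is even and $n\ge0$; $\epsilon_b(n)=-1$ if $b$ is even and $n<0$. **Faces and colorings.** Let $K$ be an alternating knot with $c$ crossings and $D$ its reduced alternating diagram, viewed as a planar graph (vertices are the crossings, edges are the arcs between crossings). Let $E(D)$ be its set of edges, $R$ its set of faces and $X\in R$ the exterior face. Color the faces in checkerboard fashion with colors $A$ and $B$, and let $R_A,R_B$ be the sets of $A$- and $B$-colored faces; each edge is adjacent to one $A$-face and one $B$-face. For faces, $e(F)$ is the number of edges of $F$, $cv(F_i,F_j)$ the number of common vertices and $ce(F_i,F_j)$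 the number of common edges. Define $$L(F)=1 \text{ if } F\in R_B,\qquad L(F)=\tfrac{e(F)}2-1\text{ if }F\in R_A,$$ and $Q(F_i,F_j)$ by: $0$ if $i=j$ and $F_i\in R_B$, or if $i\ne j$ and both faces are in $R_A$; $e(F_i)$ if $i=j$ and $F_i\in R_A$; $cv(F_i,F_j)$ if $i\ne j$ and both faces are in $R_B$; $ce(F_i,F_j)$ if $i\neq j$ and one face is in $R_A$ and the other in $R_B$. **The set $\Lambda$.** Consider maps $s:R\to\mathbb Z$ with $s(X)=0$, and for $e\in E(D)$ let $s(e)$ be the sum of the values of $s$ on the two faces adjacent to $e$. Choose a face $F^*$ of the color opposite to that of $X$ that shares a common edge with the maximum number of faces of the color of $X$; if it is not unique, choose among all faces of the color opposite to that of $X$ one sharing a common edge with the maximum number of faces of the color of $X$ other than $X$ itself; if this is still not unique choose any of the remaining candidates. Put $$\Lambda=\{s:R\to\mathbb Z\ :\ s(X)=0,\ s(F^* )=0,\ s(e)\ge0\ \ \forall e\in E(D)\}.$$ **The $q$-multisum.** With $F_1,\dots,F_{|R|-1}$ the faces other than $X$, let $$L'(s)=\sum_{i=1}^{|R|-1}L(F_i)s(F_i),\qquad Q'(s)=\frac12\sum_{1\le i,j\le|R|-1}Q(F_i,F_j)s(F_i)s(F_j),$$ and $$\Phi=(q)_\infty^{c}\sum_{s\in\Lambda}(-1)^{2L'(s)}\frac{q^{Q'(s)+L'(s)}}{\prod_{e\in E(D)}(q)_{s(e)}}.$$ $\Phi_K(q)$ is this series when the coloring is chosen with $X$ colored $A$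 (so $F^*\in R_B$). $\Phi_{-K}(q)$ is this series when the colors $A$ and $B$ are swapped, so that $X$ is colored $B$ (and $F^*\in R_A$). For instance, $\Phi_{7_2}(q)=(q)_\infty^7\sum_{a,b,c,d,e,f,g\ge0}\dfrac{q^{3a^2+2a+b^2+bc+ac+ad+ae+af+ag+cd+de+ef+fg+c+d+e+f+g}}{(q)_a(q)_b(q)_c(q)_d(q)_e(q)_f(q)_g(q)_{b+c}(q)_{a+c}(q)_{a+d}(q)_{a+e}(q)_{a+f}(q)_{a+g}}$. **Knots and diagrams.** $3_1,\dots,8_5$ are the knots of the standard (Rolfsen) table with their standard diagrams; $K_p$ is the $p$th twist knot, obtained by $-1/p$ surgery on the Whitehead link; $T(a,b)$ is the left-handed $(a,b)$ torus knot. To fix the diagrams and chirality unambiguously, here are the Tait graphs for the coloring with $X$ colored $A$: the vertices of the Tait graph are the $B$-faces, its edges are the crossings of $D$ (joining the two $B$-faces meeting there), its faces are the $A$-faces, and $X$ is its outer face; $D$ is the medial graph of the Tait graph. Write $C_n$ for the plane $n$-cycle ($C_2$ is two vertices joined by two edges), and $C_n^{(m)}$ for $C_n$ with one edge replaced by $m$ parallel edges (with bigons between them). ''Glued along an edge'' means that the two cycles share exactly that edge and lie on opposite sides of it. - $3_1,5_1,7_1$: $C_3,C_5,C_7$; $T(2,2p+1)$: $C_{2p+1}$. - $4_1,5_2,6_1,7_2,8_1$: $C_3^{(2)},C_4^{(2)},C_5^{(2)},C_6^{(2)},C_7^{(2)}$; $7_3$: $C_5^{(3)}$; $8_3$: $C_5^{(4)}$.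 - $K_p$, $p>0$: $C_{2p}^{(2)}$; $K_p$, $p<0$: $C_{2|p|+1}^{(2)}$. - $6_2$: $C_3$ and $C_4$ glued along an edge; $7_4$: two $C_4$'s glued along an edge; $8_2$: $C_3$ and $C_6$ glued along an edge. - $6_3$: two triangles glued along an edge, with one non-common edge doubled. - $7_5$: $C_3$ and $C_4$ glued along an edge, with the common edge doubled (the bigon lying between the two cycles). - $7_6$: $C_3$ and $C_4$ glued along an edge, with an edge of $C_4$ adjacent to the common edge doubled. - $7_7$: a pentagon triangulated by two diagonals from one vertex. - $8_4$: a triangle whose three edges are replaced by $4$, $1$ and $3$ parallel edges. - $8_5$: two vertices joined by three internally disjoint paths of lengths $3,3,2$.
   Formalization: When the first count leaves F* not unique, the second count is maximized only among the faces maximizing the first, not among all faces of the color opposite to X; for 8_5 the literal choice admits an F* whose series begins 1-2q, not h_3. *)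

(* Defs.v *)
From HB Require Import structures.
(* The finite-set names of [all_boot] must shadow those of [classical_sets]. *)
From mathcomp Require Import boolp classical_sets cardinality fsbigop.
From mathcomp Require Import all_boot all_order all_fingroup all_algebra archimedean zify.

Set Implicit Arguments.
Unset Strict Implicit.
Unset Printing Implicit Defensive.

Import Order.TTheory GRing.Theory Num.Theory.
Local Open Scope ring_scope.

(** Formal power series in q. *)
Record fps := Fps { fcoef : nat -> int }.

HB.instance Definition _ := gen_eqMixin fps.
HB.instance Definition _ := gen_choiceMixin fps.

Lemma fpsP (f g : fps) : fcoef f =1 fcoef g -> f = g.
Proof. by case: f g => [f] [g] /= /funext ->. Qed.

Definition fps0 := Fps (fun=> 0).
Definition fps_opp f := Fps (fun n => - fcoef f n).
Definition fps_add f g := Fps (fun n => fcoef f n + fcoef g n).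

Fact fps_addA : associative fps_add.
Proof. by move=> f g h; apply: fpsP => n /=; rewrite addrA. Qed.
Fact fps_addC : commutative fps_add.
Proof. by move=> f g; apply: fpsP => n /=; rewrite addrC. Qed.
Fact fps_add0 : left_id fps0 fps_add.
Proof. by move=> f; apply: fpsP => n /=; rewrite add0r. Qed.
Fact fps_addN : left_inverse fps0 fps_opp fps_add.
Proof. by move=> f; apply: fpsP => n /=; rewrite addNr. Qed.

HB.instance Definition _ :=
  GRing.isZmodule.Build fps fps_addA fps_addC fps_add0 fps_addN.

Definition fpsX n := Fps (fun k => (k == n)%:R).
Definition fps_mul f g :=
  Fps (fun n => \sum_(i < n.+1) fcoef f i * fcoef g (n - i)%N).

Definition fps_trunc N f : {poly int} := \poly_(i < N.+1) fcoef f i.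

Lemma coef_trunc N f n : (n <= N)%N -> (fps_trunc N f)`_n = fcoef f n.
Proof. by move=> nN; rewrite coef_poly ltnS nN. Qed.

Lemma coef_trunc_mul N f g n : (n <= N)%N ->
  (fps_trunc N f * fps_trunc N g)`_n = fcoef (fps_mul f g) n.
Proof.
move=> nN; rewrite coefM /=; apply: eq_bigr => i _.
rewrite !coef_trunc //; first exact: leq_trans (leq_subr _ _) nN.
by apply: leq_trans nN; rewrite -ltnS.
Qed.

Fact fps_mulC : commutative fps_mul.
Proof.
move=> f g; apply: fpsP => n.
by rewrite -!(coef_trunc_mul _ _ (leqnn n)) mulrC.
Qed.

Fact fps_mulA : associative fps_mul.
Proof.
move=> f g h; apply: fpsP => n.
transitivity (fps_trunc n f * (fps_trunc n g * fps_trunc n h))`_n.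
  rewrite coefM /=; apply: eq_bigr => i _.
  by rewrite coef_trunc -1?ltnS// coef_trunc_mul// leq_subr.
rewrite mulrA coefM /=; apply: eq_bigr => i _.
by rewrite coef_trunc_mul -1?ltnS// coef_trunc// leq_subr.
Qed.

Fact fps_mul1 : left_id (fpsX 0) fps_mul.
Proof.
move=> f; apply: fpsP => n /=; rewrite big_ord_recl /= mul1r subn0 big1 ?addr0//.
by move=> i _; rewrite mul0r.
Qed.

Fact fps_mulDl : left_distributive fps_mul fps_add.
Proof.
move=> f g h; apply: fpsP => n /=; rewrite -big_split /=.
by apply: eq_bigr => i _; rewrite mulrDl.
Qed.

Fact fps_oner_neq0 : fpsX 0 != 0 :> fps.
Proof. by apply/eqP => /(congr1 (fun f => fcoef f 0)). Qed.

HB.instance Definition _ := GRing.Zmodule_isComNzRing.Build fps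
  fps_mulA fps_mulC fps_mul1 fps_mulDl fps_oner_neq0.

Lemma fcoef0 n : fcoef 0 n = 0. Proof. by []. Qed.
Lemma fcoef1 n : fcoef 1 n = (n == 0%N)%:R. Proof. by []. Qed.
Lemma fcoefN f n : fcoef (- f) n = - fcoef f n. Proof. by []. Qed.
Lemma fcoefD f g n : fcoef (f + g) n = fcoef f n + fcoef g n. Proof. by []. Qed.
Lemma fcoefB f g n : fcoef (f - g) n = fcoef f n - fcoef g n. Proof. by []. Qed.
Lemma fcoefM f g n :
  fcoef (f * g) n = \sum_(i < n.+1) fcoef f i * fcoef g (n - i)%N.
Proof. by []. Qed.

Lemma fcoef_sum I (r : seq I) (P : pred I) (F : I -> fps) n :
  fcoef (\sum_(i <- r | P i) F i) n = \sum_(i <- r | P i) fcoef (F i) n.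
Proof. by apply: (big_morph (fcoef^~ n)). Qed.

Lemma fcoef_exp_eq0 u k n : fcoef u 0 = 0 -> (n < k)%N -> fcoef (u ^+ k) n = 0.
Proof.
move=> u0; elim: k n => [//|k IHk] n nk.
rewrite exprS fcoefM big1// => -[[|i] /= lti] _; first by rewrite u0 mul0r.
by rewrite IHk ?mulr0//; move: nk lti; case: n => // n; rewrite !ltnS subSS
  => nk _; apply: leq_ltn_trans nk; rewrite leq_subr.
Qed.

Definition fps_unit : pred fps := fun f => fcoef f 0 \is a GRing.unit.

(** With c the inverse of the constant term, 1/f = c * sum_k (1 - c f)^k; only
    the terms k <= n contribute to the n-th coefficient. *)
Definition fps_inv f :=
  if f \in fps_unit then
    let c := Fps (fun n => if n == 0%N then (fcoef f 0)^-1 else 0) in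
    c * Fps (fun n => \sum_(k < n.+1) fcoef ((1 - c * f) ^+ k) n)
  else f.

Fact fps_mulV : {in fps_unit, left_inverse 1 fps_inv *%R}.
Proof.
move=> f fU; rewrite /fps_inv fU; set c := Fps (fun n => if _ then _ else _).
set g := Fps _; have u0 : fcoef (1 - c * f) 0 = 0.
  by rewrite fcoefB fcoefM fcoef1 big_ord1 /= mulVr ?subrr.
rewrite mulrAC -[c * f](subKr 1); set u := 1 - c * f in u0 g *.
apply: fpsP => n; have -> : fcoef ((1 - u) * g) n =
    fcoef ((1 - u) * \sum_(k < n.+1) u ^+ k) n.
  rewrite !fcoefM; apply: eq_bigr => i _; congr (_ * _).
  rewrite fcoef_sum /= (big_ord_widen n.+1 (fun k => fcoef (u ^+ k) (n - i)%N));
    last by rewrite ltnS leq_subr.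
  rewrite big_mkcond; apply: eq_bigr => k _; case: ifPn => //.
  by rewrite -leqNgt => ik; rewrite fcoef_exp_eq0.
have -> : (1 - u) * \sum_(k < n.+1) u ^+ k = 1 - u ^+ n.+1.
  by rewrite -opprB mulNr -subrX1 opprB.
by rewrite fcoefB fcoef_exp_eq0 ?subr0.
Qed.

Fact fps_unitP (f g : fps) : g * f = 1 -> f \in fps_unit.
Proof.
move=> /(congr1 (fcoef^~ 0%N)); rewrite fcoefM big_ord1 fcoef1 /= => gf.
by apply/unitrPr; exists (fcoef g 0); rewrite mulrC.
Qed.

Fact fps_inv_out : {in [predC fps_unit], fps_inv =1 id}.
Proof. by move=> f; rewrite inE /= /fps_inv => /negbTE ->. Qed.

HB.instance Definition _ := GRing.ComNzRing_hasMulInverse.Build fps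
  fps_mulV fps_unitP fps_inv_out.

(** q^x, with the convention that it is 0 unless x is a natural number. *)
Definition qpow (x : rat) : fps :=
  if x \is a Num.nat then fpsX (Num.truncn x) else 0.

Definition qpoch (n : nat) : fps := \prod_(1 <= k < n.+1) (1 - fpsX k).

(** (q)_oo: the factors 1 - q^k with k > n do not affect the n-th coefficient. *)
Definition qpoch_oo : fps := Fps (fun n => fcoef (qpoch n) n).

Definition inv_qpoch (n : int) : fps := if n is Posz k then (qpoch k)^-1 else 0.

(** Unordered sums of families of power series; [fps_sum] is meaningful only
    when the family is [fps_summable]. *)
Definition fps_summable (I : choiceType) (A : set I) (F : I -> fps) :=
  forall n, finite_set [set i | A i /\ fcoef (F i) n != 0]%classic.

Definition fps_sum (I : choiceType) (A : set I) (F : I -> fps) : fps :=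
  Fps (fun n => \sum_(i \in A) fcoef (F i) n).

Definition eps (b : nat) (n : int) : fps :=
  if odd b then (-1) ^ n else if 0 <= n then 1 else -1.

Definition h_term (b : nat) (n : int) : fps :=
  eps b n * qpow (b%:R * n%:~R * (n%:~R + 1) / 2 - n%:~R).

Definition h (b : nat) : fps := fps_sum [set: int]%classic (h_term b).

Fact h_term_bound (b N : nat) (n : int) : (0 < b)%N ->
  b%:Z * n * (n + 1) = N%:Z * 2 + n * 2 -> - N.+1%:Z <= n /\ n <= N.+1%:Z.
Proof.
move=> b0 eN; have n1 : 0 <= n * (n + 1) by case: n {eN} => k; nia.
have {b0 eN} : n * (n + 1) <= N%:Z * 2 + n * 2.
  by rewrite -eN -mulrA ler_peMl// lez_nat.
case: n {n1} => k; first by nia.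
by rewrite NegzE; nia.
Qed.

Lemma h_summable b : (0 < b)%N -> fps_summable [set: int]%classic (h_term b).
Proof.
move=> b0 N; apply: (@sub_finite_set _ _ [set` [seq k%:Z - N.+1%:Z | k <- iota 0 (N.*2.+3)]]%classic);
  last exact: finite_seq.
move=> n [_ nN].
have : h_term b n != 0.
  by apply: contraNneq nN => ->; rewrite fcoef0.
rewrite /h_term /qpow in nN *; case: ifPn nN => [xnat nN _|_ _]; last first.
  by rewrite mulr0 eqxx.
set x := _ - _ in xnat nN.
have epsE : eps b n = 1 \/ eps b n = -1.
  rewrite /eps; case: odd; last by case: ifP; [left|right].
  case: n {nN x xnat} => k.
    by rewrite -exprnP -signr_odd; case: odd; rewrite ?expr1 ?expr0; [right|left].
  rewrite NegzE -exprnN -signr_odd.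
  by case: odd; rewrite ?expr1 ?expr0 ?invrN ?invr1; [right|left].
have {}nN : Num.truncn x = N.
  apply: contraNeq nN; rewrite eq_sym => /negbTE tN.
  by case: epsE => ->; rewrite ?mul1r ?mulN1r ?fcoefN /= tN ?oppr0.
have xN : x = N%:R by rewrite -nN truncnK.
have {xN} : b%:Z * n * (n + 1) = N%:Z * 2 + n * 2.
  apply: (@intr_inj rat); rewrite !(rmorphM, rmorphD) /=.
  move/(congr1 (fun y => (y + n%:~R) * 2)): xN.
  by rewrite /x subrK divfK// mulrDl.
move=> eN; have [lo up] := h_term_bound b0 eN.
by apply/mapP; exists (absz (n + N.+1%:Z)); rewrite ?mem_iota /=; move: (n : int) lo up; lia.
Qed.

(** A graph drawn on an oriented closed surface, the sphere for plane graphs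
    (the definitions below do not depend on the genus).
    A dart is an edge with a direction of travel.  [medge] reverses the
    direction, [mface] goes to the next dart along the face lying on the left,
    and [mnode] to the next dart, counterclockwise, with the same origin.
    Edges, vertices and faces are the orbits of these permutations. *)

Record cmap := CMap {
  dart : finType;
  medge : {perm dart};
  mnode : {perm dart};
  mface : {perm dart};
  medgeK : involutive medge;
  medge_neq : forall x, medge x != x;
  mapK : forall x, mnode (mface (medge x)) = x
}.

Definition edges (D : cmap) := porbits (medge D).
Definition vertices (D : cmap) := porbits (mnode D).
Notation face D := {F : {set dart D} | F \in porbits (mface D)}.

Fact face_of_subproof (D : cmap) (x : dart D) :
  porbit (mface D) x \in porbits (mface D).
Proof. exact: imset_f. Qed.

Definition face_of (D : cmap) (x : dart D) : face D :=
  exist _ (porbit (mface D) x) (face_of_subproof x).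

(** A vertex or edge [c] lies on [F] when they share a dart. *)
Definition on_face (D : cmap) (F : face D) (c : {set dart D}) : bool :=
  val F :&: c != set0.

(** A coloring is given by the set [A] of its A-colored faces. *)

Section MultiSum.
Variables (D : cmap) (A : {set face D}) (X : face D).
Implicit Types (F G : face D) (s : {ffun face D -> int}).

Definition checkerboard := forall x : dart D,
  (face_of x \in A) != (face_of (medge D x) \in A).

Definition nb_edges F : nat := #|[set c in edges D | on_face F c]|.
Definition cv F G : nat := #|[set c in vertices D | on_face F c & on_face G c]|.
Definition ce F G : nat := #|[set c in edges D | on_face F c & on_face G c]|.

Definition L F : rat := if F \in A then (nb_edges F)%:R / 2 - 1 else 1.

Definition Q F G : nat :=
  if F == G then if F \in A then nb_edges F else 0
  else match F \in A, G \in A with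
       | true, true => 0
       | false, false => cv F G
       | _, _ => ce F G
       end.

Definition L' s : rat := \sum_(F | F != X) L F * (s F)%:~R.
Definition Q' s : rat :=
  2^-1 * \sum_(F | F != X) \sum_(G | G != X) (Q F G)%:R * (s F)%:~R * (s G)%:~R.

Definition edge_val s (c : {set dart D}) : int := \sum_(F | on_face F c) s F.

Definition opp_X : {set face D} := [set F | (F \in A) != (X \in A)].
Definition same_X : {set face D} := [set F | (F \in A) == (X \in A)].
Definition nb_adj (S : {set face D}) F : nat := #|[set G in S | (0 < ce F G)%N]|.

(** The candidates for F*: the maximizers of the first count among the faces of
    the other color, and among these the maximizers of the second.  (For -8_5,
    maximizing the second count over all faces of the other color would admit
    further faces, for which the multisum takes a different value.) *)
Definition first_choice : {set face D} :=
  [set F in opp_X | [forall G in opp_X, nb_adj same_X G <= nb_adj same_X F]%N].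
Definition admissible : {set face D} :=
  [set F in first_choice | [forall G in first_choice,
     nb_adj (same_X :\ X) G <= nb_adj (same_X :\ X) F]%N].

Section Fixed.
Variable Fstar : face D.

Definition Lambda : set {ffun face D -> int} :=
  [set s : {ffun face D -> int} | [/\ s X = 0, s Fstar = 0 &
            forall c, c \in edges D -> 0 <= edge_val s c]]%classic.

Definition term s : fps :=
  (-1) ^ (Num.floor (2 * L' s)) * qpow (Q' s + L' s) *
    \prod_(c in edges D) inv_qpoch (edge_val s c).

Definition Phi_series : fps :=
  qpoch_oo ^+ #|vertices D| * fps_sum Lambda term.

Definition Phi_defined : Prop :=
  (forall s, Lambda s -> Q' s + L' s \is a Num.nat) /\ fps_summable Lambda term.

End Fixed.

(** The multisum makes sense and equals [f], whatever the choice of F*. *)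
Definition Phi_is (f : fps) : Prop :=
  forall Fstar, Fstar \in admissible ->
    Phi_defined Fstar /\ Phi_series Fstar = f.

End MultiSum.

Lemma L'_half_int (D : cmap) (A : {set face D}) (X : face D) s :
  2 * L' A X s \is a Num.int.
Proof.
rewrite mulr_sumr rpred_sum// => F _; rewrite mulrA rpredM ?rpred_int//.
rewrite /L; case: ifP => _; last by rewrite mulr1 rpred_nat.
by rewrite mulrBr mulrC divfK// mulr1 rpredB ?rpred_nat.
Qed.

Lemma admissible_neq0 (D : cmap) (A : {set face D}) (X : face D) :
  checkerboard A -> admissible A X != set0.
Proof.
move=> chk; have /set0Pn[x xX] : val X != set0.
  by case: X => ? /= /imsetP[x _ ->]; apply/set0Pn; exists x; rewrite porbit_id.
have eX : X = face_of x.
  apply: val_inj => /=; case: X xX => ? /= /imsetP[y _ ->].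
  by rewrite -eq_porbit_mem => /eqP.
have Fo : face_of (medge D x) \in opp_X A X by rewrite inE eX eq_sym chk.
case: (arg_maxnP (fun F => nb_adj (same_X A X) F) Fo) => F1 F1o max1.
have F1c : F1 \in first_choice A X.
  by rewrite in_set; apply/andP; split=> //; apply/forall_inP => G; apply: max1.
case: (arg_maxnP (fun F => nb_adj (same_X A X :\ X) F) F1c) => F2 F2c max2.
apply/set0Pn; exists F2; rewrite in_set; apply/andP; split=> //.
by apply/forall_inP => G; apply: max2.
Qed.

(** The dart [(x, true)] of the medial graph runs from the midpoint of the edge
    of [x] to that of the next edge counterclockwise around the origin of [x],
    cutting off that corner, and [(x, false)] is its reverse.  So the former has
    the vertex of the corner on its left, and the latter the face. *)

Section Medial.
Variable T : cmap.
Implicit Types d : dart T * bool.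

Definition med_edge d := (d.1, ~~ d.2).
Definition med_face d :=
  (if d.2 then mnode T d.1 else mface T d.1, d.2).
Definition med_node d :=
  (if d.2 then (mnode T)^-1%g d.1 else (mface T)^-1%g d.1, ~~ d.2).

Fact med_edgeK : involutive med_edge.
Proof. by case=> x b; rewrite /med_edge /= negbK. Qed.

Fact med_face_inj : injective med_face.
Proof.
by move=> [x b] [y b'] [/[swap] /= <-]; case: b => /perm_inj ->.
Qed.

Fact med_node_inj : injective med_node.
Proof.
by move=> [x b] [y b'] [/[swap] /= /negb_inj <-]; case: b => /perm_inj ->.
Qed.

Fact medial_edgeK : involutive (perm (can_inj med_edgeK)).
Proof. by move=> d; rewrite !permE med_edgeK. Qed.

Fact medial_edge_neq d : perm (can_inj med_edgeK) d != d.
Proof. by rewrite permE; case: d => x []; rewrite xpair_eqE andbF. Qed.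

Fact medialK d :
  perm med_node_inj (perm med_face_inj (perm (can_inj med_edgeK) d)) = d.
Proof.
by rewrite !permE; case: d => x []; rewrite /med_node /med_face /= permK.
Qed.

Definition medial : cmap := CMap medial_edgeK medial_edge_neq medialK.

(** The A-colored faces are those coming from the faces of [T]. *)
Definition tait_A : {set face medial} :=
  [set F : face medial | [exists d in val F, ~~ d.2]].

Lemma tait_AE x b : (face_of (D := medial) (x, b) \in tait_A) = ~~ b.
Proof.
have porb2 d : d \in porbit (mface medial) (x, b) -> d.2 = b.
  case/porbitP => n ->; elim: n => [|n IHn]; first by rewrite expg0 perm1.
  by rewrite expgSr permM permE.
rewrite inE; apply/exists_inP/idP => [[d /porb2 <-] //|nb].
by exists (x, b); rewrite ?porbit_id.
Qed.

Lemma tait_checkerboard : checkerboard tait_A.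
Proof. by move=> [x b]; rewrite permE !tait_AE; case: b. Qed.

Lemma tait_checkerboardC : checkerboard (~: tait_A).
Proof. by move=> [x b]; rewrite permE !in_setC !tait_AE; case: b. Qed.

End Medial.

(** [outer] has the outer face on its left. *)
Record tait := Tait { tait_map :> cmap; outer : dart tait_map }.

Definition tait_X (T : tait) : face (medial T) :=
  face_of (D := medial T) (outer T, false).

Definition Phi_K_is (T : tait) := Phi_is (tait_A T) (tait_X T).
Definition Phi_mK_is (T : tait) := Phi_is (~: tait_A T) (tait_X T).

(** The darts of the k-th edge are the integers k and -k.  A plane graph is
    given by the list of its face boundaries, each traversed with the face on
    its left, the outer face first. *)

Definition face_code_ok (fs : seq (seq int)) : bool :=
  [&& head [::] fs != [::], uniq (flatten fs), 0 \notin flatten fs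
    & all (fun x => - x \in flatten fs) (flatten fs)].

Record face_code := FaceCode {
  face_list :> seq (seq int);
  face_listP : face_code_ok face_list
}.

Section TaitOfCode.
Variable fs : face_code.

Definition code_dart : finType := seq_sub (flatten fs).

Definition next_on_face (x : int) : int :=
  next (nth [::] fs (find (fun c => x \in c) fs)) x.

Fact code_edge_subproof (x : code_dart) : - val x \in flatten fs.
Proof. by case/and4P: (face_listP fs) => _ _ _ /allP; apply; exact: valP. Qed.

Fact code_faceP x : x \in flatten fs ->
  exists2 c, c \in face_list fs & x \in c /\ next_on_face x = next c x.
Proof.
case/flattenP => c cfs xc; have hasx : has (fun c => x \in c) fs by apply/hasP; exists c.
exists (nth [::] fs (find (fun c => x \in c) fs)); first by rewrite mem_nth -?has_find.
by split=> //; exact: (nth_find [::] hasx).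
Qed.

Fact code_face_subproof (x : code_dart) : next_on_face (val x) \in flatten fs.
Proof.
have [c cfs [xc ->]] := code_faceP (valP x).
by apply/flattenP; exists c => //; rewrite mem_next.
Qed.

Definition code_edge (x : code_dart) : code_dart := SeqSub (code_edge_subproof x).
Definition code_face (x : code_dart) : code_dart := SeqSub (code_face_subproof x).

Fact code_edgeK : involutive code_edge.
Proof. by move=> x; apply: val_inj; rewrite /= opprK. Qed.

Fact code_face_inj : injective code_face.
Proof.
move=> x y /(congr1 val) /=.
have [c cfs [xc ->]] := code_faceP (valP x).
have [c' cfs' [yc ->]] := code_faceP (valP y) => xy; apply: val_inj.
have /and4P[_ ufs _ _] := face_listP fs.
have cc' : c = c'.
  have : next c (val x) \in c' by rewrite xy mem_next.
  have : next c (val x) \in c by rewrite mem_next.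
  move: (next c _) => z zc zc' {xy xc yc}.
  elim: (face_list fs) ufs cfs cfs' => // a l IHl /=.
  rewrite cat_uniq => /and3P[_ /hasPn al ul]; rewrite !inE.
  have alF e : e \in l -> z \in e -> z \in a -> False.
    move=> el ze za; have /negP := al z (ltac:(by apply/flattenP; exists e)).
    exact.
  case/predU1P=> [ca|cl]; case/predU1P=> [ca'|cl'].
  - by rewrite ca ca'.
  - by case: (alF _ cl' zc'); rewrite -ca.
  - by case: (alF _ cl zc); rewrite -ca'.
  - exact: IHl.
have uc : uniq c.
  elim: (face_list fs) ufs cfs => // a l IHl /=.
  rewrite cat_uniq => /and3P[ua _ ul]; rewrite inE => /predU1P[->//|].
  exact: IHl.
by rewrite -(prev_next uc (val x)) xy -cc' prev_next.
Qed.

Let e := perm (can_inj code_edgeK).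
Let f := perm code_face_inj.

Fact code_map_edgeK : involutive e.
Proof. by move=> x; rewrite !permE code_edgeK. Qed.

Fact code_map_edge_neq x : e x != x.
Proof.
rewrite permE -val_eqE /= eqNr.
apply/eqP => x0; have := ssvalP x; rewrite x0; apply/negP.
by case/and4P: (face_listP fs).
Qed.

Fact code_mapK x : (f^-1 * e)%g (f (e x)) = x.
Proof. by rewrite permM permK code_map_edgeK. Qed.

Definition code_map : cmap := CMap code_map_edgeK code_map_edge_neq code_mapK.

Fact code_outer_subproof : head 0 (head [::] fs) \in flatten fs.
Proof.
case/andP: (face_listP fs); case: (face_list fs) => [|[|x c] l] //= _ _.
by rewrite inE eqxx.
Qed.

Definition tait_of : tait :=
  @Tait code_map (SeqSub code_outer_subproof : dart code_map).

End TaitOfCode.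

Coercion tait_of : face_code >-> tait.

HB.instance Definition _ := [isSub for face_list].

Definition up (i n : nat) : seq int := [seq k%:Z | k <- iota i n].
Definition down (i n : nat) : seq int := [seq - k%:Z | k <- rev (iota i n)].

(** The n-cycle with edges 1, ..., n, whose edge n is replaced by the m parallel
    edges n, ..., n + m - 1. *)
Definition C_faces (n m : nat) : seq (seq int) :=
  [:: - (n + m.-1)%:Z :: down 1 n.-1, up 1 n
    & [seq [:: - k%:Z; k.+1%:Z] | k <- iota n m.-1]].

Definition C_ (n m : nat) : face_code :=
  insubd (FaceCode (face_list := C_faces 3 1) isT) (C_faces n m).

Lemma C_ok n m : (0 < n)%N -> (0 < m)%N -> face_list (C_ n m) = C_faces n m.
Proof.
move=> n0 m0; apply: (insubdK (sT := face_code)).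
pose N := (n + m.-1)%N.
have memup i l (k : nat) : (k%:Z \in up i l) = (i <= k < i + l)%N.
  by rewrite /up mem_map ?mem_iota// => a b [].
have memdown i l (k : nat) : (- k%:Z \in down i l) = (i <= k < i + l)%N.
  rewrite /down (mem_map (f := fun j : nat => - j%:Z)) ?mem_rev ?mem_iota//.
  by move=> a b /oppr_inj[].
have szf : size (flatten (C_faces n m)) = N.*2.
  rewrite /C_faces /= !size_cat !size_map size_rev !size_iota.
  suff -> : size (flatten [seq [:: - k%:Z; k.+1%:Z] | k <- iota n m.-1]) = m.-1.*2.
    by rewrite /N -(prednK n0) /= addSn -!addnn; lia.
  by elim: (m.-1) (n) => // j IHj i /=; rewrite IHj.
have us : uniq (up 1 N ++ down 1 N).
  rewrite cat_uniq !map_inj_uniq ?rev_uniq ?iota_uniq /=;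
    [|by move=> a b /oppr_inj[]|by move=> a b []].
  rewrite andbT; apply/hasPn => x /mapP[k]; rewrite mem_rev mem_iota => /andP[k0 _] ->.
  by apply/negP => /mapP[k' _]; lia.
have sub : {subset up 1 N ++ down 1 N <= flatten (C_faces n m)}.
  move=> x; rewrite mem_cat => /orP[] /mapP[k]; rewrite ?mem_rev mem_iota => /andP[k0 kN] ->.
    rewrite /= inE !mem_cat memup; apply/orP; right; apply/orP; right.
    case: (leqP k n) => kn; first by rewrite k0 add1n ltnS kn.
    apply/orP; right; apply/flattenP; exists [:: - k.-1%:Z; k.-1.+1%:Z].
      by apply/mapP; exists k.-1; rewrite ?mem_iota//; lia.
    by rewrite prednK// !inE eqxx orbT.
  rewrite /= inE !mem_cat memdown; have [->|kNN] := eqVneq k N; first by rewrite eqxx.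
  case: (ltnP k n) => kn; first by rewrite k0 add1n prednK// kn orbT.
  do 3![apply/orP; right]; apply/flattenP; exists [:: - k%:Z; k.+1%:Z].
    by apply/mapP; exists k; rewrite ?mem_iota//; lia.
  by rewrite inE eqxx.
have szs : (size (flatten (C_faces n m)) <= size (up 1 N ++ down 1 N))%N.
  by rewrite szf size_cat !size_map size_rev size_iota addnn.
have [_ eqs] := uniq_min_size us sub szs.
apply/and4P; split=> //; first exact: leq_size_uniq us sub szs.
- rewrite -eqs mem_cat; apply/norP; split; apply/mapP => -[k];
  by rewrite ?mem_rev mem_iota; lia.
- apply/allP => x; rewrite -!eqs !mem_cat => /orP[] /mapP[k];
  rewrite ?mem_rev mem_iota => kN ->; first by rewrite memdown kN orbT.
  by rewrite opprK memup kN.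
Qed.

(** The cycles 1, ..., a and 1, a + 1, ..., a + b - 1 glued along the edge 1. *)
Definition glued_faces (a b : nat) : seq (seq int) :=
  [:: down 2 a.-1 ++ down a.+1 b.-1; up 1 a; -1 :: up a.+1 b.-1].

Notation code fs := (FaceCode (face_list := fs) isT).

Definition K3_1 := C_ 3 1.
Definition K4_1 := C_ 3 2.
Definition K5_1 := C_ 5 1.
Definition K5_2 := C_ 4 2.
Definition K6_1 := C_ 5 2.
Definition K6_2 := code (glued_faces 3 4).
Definition K6_3 := code
  [:: [:: -3; -6; -5; -4]; [:: 1; 2; 3]; [:: -1; 4; 5]; [:: -2; 6]].
Definition K7_1 := C_ 7 1.
Definition K7_2 := C_ 6 2.
Definition K7_3 := C_ 5 3.
Definition K7_4 := code (glued_faces 4 4).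
Definition K7_5 := code
  [:: [:: -3; -2; -6; -5; -4]; [:: 1; 2; 3]; [:: -1; 7]; [:: -7; 4; 5; 6]].
Definition K7_6 := code
  [:: [:: -3; -2; -6; -5; -7]; [:: 1; 2; 3]; [:: -1; 4; 5; 6]; [:: -4; 7]].
Definition K7_7 := code
  [:: [:: -5; -4; -3; -2; -1]; [:: 1; 2; -6]; [:: 6; 3; -7]; [:: 7; 4; 5]].
Definition K8_1 := C_ 7 2.
Definition K8_2 := code (glued_faces 3 6).
Definition K8_3 := C_ 5 4.
Definition K8_4 := code
  [:: [:: -8; -5; -4]; [:: 1; 5; 6];
      [:: -1; 2]; [:: -2; 3]; [:: -3; 4]; [:: -6; 7]; [:: -7; 8]].

(** The paths are 1 2 3, 4 5 6 and 7 8; the outer face is bounded by a path of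
    length 3 and that of length 2, or by the two paths of length 3. *)
Definition K8_5 := code
  [:: [:: 7; 8; -3; -2; -1]; [:: 1; 2; 3; -6; -5; -4]; [:: 4; 5; 6; -8; -7]].
Definition K8_5_alt := code
  [:: [:: 4; 5; 6; -3; -2; -1]; [:: 1; 2; 3; -8; -7]; [:: 7; 8; -6; -5; -4]].

(** Only used for p <> 0. *)
Definition twist (p : int) : face_code :=
  if 0 < p then C_ (2 * `|p|) 2 else C_ (2 * `|p|).+1 2.

Definition torus2 (p : nat) : face_code := C_ (2 * p).+1 1.

(* Main.v *)
(** Both series are values of one multisum: a plane graph G with an outer face
    and a base vertex whose variables are 0, where G is the Tait graph for K (the
    base vertex being F* ) and its dual for -K (the outer face being F* ).  In all
    cases G is outerplanar, built from a single edge by gluing bigons and polygons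
    along outer edges, and every polygon can be glued along an edge at the base
    vertex.  The new variables can then be summed first: an n-gon contributes the
    factor h_n, a bigon (by the Durfee square identity) the factor 1, and the
    single edge contributes 1 by Euler's identity.

    For the n-gon, let u be the variable of the second end of the edge.  Summing
    along the path of new vertices gives functions of u and of the face variable a
    which satisfy a recurrence shifting u and a; it implies that the whole sum does
    not depend on u.  Letting u tend to infinity leaves only a = 0, and expanding
    in the values at u = 0 turns the path into an iterated sum of Bailey type,
    which is diagonalized with eigenvalues (-1)^N q^(N(N+1)/2). *)

Require Import Defs.
From mathcomp Require Import boolp classical_sets functions cardinality fsbigop.
From mathcomp Require Import all_boot all_order all_fingroup all_algebra archimedean.
From mathcomp Require Import zify ring lra.

Set Implicit Arguments.
Unset Strict Implicit.
Unset Printing Implicit Defensive.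

Import Order.TTheory GRing.Theory Num.Theory.
Local Open Scope ring_scope.

(** A glued piece can be summed first only where the variables at its attaching vertices are
    nonnegative: the polygon and bigon identities are available for natural [u], and a power of q
    splits into a product only if both exponents are nonnegative, since negative powers count as 0.
    Outerplanarity provides both. Every vertex lies on the outer face, whose variable is 0, so the
    corner there forces the vertex variable to be nonnegative wherever the term is nonzero, and then
    each piece has a nonnegative exponent of its own. This is why [sys_inv] carries much more than
    the value of the sum.

    The exponent Q' + L' is defined by counts of common edges and vertices, which change when pieces
    are glued. Rewritten as a sum over corners, crossings and faces, it becomes additive, and gluing
    becomes concatenation of lists, [sysD]. The passage from the medial graph to such lists is made
    once, through numerical labels of the faces. For a given diagram it remains to compare finite
    lists up to permutation, by computation; only the cycles, whose length is a parameter, need an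
    argument. *)

(** * Unordered sums of power series *)

Section Sums.
Implicit Types (I J : choiceType).

Lemma fcoef_sum_seq I (A : set I) F n (r : seq I) :
  uniq r -> (forall i, i \in r -> A i) ->
  (forall i, A i -> i \notin r -> fcoef (F i) n = 0) ->
  fcoef (fps_sum A F) n = \sum_(i <- r) fcoef (F i) n.
Proof.
move=> ur rA F0; rewrite /= (fsbigE r)//.
by rewrite big_seq_cond [RHS]big_seq_cond; apply: eq_bigl => i;
  case: (boolP (i \in r)) => //= ir; rewrite mem_set//; exact: rA.
Qed.

(** One finite list serves all coefficients up to n at once. Products need this, because a
    coefficient of a product involves all lower coefficients of the factors. *)
Lemma summable_seq I (A : set I) F (n : nat) : fps_summable A F ->
  exists r : seq I, [/\ uniq r, forall i, i \in r -> A i &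
    forall i k, A i -> (k <= n)%N -> i \notin r -> fcoef (F i) k = 0].
Proof.
move=> sF; elim: n => [|n [r [ur rA rF]]].
  have /finite_seqP[r rE] := sF 0%N.
  exists (undup r); split=> [||i k Ai]; first exact: undup_uniq.
    by move=> i; rewrite mem_undup => ir; have [] : [set i | A i /\ fcoef (F i) 0 != 0]%classic i by rewrite rE.
  rewrite leqn0 mem_undup => /eqP -> ir; apply: contraNeq ir => Fi.
  by have : [set i | A i /\ fcoef (F i) 0 != 0]%classic i by []; rewrite rE.
have /finite_seqP[s sE] := sF n.+1.
exists (undup (r ++ s)); split=> [||i k Ai]; first exact: undup_uniq.
  move=> i; rewrite mem_undup mem_cat => /orP[/rA//|iss].
  by have [] : [set i | A i /\ fcoef (F i) n.+1 != 0]%classic i by rewrite sE.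
rewrite leq_eqVlt mem_undup mem_cat negb_or => /orP[/eqP->|kn] /andP[ir iss].
  apply: contraNeq iss => Fi.
  by have : [set i | A i /\ fcoef (F i) n.+1 != 0]%classic i by []; rewrite sE.
exact: rF.
Qed.

Lemma seq_summable I (A : set I) (F : I -> fps) :
  (forall n, exists r : seq I, forall i, A i -> fcoef (F i) n != 0 -> i \in r) ->
  fps_summable A F.
Proof.
move=> rF n; have [r rFn] := rF n.
by apply: (sub_finite_set _ (finite_seq r)) => i [Ai Fi] /=; exact: rFn.
Qed.

Lemma fcoefM_eq0 f g n :
  (forall k l, (k + l = n)%N -> fcoef f k = 0 \/ fcoef g l = 0) -> fcoef (f * g) n = 0.
Proof.
move=> fg; rewrite fcoefM big1// => -[i /= ltin] _.
have /fg[->|->] : (i + (n - i) = n)%N by lia.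
  by rewrite mul0r.
by rewrite mulr0.
Qed.

Lemma eq_fps_sum I (A : set I) F G :
  (forall i, A i -> F i = G i) -> fps_sum A F = fps_sum A G.
Proof.
move=> FG; apply: fpsP => n /=; apply: eq_fsbigr => i.
by move=> /set_mem/FG ->.
Qed.

Lemma eq_summable I (A : set I) F G :
  (forall i, A i -> F i = G i) -> fps_summable A F -> fps_summable A G.
Proof.
move=> FG sF n; apply: sub_finite_set (sF n) => i [Ai Gi]; split=> //.
by rewrite FG.
Qed.

Lemma sub_summable I (A B : set I) F :
  (forall i, B i -> A i) -> fps_summable A F -> fps_summable B F.
Proof.
by move=> BA sF n; apply: sub_finite_set (sF n) => i [/BA].
Qed.

Lemma fps_sum0 I (A : set I) F : (forall i, A i -> F i = 0) -> fps_sum A F = 0.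
Proof.
by move=> F0; apply: fpsP => n /=; rewrite fsbig1// => i /F0 ->.
Qed.

Lemma fps_sum_widen I (A B : set I) F : (forall i, A i -> B i) ->
  (forall i, B i -> ~ A i -> F i = 0) -> fps_sum A F = fps_sum B F.
Proof.
move=> AB F0; apply: fpsP => n /=; apply: fsbig_widen => // i [Bi nAi] /=.
by rewrite F0.
Qed.

Lemma widen_summable I (A B : set I) F :
  (forall i, B i -> ~ A i -> F i = 0) -> fps_summable A F -> fps_summable B F.
Proof.
move=> F0 sF n; apply: sub_finite_set (sF n) => i [Bi Fi]; split=> //.
by apply: contrapT => /(F0 _ Bi) Fi0; rewrite Fi0 eqxx in Fi.
Qed.

Lemma fps_sum_reindex I J (h : I -> J) (A : set I) (B : set J) F :
  set_bij A B h -> fps_sum B F = fps_sum A (F \o h).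
Proof.
by move=> hb; apply: fpsP => n /=; rewrite (reindex_fsbig h A).
Qed.

Lemma reindex_summable I J (h : I -> J) (A : set I) (B : set J) F :
  set_bij A B h -> fps_summable A (F \o h) -> fps_summable B F.
Proof.
move=> [hA _ hs] sF n.
apply: sub_finite_set (finite_image h (sF n)) => j [Bj Fj].
by have [i Ai hi] := hs j Bj; exists i => //; split; rewrite //= hi.
Qed.

Lemma fps_sumD I (A : set I) F G : fps_summable A F -> fps_summable A G ->
  fps_sum A (fun i => F i + G i) = fps_sum A F + fps_sum A G.
Proof.
move=> sF sG; apply: fpsP => n.
have [r [ur rA rF]] := summable_seq n sF.
have [s [us sA ss]] := summable_seq n sG.
have urs := undup_uniq (r ++ s).
have rsA i : i \in undup (r ++ s) -> A i.
  by rewrite mem_undup mem_cat => /orP[/rA|/sA].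
have rs0 i : A i -> i \notin undup (r ++ s) -> fcoef (F i) n = 0 /\ fcoef (G i) n = 0.
  by rewrite mem_undup mem_cat negb_or => Ai /andP[ir iss]; split; [apply: rF|apply: ss].
rewrite fcoefD !(fcoef_sum_seq urs rsA).
- by rewrite -big_split.
- by move=> i Ai /rs0[].
- by move=> i Ai /rs0[].
- by move=> i Ai /rs0[]// ; rewrite fcoefD => -> ->.
Qed.

Lemma summableD I (A : set I) F G : fps_summable A F -> fps_summable A G ->
  fps_summable A (fun i => F i + G i).
Proof.
move=> sF sG; apply: seq_summable => n.
have [r [ur rA rF]] := summable_seq n sF.
have [s [us sA ss]] := summable_seq n sG.
exists (r ++ s) => i Ai; apply: contra_neqT; rewrite mem_cat negb_or fcoefD => /andP[ir iss].
by rewrite rF// ss.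
Qed.

Lemma fps_sumM I (A : set I) c F : fps_summable A F ->
  fps_sum A (fun i => c * F i) = c * fps_sum A F.
Proof.
move=> sF; apply: fpsP => n.
have [r [ur rA rF]] := summable_seq n sF.
rewrite (fcoef_sum_seq ur rA); last first.
  move=> i Ai ir; apply: fcoefM_eq0 => k l kl; right; apply: rF => //; lia.
rewrite fcoefM.
under [in LHS]eq_bigr do rewrite fcoefM.
rewrite exchange_big; apply: eq_bigr => k _.
rewrite (@fcoef_sum_seq _ A F (n - k)%N r)// ?mulr_sumr//.
by move=> i Ai ir; apply: rF => //; lia.
Qed.

Lemma summableM I (A : set I) c F : fps_summable A F ->
  fps_summable A (fun i => c i * F i).
Proof.
move=> sF; apply: seq_summable => n; have [r [ur rA rF]] := summable_seq n sF.
exists r => i Ai; apply: contra_neqT => ir.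
by apply: fcoefM_eq0 => k l kl; right; apply: rF => //; lia.
Qed.

Lemma fps_sum1 I (A : set I) F i : A i -> (forall j, A j -> j <> i -> F j = 0) ->
  fps_sum A F = F i.
Proof.
move=> Ai F0; apply: fpsP => n; rewrite (@fcoef_sum_seq _ A F n [:: i]) ?big_seq1//.
  by move=> j; rewrite inE => /eqP ->.
by move=> j Aj; rewrite inE => /eqP/F0->.
Qed.

(** Fubini over the fibers of [p]. Only finitely many indices matter for a given coefficient, so the
    claim reduces to exchanging two finite sums. *)
Lemma fps_sum_fiber I J (A : set I) (B : set J) (p : I -> J) F :
  fps_summable A F -> (forall i, A i -> B (p i)) ->
  fps_sum A F = fps_sum B (fun j => fps_sum [set i | A i /\ p i = j]%classic F).
Proof.
move=> sF pB; apply: fpsP => n.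
have [r [ur rA rF]] := summable_seq n sF.
have up : uniq (undup (map p r)) by exact: undup_uniq.
have inner j : fcoef (fps_sum [set i | A i /\ p i = j]%classic F) n =
    \sum_(i <- r) if p i == j then fcoef (F i) n else 0.
  rewrite (@fcoef_sum_seq _ _ _ _ [seq i <- r | p i == j]).
  - by rewrite big_filter big_mkcond.
  - by rewrite filter_uniq.
  - by move=> i; rewrite mem_filter => /andP[/eqP ? /rA].
  - move=> i [Ai /eqP pi]; rewrite mem_filter pi /= => ir; exact: rF.
rewrite (fcoef_sum_seq ur rA); last by move=> *; apply: rF.
rewrite (@fcoef_sum_seq _ _ _ _ _ up).
- under [RHS]eq_bigr do rewrite inner.
  rewrite exchange_big /= big_seq [RHS]big_seq; apply: eq_bigr => i ir.
  rewrite (bigD1_seq (p i)) ?mem_undup ?map_f//= eqxx big1 ?addr0// => j.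
  by rewrite eq_sym => /negbTE ->.
- by move=> j; rewrite mem_undup => /mapP[i /rA/pB Bi ->].
- move=> j Bj; rewrite mem_undup => jr; rewrite inner big_seq big1// => i ir.
  by case: eqP => // pij; rewrite -pij map_f in jr.
Qed.

(* A finite number of indices of [B] matter for each coefficient, and then
   finitely many in each fiber. *)
Lemma summable_fiberM I J (A : set I) (B : set J) (p : I -> J) F G :
  (forall i, A i -> B (p i)) -> fps_summable B F ->
  (forall j, B j -> fps_summable [set i | A i /\ p i = j]%classic G) ->
  fps_summable A (fun i => F (p i) * G i).
Proof.
move=> pB sF sG; apply: seq_summable => n.
have [r [ur rB rF]] := summable_seq n sF.
have /choice[t tP] : forall j, exists t : seq I, B j -> forall i, A i -> p i = j ->
    i \notin t -> forall k, (k <= n)%N -> fcoef (G i) k = 0.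
  move=> j.
  case: (pselect (B j)) => [Bj|//]; last by exists [::].
  have [s [us sA ss]] := summable_seq n (sG j Bj).
  by exists s => _ i Ai pij ij k kn; apply: ss.
exists (flatten (map t r)) => i Ai; apply: contra_neqT => ir.
apply: fcoefM_eq0 => k l kl; case: (boolP (p i \in r)) => pir.
  right; apply: (tP (p i)) => //; first exact: pB.
    by apply: contraNN ir => it; apply/flatten_mapP; exists (p i).
  lia.
by left; apply: rF => //; [exact: pB|lia].
Qed.

Lemma fps_sum_pair I J (F : I -> J -> fps) :
  fps_summable [set: I * J]%classic (fun ij => F ij.1 ij.2) ->
  fps_sum [set: I * J]%classic (fun ij => F ij.1 ij.2) =
  fps_sum [set: I]%classic (fun i => fps_sum [set: J]%classic (F i)).
Proof.
move=> sF; rewrite (@fps_sum_fiber _ _ _ [set: I]%classic fst)//.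
apply: eq_fps_sum => i _.
rewrite (@fps_sum_reindex J _ (fun j => (i, j)) [set: J]%classic)//.
split=> [j _ //|j k _ _ []//|[i' j] [_ /= ->]]; by exists j.
Qed.

End Sums.

(** * Series indexed by the natural numbers *)

Notation nsum F := (fps_sum [set: nat]%classic F).
Notation nsummable F := (fps_summable [set: nat]%classic F).

Section NatSums.
Implicit Types F G : nat -> fps.

Lemma nsumS F : nsummable F -> nsum F = F 0%N + nsum (fun n => F n.+1).
Proof.
move=> sF; rewrite (@fps_sum_fiber _ _ _ [set: bool]%classic (fun n => n == 0%N))//.
apply: fpsP => n; rewrite (@fcoef_sum_seq _ _ _ _ [:: true; false])//; last by case.
rewrite big_cons big_seq1 fcoefD; congr (fcoef _ _ + fcoef _ _).
  rewrite (@fps_sum1 _ _ _ 0%N)// => j [_ /eqP -> //].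
apply/fps_sum_reindex; split=> [j _ //|j k _ _ []//|[|j] [_]//= _]; by exists j.
Qed.

Lemma nsummableS F : nsummable F -> nsummable (fun n => F n.+1).
Proof.
move=> sF; apply: seq_summable => n; have [r [_ _ rF]] := summable_seq n sF.
exists (map predn r) => i _; apply: contra_neqT => ir; apply: rF => //.
by apply: contraNN ir => ir; rewrite -[i]/(i.+1.-1) map_f.
Qed.

Lemma nsummable_shift F : nsummable (fun n => F n.+1) -> nsummable F.
Proof.
move=> sF; apply: seq_summable => n; have [r [_ _ rF]] := summable_seq n sF.
exists (0%N :: map succn r) => -[_ _ //|i _]; apply: contra_neqT.
rewrite inE /= => ir; apply: rF => //.
by apply: contraNN ir => ir; rewrite map_f.
Qed.

Lemma eq_nsum F G : F =1 G -> nsum F = nsum G.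
Proof. by move=> FG; apply: eq_fps_sum. Qed.

Lemma nsumD F G : nsummable F -> nsummable G ->
  nsum (fun n => F n + G n) = nsum F + nsum G.
Proof. exact: fps_sumD. Qed.

Lemma nsumM c F : nsummable F -> nsum (fun n => c * F n) = c * nsum F.
Proof. exact: fps_sumM. Qed.

Lemma nsumB F G : nsummable F -> nsummable G ->
  nsum (fun n => F n - G n) = nsum F - nsum G.
Proof.
move=> sF sG; rewrite -mulN1r -nsumM// -nsumD//; last exact: summableM.
by apply: eq_nsum => n; rewrite mulN1r.
Qed.

Lemma nsummableB F G : nsummable F -> nsummable G -> nsummable (fun n => F n - G n).
Proof.
move=> sF sG; apply: (@eq_summable _ _ (fun n => F n + -1 * G n)).
  by move=> n _; rewrite mulN1r.
by apply: summableD => //; apply: summableM.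
Qed.

Lemma nsum_telescope F : nsummable F -> nsum (fun n => F n - F n.+1) = F 0%N.
Proof.
by move=> sF; rewrite nsumB//; [rewrite [nsum F]nsumS// addrK|exact: nsummableS].
Qed.

End NatSums.

(** * Order of vanishing *)

Definition ordge (k : nat) (f : fps) := forall n, (n < k)%N -> fcoef f n = 0.

Lemma ordgeM k l f g : ordge k f -> ordge l g -> ordge (k + l) (f * g).
Proof.
move=> kf lg n nkl; apply: fcoefM_eq0 => i j ij.
by case: (ltnP i k) => ik; [left; apply: kf|right; apply: lg; lia].
Qed.

Lemma ordgeMl k f g : ordge k f -> ordge k (f * g).
Proof. by move=> kf; rewrite -[k]addn0; apply: ordgeM. Qed.

Lemma ordgeMr k f g : ordge k g -> ordge k (f * g).
Proof. by rewrite mulrC; apply: ordgeMl. Qed.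

Lemma ordgeD k f g : ordge k f -> ordge k g -> ordge k (f + g).
Proof. by move=> kf kg n nk; rewrite fcoefD kf// kg. Qed.

Lemma ordgeN k f : ordge k f -> ordge k (- f).
Proof. by move=> kf n nk; rewrite fcoefN kf// oppr0. Qed.

Lemma ordge_le k l f : (l <= k)%N -> ordge k f -> ordge l f.
Proof. by move=> lk kf n nl; apply: kf; lia. Qed.

Lemma ordgeX k : ordge k (fpsX k).
Proof. by move=> n nk /=; case: eqP => // nk'; lia. Qed.

Lemma ordge_sum (I : choiceType) k (A : set I) F :
  (forall i, A i -> ordge k (F i)) -> ordge k (fps_sum A F).
Proof. by move=> kF n nk /=; rewrite fsbig1// => i /kF; apply. Qed.

Lemma ordge_eq f g : (forall k, ordge k (f - g)) -> f = g.
Proof.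
move=> fg; apply: fpsP => n; apply/eqP; rewrite -subr_eq0 -fcoefB; apply/eqP.
exact: (fg n.+1).
Qed.

Lemma ordge_nsummable (F : nat -> fps) : (forall n, ordge n (F n)) -> nsummable F.
Proof.
move=> oF; apply: seq_summable => n; exists (iota 0 n.+1) => i _.
by apply: contra_neqT; rewrite mem_iota /= -leqNgt => ni; apply: oF.
Qed.

Lemma ordge_summable2 (F : nat -> nat -> fps) : (forall m n, ordge (m + n) (F m n)) ->
  fps_summable [set: nat * nat]%classic (fun x => F x.1 x.2).
Proof.
move=> oF; apply: seq_summable => n.
exists [seq (i, j) | i <- iota 0 n.+1, j <- iota 0 n.+1] => -[i j] _ Fij.
have lein : (i + j <= n)%N.
  by rewrite leqNgt; apply: contraNN Fij => ?; apply/eqP/oF.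
by apply/allpairsP; exists (i, j); rewrite !mem_iota; split=> //=; lia.
Qed.
(** * Powers of q and q-factorials *)

Arguments fpsX n%_N.
Arguments qpoch n%_N.

Local Notation X := fpsX.

Lemma fpsX0 : X 0 = 1. Proof. by []. Qed.

Lemma fpsXD m n : X (m + n) = X m * X n.
Proof.
apply: fpsP => k; rewrite fcoefM /=.
case: (leqP m k) => mk.
  rewrite (bigD1 (Ordinal (mk : (m < k.+1)%N)))//= eqxx mul1r big1.
    by rewrite addr0; congr (_%:R); congr nat_of_bool; apply/eqP/eqP; lia.
  by move=> i; rewrite -val_eqE /= => /negbTE ->; rewrite mul0r.
rewrite big1 => [|[i ik] _ /=]; first by case: eqP => //; lia.
by case: eqP => [|_]; [lia|rewrite mul0r].
Qed.

Lemma fpsXM m n : X (m * n) = X m ^+ n.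
Proof. by elim: n => [|n IHn]; [rewrite muln0 expr0|rewrite mulnS fpsXD IHn exprS]. Qed.

Definition q : fps := X 1.

Lemma fpsXS n : X n.+1 = q * X n. Proof. by rewrite -add1n fpsXD. Qed.

Definition fpsXE := (mulnS, mulSn, mulnDl, mulnDr, addnS, addSn, fpsXD, fpsXS, fpsX0).

Local Notation iq n := ((qpoch n)^-1).
Local Notation qoo := qpoch_oo.

Lemma fcoef_unit f : fcoef f 0 = 1 -> f \is a GRing.unit.
Proof. by move=> f1; change (is_true (fcoef f 0 \is a GRing.unit)); rewrite f1 unitr1. Qed.

Lemma fcoef0M f g : fcoef (f * g) 0 = fcoef f 0 * fcoef g 0.
Proof. by rewrite fcoefM big_ord1. Qed.

Lemma qpoch0 : qpoch 0 = 1. Proof. by rewrite /qpoch big_nil. Qed.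

Lemma qpochS n : qpoch n.+1 = qpoch n * (1 - X n.+1).
Proof. by rewrite /qpoch big_nat_recr. Qed.

Lemma fcoef0_qpoch n : fcoef (qpoch n) 0 = 1.
Proof.
by elim: n => [|n IHn]; rewrite ?qpoch0// qpochS fcoef0M IHn mul1r fcoefB.
Qed.

Lemma qpoch_unit n : qpoch n \is a GRing.unit.
Proof. exact/fcoef_unit/fcoef0_qpoch. Qed.

Lemma qoo_unit : qoo \is a GRing.unit.
Proof. exact/fcoef_unit/fcoef0_qpoch. Qed.

Local Hint Resolve qpoch_unit qoo_unit : core.

Lemma iq0 : iq 0 = 1. Proof. by rewrite qpoch0 invr1. Qed.

Lemma subX_unit n : 1 - X n.+1 \is a GRing.unit.
Proof. by apply: fcoef_unit; rewrite fcoefB. Qed.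

Lemma iqS n : iq n = (1 - X n.+1) * iq n.+1.
Proof.
by rewrite qpochS invrM ?subX_unit// mulrA mulrV ?subX_unit ?mul1r.
Qed.

Lemma qooV : qoo * qoo^-1 = 1. Proof. by rewrite mulrV. Qed.

(** Congruence modulo q^k. Together with [ordge_eq] it replaces limits in the q-adic topology. *)
Definition cong k f g := ordge k (f - g).

Lemma congxx k f : cong k f f.
Proof. by move=> n _; rewrite subrr. Qed.

Lemma cong_sym k f g : cong k f g -> cong k g f.
Proof. by move=> /ordgeN; rewrite /cong opprB. Qed.

Lemma cong_trans k g f h : cong k f g -> cong k g h -> cong k f h.
Proof. by move=> fg /(ordgeD fg); rewrite addrA subrK. Qed.

Lemma congM k f f' g g' : cong k f f' -> cong k g g' -> cong k (f * g) (f' * g').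
Proof.
move=> ff gg; have -> : f * g = f * g - f * g' + f * g' by ring.
rewrite /cong -addrA -mulrBr -mulrBl.
by apply: ordgeD; [apply: ordgeMr|apply: ordgeMl].
Qed.

Lemma cong_le k l f g : (l <= k)%N -> cong k f g -> cong l f g.
Proof. exact: ordge_le. Qed.

Lemma congV k f g : f \is a GRing.unit -> g \is a GRing.unit ->
  cong k f g -> cong k f^-1 g^-1.
Proof.
move=> uf ug /cong_sym fg; rewrite /cong.
have -> : f^-1 - g^-1 = f^-1 * g^-1 * (g - f).
  by rewrite mulrBr -mulrA mulVr// mulr1 mulrAC mulVr// mul1r.
exact: ordgeMr.
Qed.

Lemma cong_qpochS m n k : (m <= n)%N -> (k <= m.+1)%N -> cong k (qpoch n) (qpoch m).
Proof.
move=> + km; elim: n => [|n IHn]; first by rewrite leqn0 => /eqP ->; apply: congxx.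
rewrite leq_eqVlt => /orP[/eqP ->|]; first exact: congxx.
rewrite ltnS => mn; apply: cong_trans (IHn mn).
rewrite /cong qpochS mulrBr mulr1 addrAC subrr add0r; apply/ordgeN/ordgeMr.
by apply: ordge_le (@ordgeX _); lia.
Qed.

Lemma cong_qoo n : cong n.+1 qoo (qpoch n).
Proof.
move=> k kn; rewrite fcoefB /=.
have := @cong_qpochS k n k.+1; rewrite -ltnS => /(_ kn (leqnn _)) /(_ k (ltnSn k)).
by rewrite fcoefB => /eqP; rewrite subr_eq0 => /eqP ->; rewrite subrr.
Qed.

Lemma cong_iq n : cong n.+1 (iq n) qoo^-1.
Proof. by apply: congV => //; apply/cong_sym/cong_qoo. Qed.

(** As a function of [a] the sum satisfies the recurrence of (q)_a, and it tends to 1 as [a] grows.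
    Comparing limits gives the value 1/(q)_oo at a = 0. *)
Lemma euler_sum a : nsum (fun j => X (a.+1 * j) * iq j) = qpoch a / qoo.
Proof.
have sE b : nsummable (fun j => X (b.+1 * j) * iq j).
  by apply: ordge_nsummable => j; apply: ordgeMl; apply: ordge_le (@ordgeX _); lia.
pose e b := nsum (fun j => X (b.+1 * j) * iq j).
have eS b : e b.+1 = (1 - X b.+1) * e b.
  suff eB : e b - e b.+1 = X b.+1 * e b by rewrite -[e b.+1](subKr (e b)) eB; ring.
  (* The difference of the summands contains 1 - q^j, which kills the term j = 0 and lowers (q)_j by
     one factor; shifting j then leaves the factor q^(b+1). *)
  rewrite -nsumB// -nsumM// nsumS//; last exact: nsummableB.
  rewrite !muln0 subrr add0r; apply: eq_nsum => j.
  by rewrite (iqS j) !fpsXE; ring.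
have eq a' : e a' = qpoch a' * e 0%N.
  elim: a' => [|b IHb]; first by rewrite qpoch0 mul1r.
  by rewrite eS IHb qpochS; ring.
have e1 b : cong b.+1 (e b) 1.
  rewrite /cong /e nsumS// muln0 iq0 mulr1 addrAC fpsX0 subrr add0r.
  by apply: ordge_sum => j _; apply: ordgeMl; apply: ordge_le (@ordgeX _); nia.
have e0 : qoo * e 0%N = 1.
  apply: ordge_eq => k; apply: (@cong_le k.+1)=> //.
  apply: cong_trans (e1 k); rewrite [e k]eq; apply: congM; [exact: cong_qoo|exact: congxx].
rewrite -/(e a) eq; congr (_ * _).
by rewrite -[LHS]mul1r -(mulVr qoo_unit) -mulrA e0 mulr1.
Qed.

(** * Polygon sums *)

Definition qtri (a : nat) : fps := (-1) ^+ a * X 'C(a.+1, 2).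
Definition qbin2 (a : nat) : fps := (-1) ^+ a * X 'C(a, 2).

Lemma qtriS a : qtri a.+1 = - (X a.+1 * qtri a).
Proof. by rewrite /qtri binS bin1 addnC fpsXD exprS; ring. Qed.

Lemma qbin2S a : qbin2 a.+1 = - (X a * qbin2 a).
Proof. by rewrite /qbin2 binS bin1 addnC fpsXD exprS; ring. Qed.

Lemma qtriE a : qtri a = X a * qbin2 a.
Proof. by rewrite /qtri /qbin2 binS bin1 addnC fpsXD; ring. Qed.

Lemma ordge_qtri a : ordge a (qtri a).
Proof. by rewrite qtriE; apply/ordgeMl/ordgeX. Qed.

(** The initial value is the kernel of the identity for the weight
    q^((a + 1) s) / ((q)_s (q)_(a + s)), so that [chain_rec] holds from m = 0 on. *)
Fixpoint chain m a u : fps :=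
  if m is m'.+1 then
    qtri a * nsum (fun s => X ((u + a).+1 * s) * iq s * iq (a + s) * chain m' a s)
  else if u == 0%N then qpoch a else 0.

Lemma chain_summable a u F :
  nsummable (fun s => X ((u + a).+1 * s) * iq s * iq (a + s) * F s).
Proof.
apply: ordge_nsummable => s; rewrite -!mulrA; apply: ordgeMl.
by apply: ordge_le (@ordgeX _); lia.
Qed.

(** Induction on m. Raising [u] multiplies the summand by q^s, and the factor 1 - q^s of the
    difference lowers (q)_s. After shifting s, the recurrence for m expresses the summand through
    those with parameters a and a + 1, that is, through S a and S a.+1. *)
Lemma chain_rec m a u :
  chain m a u.+1 = (1 - X (u + a).+1) * chain m a u - X u * chain m a.+1 u.
Proof.
elim: m a u => [|m IHm] a u.
  by case: u => [|u] /=; rewrite ?fpsX0 ?mulr0 ?qpochS ?subr0// add0n; ring.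
pose S b := nsum (fun s => X ((u + b).+1 * s) * iq s * iq (b + s) * chain m b s).
have E b : chain m.+1 b u = qtri b * S b by [].
rewrite !E qtriS /= addSn.
pose S' := nsum (fun s => X ((u + a).+2 * s) * iq s * iq (a + s) * chain m a s).
suff SS : S a - S' = X (u + a).+1 * (S a - S a.+1).
  rewrite -/S' -[S'](subKr (S a)) SS !fpsXE; ring.
have sS b := @chain_summable b u (chain m b).
have sS1 := @chain_summable a u.+1 (chain m a); rewrite addSn in sS1.
rewrite -nsumB// -nsumB// -nsumM//; last exact: nsummableB.
rewrite nsumS//; last exact: nsummableB.
rewrite !muln0 subrr add0r; apply: eq_nsum => s.
rewrite IHm (iqS s) addnS (iqS (a + s)) [(s + a)%N]addnC !fpsXE; ring.
Qed.

(** The polygon has m + 1 edges, and u is the variable of the end of the glued edge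
    other than the base vertex. *)
Definition polysum m u : fps :=
  qoo ^+ m * nsum (fun a => qbin2 a * X (a * u) * iq (a + u) * iq a * chain m a u).

Lemma ordge_chain m a u : (0 < m)%N -> ordge a (chain m a u).
Proof. by case: m => // m _; apply/ordgeMl/ordge_qtri. Qed.

Lemma polysum_summable m u : (0 < m)%N ->
  nsummable (fun a => qbin2 a * X (a * u) * iq (a + u) * iq a * chain m a u).
Proof. by move=> m0; apply: ordge_nsummable => a; apply/ordgeMr/ordge_chain. Qed.

(** Write 1 = q^a + (1 - q^a) in the sum at u and shift a in the second part. By [chain_rec] the two
    parts add up, term by term, to the sum at u + 1. *)
Lemma polysumS m u : (0 < m)%N -> polysum m u.+1 = polysum m u.
Proof.
move=> m0; rewrite /polysum; congr (_ * _).
pose t a := qbin2 a * X (a * u) * iq (a + u) * iq a * chain m a u.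
have st : nsummable t by apply: polysum_summable.
have sqt : nsummable (fun a => X a * t a) by exact: summableM.
have s1t : nsummable (fun a => (1 - X a) * t a) by exact: summableM.
have s1tS : nsummable (fun a => (1 - X a.+1) * t a.+1) by exact: nsummableS s1t.
have -> : nsum t = nsum (fun a => X a * t a + (1 - X a) * t a).
  by apply: eq_nsum => a; ring.
rewrite nsumD// [X in _ = _ + X]nsumS// fpsX0 subrr mul0r add0r -nsumD//.
apply: eq_nsum => a; rewrite chain_rec /t qbin2S.
by rewrite addnS addSn (iqS (a + u)) (iqS a) ![(u + a)%N]addnC !fpsXE; ring.
Qed.

Lemma cong_nsum0 k F : nsummable F -> (forall a, ordge k (F a.+1)) ->
  cong k (nsum F) (F 0%N).
Proof.
move=> sF oF; rewrite /cong nsumS// addrAC subrr add0r.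
by apply: ordge_sum => a _; apply: oF.
Qed.

(** As u grows, only the terms with a = 0 and with the first variable of the
    chain equal to 0 survive. *)
Lemma polysumE m u : polysum m.+1 u = qoo ^+ m * chain m 0 0.
Proof.
have pc n : polysum m.+1 n = polysum m.+1 0.
  by elim: n => // n IHn; rewrite polysumS.
rewrite pc; apply: ordge_eq => k; rewrite -(pc k) -/(cong _ _ _).
(* The surviving term has the factor 1/(q)_k, whose limit 1/(q)_oo cancels one of the m + 1 factors
   (q)_oo. *)
have -> : qoo ^+ m * chain m 0 0 = qoo ^+ m.+1 * (qoo^-1 * chain m 0 0).
  by rewrite exprSr -mulrA [qoo * _]mulrA qooV mul1r.
apply: congM; first exact: congxx.
apply: cong_trans (cong_nsum0 (polysum_summable k _) _) _ => //.
  by move=> a; rewrite [qbin2 _ * _]mulrC -!mulrA; apply: ordgeMl; apply: ordge_le (@ordgeX _); exact: leq_pmull.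
have -> : qbin2 0 = 1 by rewrite /qbin2 expr0 mul1r.
rewrite mul0n fpsX0 !mul1r iq0 mulr1 add0n.
apply: congM; first by apply: cong_le (@cong_iq k).
rewrite /= [qtri 0]/qtri expr0 fpsX0 !mul1r addn0.
have s := @chain_summable 0 k (chain m 0).
rewrite addn0 in s.
apply: cong_trans (cong_nsum0 s _) _.
  by move=> a; rewrite -!mulrA; apply: ordgeMl; apply: ordge_le (@ordgeX _); nia.
by rewrite muln0 iq0 fpsX0 !mul1r; apply: congxx.
Qed.

(** * Diagonalization of the iterated sum *)

Definition qbin n k : fps := if (k <= n)%N then qpoch n * iq k * iq (n - k) else 0.

Lemma qbinSS n k : qbin n.+1 k.+1 = qbin n k.+1 + X (n - k) * qbin n k.
Proof.
rewrite /qbin ltnS; case: (ltngtP k n) => [kn|nk|->]; [|by rewrite mulr0 addr0|]; last first.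
  by rewrite !subnn iq0 fpsX0 mul1r !mulr1 !mulrV// add0r.
rewrite subSS; have -> : (n - k = (n - k.+1).+1)%N by lia.
rewrite qpochS (iqS k) (iqS (n - k.+1)).
have -> : X n.+1 = X k.+1 * X (n - k.+1).+1 by rewrite -fpsXD; congr X; lia.
ring.
Qed.

Lemma qbin0 n : qbin n 0 = 1.
Proof. by rewrite /qbin subn0 iq0 mulr1 mulrV. Qed.

(** Dividing [chain_rec] by (q)_(u+a+1), the left-hand side g(a, u) satisfies g(a, u + 1) = g(a, u)
    - q^u g(a + 1, u). So it is the u-th q-difference in a of its values at u = 0. *)
Lemma chain_expand m a u : chain m a u * iq (u + a) =
  \sum_(k < u.+1) (-1) ^+ k * X 'C(k, 2) * qbin u k * (chain m (a + k) 0 * iq (a + k)).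
Proof.
elim: u a => [|u IHu] a.
  by rewrite big_ord1 expr0 !mul1r qbin0 mul1r addn0.
have -> : chain m a u.+1 * iq (u.+1 + a) =
    chain m a u * iq (u + a) - X u * (chain m a.+1 u * iq (u + a.+1)).
  by rewrite chain_rec (iqS (u + a)) addSn addnS; ring.
rewrite !IHu big_ord_recl [RHS]big_ord_recl !qbin0 -addrA; congr (_ + _).
have -> : \sum_(i < u) (-1) ^+ bump 0 i * X 'C(bump 0 i, 2) * qbin u (bump 0 i) *
      (chain m (a + bump 0 i) 0 * iq (a + bump 0 i)) =
    \sum_(i < u.+1) (-1) ^+ i.+1 * X 'C(i.+1, 2) * qbin u i.+1 *
      (chain m (a + i.+1) 0 * iq (a + i.+1)).
  by rewrite big_ord_recr /= {3}/qbin ltnn mulr0 mul0r addr0.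
rewrite mulr_sumr -sumrB; apply: eq_bigr => -[k /= ku] _.
rewrite /bump add1n qbinSS addSn addnS exprS binS bin1 addnC.
have -> : X u = X k * X (u - k) by rewrite -fpsXD subnKC.
by rewrite fpsXD; ring.
Qed.

Lemma nsum_diag (F : nat -> nat -> fps) :
  fps_summable [set: nat * nat]%classic (fun x => F x.1 x.2) ->
  nsum (fun k => nsum (F k)) = nsum (fun s => \sum_(k < s.+1) F k (s - k)%N).
Proof.
move=> sF; rewrite -fps_sum_pair// (@fps_sum_fiber _ _ _ [set: nat]%classic (fun x => x.1 + x.2)%N)//.
apply: eq_fps_sum => s _; apply: fpsP => n.
rewrite (@fcoef_sum_seq _ _ _ _ [seq (k, s - k)%N | k <- iota 0 s.+1]).
- rewrite big_map fcoef_sum.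
  by rewrite -[s.+1 in LHS]subn0 -/(index_iota 0 s.+1) big_mkord.
- by rewrite map_inj_uniq ?iota_uniq// => i j [].
- by move=> x /mapP[k]; rewrite mem_iota => /andP[_ ks] ->; split=> //=; lia.
- move=> [i j] [_ ijs] /negP[]; rewrite /= in ijs; apply/mapP; exists i; first by rewrite mem_iota; lia.
  by congr (_, _); lia.
Qed.

Lemma qtriD a k : qtri (a + k) = qtri a * ((-1) ^+ k * X 'C(k, 2) * X (a.+1 * k)).
Proof.
elim: k => [|k IHk]; first by rewrite addn0 expr0 muln0 !fpsX0 !mulr1.
rewrite addnS qtriS IHk binS bin1 exprS mulnS !fpsXE; ring.
Qed.

(** Normalized so that [phi 0] is constantly 1 and that passing from m to m + 1 applies one
    triangular operator, the same for all m. *)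
Definition phi m a : fps := qoo ^+ m * chain m a 0 * iq a.

(** Expand the inner chain by [chain_expand], put s = k + j and sum over j by Euler's identity. The
    resulting (q)_a/(q)_oo cancels against the prefactors. *)
Lemma phiS m a : phi m.+1 a = nsum (fun k => qtri (a + k) * iq k * phi m (a + k)).
Proof.
pose g b := chain m b 0 * iq b.
pose F k j := (-1) ^+ k * X 'C(k, 2) * X (a.+1 * (k + j)) * iq k * iq j * g (a + k)%N.
have FE k j : F k j = (-1) ^+ k * X 'C(k, 2) * X (a.+1 * k) * iq k * g (a + k)%N *
    (X (a.+1 * j) * iq j) by rewrite /F mulnDr fpsXD; ring.
have sF : fps_summable [set: nat * nat]%classic (fun x => F x.1 x.2).
  apply: ordge_summable2 => k j; rewrite /F; do 3!apply: ordgeMl.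
  by apply/ordgeMr; apply: ordge_le (@ordgeX _); nia.
have sE : nsummable (fun j => X (a.+1 * j) * iq j).
  by apply: ordge_nsummable => j; apply: ordgeMl; apply: ordge_le (@ordgeX _); nia.
have -> : phi m.+1 a = qoo ^+ m.+1 * qtri a * iq a *
    nsum (fun s => \sum_(k < s.+1) F k (s - k)%N).
  rewrite /phi /=; set S := fps_sum _ _; set S' := fps_sum _ _.
  suff -> : S = S' by ring.
  apply: eq_nsum => s; rewrite add0n.
  have -> : X (a.+1 * s) * iq s * iq (a + s) * chain m a s =
      X (a.+1 * s) * iq s * (chain m a s * iq (s + a)) by rewrite addnC; ring.
  rewrite chain_expand mulr_sumr; apply: eq_bigr => -[k /= ks] _.
  rewrite /F /qbin -ltnS ks subnKC//.
  have : qpoch s * iq s = 1 by rewrite mulrV.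
  rewrite -/(g _); move: (iq s) (qpoch s) => x y xy.
  by rewrite -[RHS]mul1r -xy; ring.
rewrite -nsum_diag//.
have -> : nsum (fun k => nsum (F k)) = nsum (fun k =>
    (qpoch a / qoo) * ((-1) ^+ k * X 'C(k, 2) * X (a.+1 * k) * iq k * g (a + k)%N)).
  apply: eq_nsum => k; rewrite (eq_nsum (FE k)) nsumM// euler_sum mulrC//.
rewrite -nsumM; last first.
  apply: summableM; apply: ordge_nsummable => k; do 2!apply: ordgeMl.
  by apply: ordgeMr; apply: ordge_le (@ordgeX _); nia.
apply: eq_nsum => k; rewrite qtriD /phi -/(g _) exprSr -[qoo ^+ m * _ * _]mulrA -/(g _).
have E1 : qpoch a * iq a = 1 by rewrite mulrV.
have E2 : qoo * qoo^-1 = 1 by exact: qooV.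
move: (qpoch a) (iq a) E1 (qoo^-1) E2 => y x xy z qz.
transitivity ((y * x) * (qoo * z) * (qtri a * ((-1) ^+ k * X 'C(k, 2) * X (a.+1 * k)) * iq k * (qoo ^+ m * g (a + k)%N))); first by ring.
by rewrite xy qz !mul1r /g; ring.
Qed.

Lemma qbinSS' n k : qbin n.+1 k.+1 = X k.+1 * qbin n k.+1 + qbin n k.
Proof.
rewrite /qbin ltnS; case: (ltngtP k n) => [kn|nk|->]; [|by rewrite mulr0 addr0|]; last first.
  by rewrite !subnn iq0 !mulr1 !mulrV// mulr0 add0r.
rewrite subSS; have -> : (n - k = (n - k.+1).+1)%N by lia.
rewrite qpochS (iqS k) (iqS (n - k.+1)).
have -> : X n.+1 = X k.+1 * X (n - k.+1).+1 by rewrite -fpsXD; congr X; lia.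
ring.
Qed.

(** The M-th q-difference in b of (q)_(N+b)/(q)_b, a product of N factors. Each difference removes
    one of the factors depending on b, whence the closed form [qdiffE]. *)
Definition qdiff M N b : fps := \sum_(i < M.+1)
  (-1) ^+ i * X 'C(M - i, 2) * qbin M i * (qpoch (N + b + i) * iq (b + i)).

Lemma qdiffS M N b : qdiff M.+1 N b = X M * qdiff M N b - qdiff M N b.+1.
Proof.
rewrite /qdiff big_ord_recl.
have -> : \sum_(i < M.+1) (-1) ^+ lift ord0 i * X 'C(M.+1 - lift ord0 i, 2) *
      qbin M.+1 (lift ord0 i) * (qpoch (N + b + lift ord0 i) * iq (b + lift ord0 i)) =
    \sum_(i < M.+1) (-1) ^+ i.+1 * X 'C(M - i, 2) * X i.+1 * qbin M i.+1 *
      (qpoch (N + b + i.+1) * iq (b + i.+1)) - \sum_(i < M.+1)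
     (-1) ^+ i * X 'C(M - i, 2) * qbin M i * (qpoch (N + b.+1 + i) * iq (b.+1 + i)).
  rewrite -sumrB; apply: eq_bigr => -[i /= iM] _.
  rewrite /bump add1n subSS qbinSS' exprS !addnS addSn; ring.
rewrite addrA; congr (_ - _).
have qb0 : qbin M M.+1 = 0 by rewrite /qbin ltnn.
rewrite big_ord_recr /= qb0 mulr0 mul0r addr0.
rewrite [in RHS]big_ord_recl mulrDr; congr (_ + _).
  by rewrite /= !subn0 binS bin1 !qbin0 addnC fpsXD; ring.
rewrite mulr_sumr; apply: eq_bigr => -[i /= iM] _.
rewrite /bump add1n.
have -> : 'C(M - i, 2) = ('C(M - i.+1, 2) + (M - i.+1))%N.
  have -> : (M - i = (M - i.+1).+1)%N by lia.
  by rewrite binS bin1.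
have -> : X M = X i.+1 * X (M - i.+1) by rewrite -fpsXD; congr X; lia.
by rewrite fpsXD; ring.
Qed.

Lemma qdiffE M N b : (M <= N)%N -> qdiff M N b =
  (-1) ^+ M * X (M * (b + M)) * qpoch N * iq (N - M) * qpoch (N + b) * iq (b + M).
Proof.
elim: M b => [|M IHM] b MN.
  rewrite /qdiff big_ord1 qbin0 !addn0 subn0 expr0 mul0n !fpsX0 !mul1r.
  by rewrite mulrV// mul1r.
rewrite qdiffS !IHM ?(ltnW MN)//.
have -> : (N - M = (N - M.+1).+1)%N by lia.
rewrite [iq (N - M.+1)]iqS !addnS !addSn (qpochS (N + b)) (iqS (b + M)).
have -> : X (N + b).+1 = X (N - M.+1).+1 * X (b + M).+1.
  by rewrite -fpsXD; congr X; lia.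
by rewrite exprS !fpsXE; ring.
Qed.

Lemma bin2D m n : 'C(m + n, 2) = ('C(m, 2) + 'C(n, 2) + m * n)%N.
Proof.
elim: n => [|n IHn]; first by rewrite addn0 muln0 !addn0.
by rewrite addnS !binS !bin1 IHn; lia.
Qed.

Lemma bin2_sq n : ('C(n, 2) + 'C(n, 2) + n = n * n)%N.
Proof. by elim: n => // n IHn; rewrite !binS !bin1; lia. Qed.

(** With N = a + d, this is the component of [phi m a] along the N-th eigenvector of the operator in
    [phiS]: [qtri N] is the eigenvalue, and the remaining factors expand the constant 1. *)
Definition theta m a d : fps := qtri (a + d) ^+ m * X ((a + d) * d) *
  (1 - X ((a + d).*2).+1) * qpoch (a + (a + d)) * iq d * iq a.

Lemma ordge_theta m a d : ordge d (theta m a d).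
Proof.
do 4!apply: ordgeMl; apply: ordgeMr; apply: ordge_le (@ordgeX _).
by case: d => // d; nia.
Qed.

Lemma theta_summable m a : nsummable (theta m a).
Proof. exact/ordge_nsummable/ordge_theta. Qed.

(* The q-Chu-Vandermonde sum, as an M-th q-difference of a product. *)
Lemma thetaS m a M : theta m.+1 a M =
  \sum_(k < M.+1) qtri (a + k) * iq k * theta m (a + k) (M - k)%N.
Proof.
have -> : theta m.+1 a M = qtri (a + M) ^+ m * (1 - X ((a + M).*2).+1) *
    ((-1) ^+ a * X 'C((a + M).+1, 2) * iq M * qdiff M (a + M) a).
  rewrite qdiffE ?leq_addl// addnK /theta exprSr {2}/qtri exprD.
  have : qpoch (a + M) * iq (a + M) = 1 by rewrite mulrV.
  move: (qpoch (a + M)) (iq (a + M)) => x y xy.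
  by rewrite [(M * _)%N]mulnC [(a + M + a)%N]addnC -[LHS]mul1r -xy; ring.
rewrite /qdiff !mulr_sumr; apply: eq_bigr => -[k /= kM] _.
have eM : (a + k + (M - k) = a + M)%N by lia.
rewrite /theta eM /qbin -ltnS kM {2}/qtri exprD.
(* This matches the exponents of the q-difference with those of [qtri (a + k)] and
   [theta m (a + k) (M - k)]. *)
have e1 : ('C((a + M).+1, 2) + 'C(M - k, 2) = 'C((a + k).+1, 2) + (a + M) * (M - k))%N.
  have -> : (a + M).+1 = ((a + k).+1 + (M - k))%N by lia.
  have -> : (a + M = a + k + (M - k))%N by lia.
  by rewrite bin2D; move: (bin2_sq (M - k)); move: 'C(_, 2) 'C(_, 2); nia.
have -> : (a + M + a + k = a + k + (a + M))%N by lia.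
have : X 'C((a + M).+1, 2) * X 'C(M - k, 2) = X 'C((a + k).+1, 2) * X ((a + M) * (M - k)).
  by rewrite -!fpsXD e1.
have : qpoch M * iq M = 1 by rewrite mulrV.
move: (qpoch M) (iq M) => x y xy.
move: (X 'C((a + M).+1, 2)) (X 'C(M - k, 2)) (X 'C((a + k).+1, 2)) (X ((a + M) * (M - k))).
move=> z1 z2 z3 z4 zz.
transitivity (qtri (a + M) ^+ m * (1 - X ((a + M).*2).+1) * (-1) ^+ a * (-1) ^+ k *
   (z1 * z2) * (x * y) * iq k * iq (M - k) * (qpoch (a + k + (a + M)) * iq (a + k))); first by ring.
by rewrite zz xy; ring.
Qed.

(* B below is the certificate for
   (1 - q^(a + 1)) (sum of the w a) - (sum of the w (a + 1)) = 0. *)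
Lemma theta0 a : nsum (theta 0 a) = 1.
Proof.
pose w a d := X ((a + d) * d) * (1 - X ((a + d).*2).+1) * qpoch (a + (a + d)) * iq d.
have sw b : nsummable (w b).
  apply: ordge_nsummable => d; do 3!apply: ordgeMl; apply: ordge_le (@ordgeX _).
  by case: d => // d; nia.
suff wE : nsum (w a) = qpoch a.
  rewrite (eq_nsum (G := fun d => iq a * w a d)); last first.
    by move=> d; rewrite /theta /w expr0; ring.
  by rewrite nsumM// wE mulVr.
elim: a => [|a IHa].
  rewrite (eq_nsum (G := fun d => X (d * d) - X (d.+1 * d.+1))); last first.
    move=> d; rewrite /w !add0n -mulrA mulrV// mulr1 mulrBr mulr1 -fpsXD.
    by congr (_ - X _); rewrite -addnn; nia.
  rewrite nsum_telescope ?fpsX0 ?qpoch0//.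
  apply: ordge_nsummable => d; apply: ordge_le (@ordgeX _); nia.
pose B d := if d is e.+1 then
  - (X ((a + d) * e) * (1 - X (a + d)) * qpoch (a + (a + d)) * iq e) else 0.
have sB : nsummable B.
  apply: nsummable_shift; apply: ordge_nsummable => d /=.
  apply/ordgeN; do 3!apply: ordgeMl; apply: ordge_le (@ordgeX _); nia.
(* The series for a + 1 is delayed by one place, so that a + d is the same in both series and the
   identity with [B] holds term by term. *)
pose v d := if d is e.+1 then w a.+1 e else 0.
have sv : nsummable v by apply: nsummable_shift; exact: sw.
have -> : nsum (w a.+1) = nsum v by rewrite [RHS]nsumS// add0r.
rewrite qpochS -IHa mulrC -nsumM//; apply/eqP; rewrite -subr_eq0 -opprB oppr_eq0.
rewrite -nsumB//; last exact: summableM.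
have <- : nsum (fun d => B d - B d.+1) = 0 by rewrite nsum_telescope.
apply/eqP/eq_nsum => -[|d]; rewrite /B /v /w.
  rewrite !addn0 !muln0 !addn1 !addnS qpochS iq0 -addnn; ring.
rewrite (iqS d) !addnS !addSn !qpochS -addnn !fpsXE; ring.
Qed.

Lemma theta_summable2 m a : fps_summable [set: nat * nat]%classic
  (fun x => qtri (a + x.1) * iq x.1 * theta m (a + x.1) x.2).
Proof.
apply: (@ordge_summable2 (fun k d => qtri (a + k) * iq k * theta m (a + k) d)) => k d.
apply: ordgeM; last exact: ordge_theta.
by apply: ordgeMl; apply: ordge_le (@ordge_qtri _); lia.
Qed.

Lemma phiE m a : phi m a = nsum (theta m a).
Proof.
elim: m a => [|m IHm] a.
  by rewrite theta0 /phi expr0 mul1r /= mulrV.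
rewrite phiS (eq_nsum (@thetaS m a)) -(@nsum_diag (fun k d => qtri (a + k) * iq k * theta m (a + k) d) (@theta_summable2 m a)).
apply: eq_nsum => k; rewrite IHm nsumM//; exact: theta_summable.
Qed.

Lemma qpow_nat n : qpow n%:R = X n.
Proof. by rewrite /qpow natr_nat natrK. Qed.

(** At a = 0 the N-th component is [qtri N ^+ m] times q^(N^2) - q^((N+1)^2). Its two terms are
    those of h with indices N and -N-1, which [p] puts into one fiber; the parity of m decides
    between the two kinds of signs in [eps]. *)
Lemma hE m : h m.+2 = phi m 0.
Proof.
have t0 N : theta m 0 N = qtri N ^+ m * (X (N * N) - X (N * N + N.*2.+1)).
  by rewrite /theta !add0n iq0 mulr1 -!mulrA mulrV// mulr1 mulrBr mulr1 fpsXD.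
have cm N : qtri N ^+ m = (-1) ^+ (N * m) * X ('C(N.+1, 2) * m).
  by rewrite /qtri exprMn -exprM fpsXM.
have b2 N : ('C(N.+1, 2)%:R : rat) = N%:R * (N%:R + 1) / 2.
  have := bin2_sq N.+1; move: 'C(_, _) => c /(congr1 (fun x => x%:R : rat)).
  by rewrite !natrD natrM -natr1; lra.
rewrite phiE; pose p (n : int) := match n with Posz k => k | Negz k => k end.
rewrite /h (@fps_sum_fiber _ _ _ [set: nat]%classic p)//; last exact: h_summable.
apply: eq_fps_sum => N _; rewrite t0.
have -> : fps_sum [set i | [set: int]%classic i /\ p i = N]%classic (h_term m.+2) =
    h_term m.+2 (Posz N) + h_term m.+2 (Negz N).
  apply: fpsP => n; rewrite (@fcoef_sum_seq _ _ _ _ [:: Posz N; Negz N])//.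
  - by rewrite big_cons big_seq1 fcoefD.
  - by move=> i; rewrite !inE => /orP[] /eqP ->.
  - by move=> [k|k] [_ /= ->]; rewrite !inE eqxx ?orbT.
rewrite mulrBr; congr (_ + _).
  have -> : h_term m.+2 (Posz N) = eps m.+2 N * X ('C(N.+1, 2) * m + N * N).
    rewrite /h_term -qpow_nat; congr (_ * qpow _).
    rewrite natrD !natrM b2 -[N%:~R]/(N%:R) -[m.+2]addn2 natrD; by field.
  rewrite cm fpsXD mulrA; congr (_ * _ * _).
  rewrite /eps /= negbK -[in RHS]signr_odd oddM.
  by case: (odd m); rewrite ?andbT ?andbF// signr_odd.
have -> : h_term m.+2 (Negz N) = eps m.+2 (Negz N) * X ('C(N.+1, 2) * m + (N * N + N.*2.+1)).
  rewrite /h_term -qpow_nat; congr (_ * qpow _).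
  rewrite natrD !natrM b2 NegzE -[m.+2]addn2 !natrD -[N.*2.+1]addn1 -addnn !natrD mulrNz.
  rewrite -[N.+1%:~R]/(N.+1%:R) -natr1 natrM; by field.
rewrite cm fpsXD mulrA -mulNr -mulNr; congr (_ * _ * _).
rewrite /eps /= negbK NegzE -exprnN -exprVn -[in RHS]signr_odd oddM.
rewrite invrN invr1.
by case: (odd m); rewrite ?andbT ?andbF// signr_odd exprS mulN1r.
Qed.

Lemma polysum_h n u : polysum n.+1 u = h n.+2.
Proof. by rewrite polysumE hE /phi iq0 mulr1. Qed.
Local Notation iqz := inv_qpoch.

(** * Gluing bigons and polygons *)

(** Zero at negative exponents, in agreement with [qpow]. The price is that [qzD] holds only for
    nonnegative exponents. *)
Definition qz (z : int) : fps := if z is Posz n then X n else 0.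

Lemma qzD x y : 0 <= x -> 0 <= y -> qz (x + y) = qz x * qz y.
Proof. by case: x => // m _; case: y => // n _; rewrite -PoszD /= fpsXD. Qed.

Definition tri (z : int) : int := (z * (z + 1) %/ 2)%Z.

Lemma triE z : 2 * tri z = z * (z + 1).
Proof.
rewrite /tri mulrC divzK//.
have e := divz_eq z 2; have r0 : 0 <= (z %% 2)%Z by apply: modz_ge0.
have r2 : (z %% 2)%Z < 2 by apply: ltz_pmod.
apply/dvdzP; move: (z %/ 2)%Z (z %% 2)%Z e r0 r2 => k r e r0 r2.
have [r_eq|r_eq] : r = 0 \/ r = 1 by lia.
  by exists (k * (z + 1)); rewrite e r_eq; ring.
by exists (z * (k + 1)); rewrite e r_eq; ring.
Qed.

Lemma zsum_nat (F : int -> fps) : (forall n, F (Negz n) = 0) ->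
  fps_sum [set: int]%classic F = nsum (fun n => F (Posz n)).
Proof.
move=> F0; rewrite -(@fps_sum_widen _ [set z | 0 <= z]%classic)//; last first.
  by case=> // n _ [].
apply: (@fps_sum_reindex _ _ Posz [set: nat]%classic).
by split=> [n _ //|m n _ _ [] //|[n|//] _]; exists n.
Qed.

Lemma zsummable_nat (F : int -> fps) : (forall n, F (Negz n) = 0) ->
  nsummable (fun n => F (Posz n)) -> fps_summable [set: int]%classic F.
Proof.
move=> F0 sF; apply: (@widen_summable _ [set z | 0 <= z]%classic).
  by case=> // n _ [].
apply: (@reindex_summable _ _ Posz [set: nat]%classic) => //.
by split=> [n _ //|m n _ _ [] //|[n|//] _]; exists n.
Qed.

Arguments chain : simpl never.

Lemma chainS m a u : chain m.+1 a u =
  qtri a * nsum (fun s => X ((u + a).+1 * s) * iq s * iq (a + s) * chain m a s).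
Proof. by []. Qed.

Lemma chain1 a u : chain 1 a u = qtri a.
Proof.
rewrite chainS (@fps_sum1 _ _ _ 0%N)//; last by case=> [_ []|s _ _]//; rewrite mulr0.
by rewrite muln0 addn0 iq0 fpsX0 !mul1r /chain mulVr// mulr1.
Qed.

(** Translating a by the smaller of u and v turns this into the polygon sum with two edges:
    [chain 1] is [qtri], and [polysum 1] equals 1 at every argument. *)
Lemma durfee_sum (u v : nat) :
  fps_summable [set: int]%classic
    (fun a => qz ((a + u%:Z) * (a + v%:Z)) * iqz (a + u%:Z) * iqz (a + v%:Z)) /\
  fps_sum [set: int]%classic
    (fun a => qz ((a + u%:Z) * (a + v%:Z)) * iqz (a + u%:Z) * iqz (a + v%:Z)) = qoo^-1.
Proof.
wlog uv : u v / (u <= v)%N => [W|].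
  have [/W//|/ltnW/W[s <-]] := leqP u v.
  by split; [apply: eq_summable s => a _|apply: eq_fps_sum => a _];
    rewrite [in qz _]mulrC mulrAC.
pose F (n : int) := qz (n * (n + (v - u)%N%:Z)) * iqz n * iqz (n + (v - u)%N%:Z).
have bij : set_bij [set: int]%classic [set: int]%classic (fun a : int => a + u%:Z).
  split=> [//|a b _ _ /addIr //|a _]; by exists (a - u%:Z); rewrite // subrK.
have FE a : qz ((a + u%:Z) * (a + v%:Z)) * iqz (a + u%:Z) * iqz (a + v%:Z) = F (a + u%:Z).
  by rewrite /F; have -> : a + u%:Z + (v - u)%N%:Z = a + v%:Z by lia.
have F0 n : F (Negz n) = 0 by rewrite /F /= mulr0 mul0r.
have FP n : F (Posz n) = X (n * (n + (v - u))) * iq n * iq (n + (v - u)).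
  by rewrite /F -PoszD.
have sF : nsummable (fun n => F (Posz n)).
  apply: ordge_nsummable => n; rewrite FP -mulrA.
  apply: ordgeMl; apply: ordge_le (@ordgeX _); case: n => // n; nia.
have sFz := zsummable_nat F0 sF.
split.
  apply: (@reindex_summable _ _ (fun a : int => a - u%:Z) [set: int]%classic); last first.
    by apply: eq_summable sFz => a _ /=; rewrite FE subrK.
  by split=> [//|a b _ _ /addIr //|a _]; exists (a + u%:Z); rewrite // addrK.
rewrite (eq_fps_sum (G := F \o (fun a : int => a + u%:Z))); last first.
  by move=> a _; exact: FE.
rewrite -(fps_sum_reindex _ bij) zsum_nat// (eq_nsum FP).
have : polysum 1 (v - u) = 1 by rewrite polysumE expr0 mul1r /chain qpoch0.
rewrite /polysum expr1 => E.
rewrite -[RHS]mulr1 -E mulrA mulVr// mul1r; apply: eq_nsum => n.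
rewrite chain1.
rewrite -[LHS]mulrA [iq n * _]mulrC mulrA mulnDr fpsXD.
have <- : qbin2 n * qtri n = X (n * n).
  by rewrite /qtri /qbin2 mulrACA -expr2 sqrr_sign mul1r -fpsXD binS bin1 -(bin2_sq n) addnA.
by ring.
Qed.

(** * Sums over integer values of finitely many labels *)

Section Assignments.
Variable L : choiceType.
Implicit Types (s : L -> int) (ls : seq L) (l : L).

Definition upd s l (x : int) : L -> int := fun k => if k == l then x else s k.

(** The variables in [ls] are summed over, all others are frozen at their values in [s]. Assignments
    are functions on all labels, so gluing new pieces does not change their type. *)
Definition asg ls s : set (L -> int) :=
  [set s' | forall l, l \notin ls -> s' l = s l]%classic.

Lemma asg_nil s : asg [::] s = [set s]%classic.
Proof.
by apply/seteqP; split=> [s' ss'|_ -> //] /=; apply/funext => l; exact: ss'.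
Qed.

Lemma asg_cons_fiber l ls s x : l \notin ls ->
  [set s' | asg (l :: ls) s s' /\ s' l = x]%classic = asg ls (upd s l x).
Proof.
move=> lls; apply/seteqP; split=> [s' [as' <-] k kls|s' as'].
  by rewrite /upd; case: eqP => [->//|/eqP kl]; apply: as'; rewrite inE negb_or kl.
split; last by rewrite as'// /upd eqxx.
by move=> k; rewrite inE negb_or => /andP[/negbTE kl /as' ->]; rewrite /upd kl.
Qed.

(** Forgets the values at the new labels [ls]; its fibers are the inner sums of a glued system. *)
Definition reset ls s : L -> int := fun k => if k \in ls then 0 else s k.

Lemma asg_cat_fiber ls1 ls2 s : ~~ has (mem ls1) ls2 -> asg ls2 (fun=> 0) s ->
  [set s' | asg (ls1 ++ ls2) (fun=> 0) s' /\ reset ls1 s' = s]%classic = asg ls1 s.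
Proof.
move=> /hasPn dis sa; apply/seteqP; split=> [s' [as' <-] k kls|s' as'].
  by rewrite /reset (negbTE kls).
split; first by move=> k; rewrite mem_cat negb_or => /andP[/as' -> /sa].
apply/funext => k; rewrite /reset; case: ifPn => [k1|/as'//].
by rewrite sa//; apply: contraTN k1 => /dis.
Qed.

Lemma asg_reset ls1 ls2 s : asg (ls1 ++ ls2) (fun=> 0) s -> asg ls2 (fun=> 0) (reset ls1 s).
Proof.
move=> as' k k2; rewrite /reset; case: ifPn => // k1.
by apply: as'; rewrite mem_cat negb_or k1.
Qed.

(** The factors along a path from [v] through [ws] to the base vertex. The variable there is 0, so
    the last edge leaves only [qtri a], the value of [chain 1]. *)
Fixpoint path_term (a : nat) (v : L) (ws : seq L) s : fps :=
  if ws is w :: ws' then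
    qtri a * (qz ((s v + a%:Z + 1) * s w) * iqz (s w) * iqz (a%:Z + s w)) *
    path_term a w ws' s
  else qtri a.

Lemma path_sum a v ws s t : uniq ws -> v \notin ws -> s v = Posz t ->
  fps_summable (asg ws s) (path_term a v ws) /\
  fps_sum (asg ws s) (path_term a v ws) = chain (size ws).+1 a t.
Proof.
elim: ws v s t => [|w ws IHws] v s t.
  move=> _ _ _; rewrite asg_nil; split.
    by apply: seq_summable => n; exists [:: s] => _ -> _; rewrite inE.
  by rewrite (@fps_sum1 _ _ _ s)// [RHS]chain1.
rewrite /= inE negb_or => /andP[wws uws] /andP[vw vws] svt.
pose c (x : int) := qtri a * (qz ((t%:Z + a%:Z + 1) * x) * iqz x * iqz (a%:Z + x)).
have c0 n : c (Negz n) = 0 by rewrite /c /= mulr0 mul0r mulr0.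
have cn n : c (Posz n) = qtri a * (X ((t + a).+1 * n) * iq n * iq (a + n)).
  have e : t%:Z + a%:Z + 1 = Posz (t + a).+1 by lia.
  by rewrite /c e -PoszD.
have sc : fps_summable [set: int]%classic c.
  apply: zsummable_nat => //; apply: (@eq_summable _ _ (fun n => qtri a * (X ((t + a).+1 * n) * iq n * iq (a + n)))).
    by move=> n _; rewrite cn.
  apply: summableM; apply: (@eq_summable _ _ (fun n => X ((t + a).+1 * n) * iq n * iq (a + n) * 1)).
    by move=> n _; rewrite mulr1.
  exact: chain_summable.
have FE s' : asg (w :: ws) s s' -> qtri a * (qz ((s' v + a%:Z + 1) * s' w) * iqz (s' w) *
    iqz (a%:Z + s' w)) * path_term a w ws s' = c (s' w) * path_term a w ws s'.
  by move=> /(_ v) -> //; rewrite ?inE ?negb_or ?vw// svt.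
have inner (n : nat) := IHws w (upd s w n) n uws wws (ltac:(by rewrite /upd eqxx)).
(* The induction hypothesis covers only nonnegative values at [w]. Cutting the path term off
   elsewhere changes nothing, because its coefficient [c] vanishes there. *)
have sG x : fps_summable [set s' | asg (w :: ws) s s' /\ s' w = x]%classic
    (fun s' => if 0 <= s' w then path_term a w ws s' else 0).
  case: x => n; last first.
    by move=> k; apply: sub_finite_set (finite_set0 _) => s' [[_ ->]] /eqP[].
  rewrite asg_cons_fiber//; apply: eq_summable (inner n).1 => s' /(_ w wws).
  by rewrite /upd eqxx => ->.
have sF : fps_summable (asg (w :: ws) s) (fun s' => c (s' w) * path_term a w ws s').
  apply: (@eq_summable _ _ (fun s' => c (s' w) * (if 0 <= s' w then path_term a w ws s' else 0))).
    by move=> s' _; case: (s' w) => // n; rewrite c0 !mul0r.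
  exact: (@summable_fiberM _ _ _ [set: int]%classic (fun s' => s' w)).
split; first by apply: eq_summable sF => s' /FE.
rewrite (eq_fps_sum FE) (fps_sum_fiber (B := [set: int]%classic) (p := fun s' => s' w) sF)//.
rewrite zsum_nat; last first.
  by move=> n; apply: fps_sum0 => s' [_ ->]; rewrite c0 mul0r.
rewrite chainS -nsumM; last exact: chain_summable.
apply: eq_nsum => n; have [si <-] := inner n.
rewrite mulrA -cn -fps_sumM// asg_cons_fiber//; apply: eq_fps_sum => s' /(_ w wws).
by rewrite /upd eqxx => ->.
Qed.

End Assignments.

(** The combinatorial data of a multisum: the pairs (A-face, B-face) adjacent to
    the edges of D, the pairs of B-faces meeting at the crossings, the faces of both
    colors, and those other than X and F*. *)
Record system (L : Type) := System {
  corners : seq (L * L);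
  bonds : seq (L * L);
  alab : seq L;
  blab : seq L;
  newlab : seq L
}.

(** * Multisums of labelled systems *)

Lemma tri_nat (n : nat) : tri n = 'C(n.+1, 2).
Proof.
have := triE n; have := bin2_sq n; rewrite binS bin1; move: 'C(n, 2) (tri n) => c t; nia.
Qed.

Lemma signzD (x y : int) : (-1 : fps) ^ (x + y) = (-1) ^ x * (-1) ^ y.
Proof. by rewrite exprzDr ?unitrN1. Qed.

(** f0 and v0 are X and F*, the A-colored one being f0. *)
Section Systems.
Variables (L : choiceType) (f0 v0 : L).
Implicit Types (S N : system L) (s : L -> int).

(** This is Q' + L'. Since e(F) counts the corners of an A-face, the contributions s^2/2 from Q' and
    s/2 from L' form one [tri] per corner, and -s per A-face remains. *)
Definition expo S s : int :=
  \sum_(c <- corners S) (tri (s c.1) + s c.1 * s c.2) +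
  \sum_(b <- bonds S) s b.1 * s b.2 + \sum_(v <- blab S) s v - \sum_(f <- alab S) s f.

Definition corner_prod S s : fps := \prod_(c <- corners S) iqz (s c.1 + s c.2).

(** Modulo 2, the number 2L' is the sum of e(F)s(F) over the A-faces, hence the sum of the
    A-variables over all corners. *)
Definition sterm S s : fps :=
  (-1) ^ (\sum_(c <- corners S) s c.1) * qz (expo S s) * corner_prod S s.

Definition valid S s : bool := all (fun c => 0 <= s c.1 + s c.2) (corners S).

Definition sysD N S := System (corners N ++ corners S) (bonds N ++ bonds S)
  (alab N ++ alab S) (blab N ++ blab S) (newlab N ++ newlab S).

Lemma expoD N S s : expo (sysD N S) s = expo N s + expo S s.
Proof. by rewrite /expo /= !big_cat /=; ring. Qed.

Lemma corner_prod_eq0 S s : ~~ valid S s -> corner_prod S s = 0.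
Proof.
move=> /allPn[c cS]; rewrite -ltNge => c0.
rewrite /corner_prod (big_rem c)//=.
by case: (_ + _) c0 => // n _; rewrite mul0r.
Qed.

Lemma sterm_eq0 S s : ~~ valid S s -> sterm S s = 0.
Proof. by rewrite /sterm => /corner_prod_eq0 ->; rewrite mulr0. Qed.

Lemma validD N S s : valid (sysD N S) s = valid N s && valid S s.
Proof. by rewrite /valid all_cat. Qed.

Lemma stermD N S s : (valid N s -> 0 <= expo N s) -> (valid S s -> 0 <= expo S s) ->
  sterm (sysD N S) s = sterm N s * sterm S s.
Proof.
move=> eN eS; case: (boolP (valid (sysD N S) s)) => v; last first.
  rewrite sterm_eq0//; move: v; rewrite validD negb_and.
  by case/orP => /sterm_eq0 ->; rewrite ?mul0r ?mulr0.
move: v; rewrite validD => /andP[/eN eN0 /eS eS0].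
rewrite /sterm expoD qzD// /corner_prod /= !big_cat /= signzD; ring.
Qed.

Definition labels S := f0 :: v0 :: newlab S.

(** The invariant of gluing. [inv_outer] expresses outerplanarity and makes the B-variables
    nonnegative on valid assignments. [inv_ge0] allows powers of q to be factored and shows in the
    end that Q' + L' is a natural number on Lambda. [inv_sum] has one factor (q)_oo per bond, that
    is, per crossing. *)
Record sys_inv S (W : fps) := SysInv {
  inv_corner : forall c, c \in corners S -> (c.1 \in labels S) && (c.2 \in labels S);
  inv_bond : forall b, b \in bonds S -> (b.1 \in labels S) && (b.2 \in labels S);
  inv_alab : {subset alab S <= labels S};
  inv_blab : {subset blab S <= labels S};
  inv_uniq : uniq (labels S);
  inv_outer : forall v, v \in blab S -> (f0, v) \in corners S;
  inv_ge0 : forall s, s f0 = 0 -> s v0 = 0 -> valid S s -> 0 <= expo S s;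
  inv_summable : fps_summable (asg (newlab S) (fun=> 0)) (sterm S);
  inv_sum : qoo ^+ size (bonds S) * fps_sum (asg (newlab S) (fun=> 0)) (sterm S) = W
}.

Lemma sterm_ext S W s s' : sys_inv S W -> {in labels S, s =1 s'} ->
  sterm S s = sterm S s'.
Proof.
move=> iS ss; rewrite /sterm /expo /corner_prod.
congr (_ ^ _ * qz (_ + _ + _ - _) * _); rewrite ?[LHS]big_seq ?[RHS]big_seq;
  try (apply: eq_bigr => x xS).
- by have /andP[/ss -> _] := inv_corner iS xS.
- by have /andP[/ss -> /ss ->] := inv_corner iS xS.
- by have /andP[/ss -> /ss ->] := inv_bond iS xS.
- by rewrite ss ?(inv_blab iS).
- by rewrite ss ?(inv_alab iS).
- by have /andP[/ss -> /ss ->] := inv_corner iS xS.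
Qed.

(** For fixed old variables the new factor sums to the constant [K], which therefore leaves the old
    sum. The analytic hypotheses on [N] are required only where the old B-variables are
    nonnegative. *)
Lemma sys_invD N S W w K : sys_inv S W ->
  (forall c, c \in corners N -> (c.1 \in newlab N ++ labels S) && (c.2 \in newlab N ++ labels S)) ->
  (forall c, c \in bonds N -> (c.1 \in newlab N ++ labels S) && (c.2 \in newlab N ++ labels S)) ->
  {subset alab N <= newlab N ++ labels S} -> {subset blab N <= newlab N ++ labels S} ->
  uniq (newlab N ++ labels S) ->
  (forall v, v \in blab N -> (f0, v) \in corners N) ->
  (forall s, s f0 = 0 -> s v0 = 0 -> {in blab S, forall v, 0 <= s v} ->
    valid N s -> 0 <= expo N s) ->
  (forall s, s f0 = 0 -> s v0 = 0 -> {in blab S, forall v, 0 <= s v} ->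
    fps_summable (asg (newlab N) s) (sterm N) /\ fps_sum (asg (newlab N) s) (sterm N) = K) ->
  qoo ^+ size (bonds N) * K = w ->
  sys_inv (sysD N S) (w * W).
Proof.
move=> iS cN bN aN lN uN oN eN sN wE.
have labE x : (x \in labels (sysD N S)) = (x \in newlab N ++ labels S).
  by rewrite /labels /= !(inE, mem_cat); do !case: (_ == _); do ?case: (_ \in _).
have labS x : x \in labels S -> x \in labels (sysD N S).
  by rewrite labE mem_cat => ->; rewrite orbT.
have uD : uniq (labels (sysD N S)).
  rewrite (perm_uniq (s2 := newlab N ++ labels S))//.
  exact/permPl/(perm_catCA [:: f0; v0] (newlab N) (newlab S)).
have nonneg s : s f0 = 0 -> valid S s -> {in blab S, forall v, 0 <= s v}.
  move=> sf0 vS v /(inv_outer iS) vc.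
  by have := allP vS _ vc; rewrite /= sf0 add0r.
have stD s : s f0 = 0 -> s v0 = 0 -> sterm (sysD N S) s = sterm S s * sterm N s.
  move=> sf0 sv0; case: (boolP (valid S s)) => vS.
    rewrite mulrC stermD//; first by apply: eN => //; apply: nonneg.
    exact: (inv_ge0 iS).
  by rewrite (sterm_eq0 vS) mul0r sterm_eq0// validD (negbTE vS) andbF.
have /and3P[f0D v0D _] : [&& f0 \notin newlab N ++ newlab S, v0 \notin newlab N ++ newlab S & true].
  move: uD; rewrite /labels /= inE negb_or => /and3P[/andP[_ ->] -> _] //.
have as0 s : asg (newlab (sysD N S)) (fun=> 0) s -> s f0 = 0 /\ s v0 = 0.
  by move=> a; split; rewrite a.
have dis : ~~ has (mem (newlab N)) (newlab S).
  move: uN; rewrite cat_uniq => /and3P[_ /hasPn d _]; apply/hasPn => x xS.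
  by apply: d; rewrite !inE xS !orbT.
have resE s : asg (newlab (sysD N S)) (fun=> 0) s -> {in labels S, s =1 reset (newlab N) s}.
  move=> _ x xS; rewrite /reset; case: ifPn => // xN.
  by move: uN; rewrite cat_uniq => /and3P[_ /hasPn /(_ x xS)]; rewrite /= xN.
(* Where the old assignment is not valid, the old factor is 0 and nothing is known about summing the
   new one, so the latter is cut off. *)
pose G s := if valid S s then sterm N s else 0.
have stG s : asg (newlab (sysD N S)) (fun=> 0) s ->
    sterm (sysD N S) s = sterm S (reset (newlab N) s) * G s.
  move=> a; have [sf sv] := as0 _ a; rewrite stD// -(sterm_ext iS (resE _ a)) /G.
  by case: ifPn => // /sterm_eq0 ->; rewrite !mul0r.
have inner s : asg (newlab S) (fun=> 0) s ->
    fps_summable [set s' | asg (newlab N ++ newlab S) (fun=> 0) s' /\ reset (newlab N) s' = s]%classic G /\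
    sterm S s * fps_sum [set s' | asg (newlab N ++ newlab S) (fun=> 0) s' /\ reset (newlab N) s' = s]%classic G
    = sterm S s * K.
  move=> sa; rewrite asg_cat_fiber//.
  have ss' s' : asg (newlab N) s s' -> {in labels S, s' =1 s}.
    move=> a x xS; apply: a; apply/negP => xN.
    by move: uN; rewrite cat_uniq => /and3P[_ /hasPn /(_ x xS)]; rewrite /= xN.
  have vs' s' : asg (newlab N) s s' -> valid S s' = valid S s.
    move=> /ss' e; apply: eq_in_all => c /(inv_corner iS)/andP[c1 c2].
    by rewrite !e.
  have sf : s f0 = 0 by rewrite sa//; move: f0D; rewrite mem_cat negb_or => /andP[].
  have sv : s v0 = 0 by rewrite sa//; move: v0D; rewrite mem_cat negb_or => /andP[].
  case: (boolP (valid S s)) => vS; last first.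
    rewrite (sterm_eq0 vS) !mul0r; split=> //.
    by move=> n; apply: sub_finite_set (finite_set0 _) => s' [a]; rewrite /G vs'// (negbTE vS) => /eqP[].
  have [sm su] := sN s sf sv (nonneg s sf vS).
  have GE s' : asg (newlab N) s s' -> sterm N s' = G s' by move=> a; rewrite /G vs'// vS.
  split; first exact: eq_summable sm.
  by rewrite -(eq_fps_sum GE) su.
have sumG : fps_summable (asg (newlab (sysD N S)) (fun=> 0))
    (fun s => sterm S (reset (newlab N) s) * G s).
  apply: (summable_fiberM (B := asg (newlab S) (fun=> 0))).
  - by move=> s; apply: asg_reset.
  - exact: inv_summable iS.
  - by move=> s /inner[].
split=> //.
- by move=> c; rewrite /= mem_cat !labE => /orP[/cN//|/(inv_corner iS)/andP[/labS+ /labS]];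
    rewrite !labE => -> ->.
- by move=> c; rewrite /= mem_cat !labE => /orP[/bN//|/(inv_bond iS)/andP[/labS+ /labS]];
    rewrite !labE => -> ->.
- by move=> x; rewrite /= mem_cat => /orP[/aN|/(inv_alab iS)/labS//]; rewrite labE.
- by move=> x; rewrite /= mem_cat => /orP[/lN|/(inv_blab iS)/labS//]; rewrite labE.
- by move=> v; rewrite /= !mem_cat => /orP[/oN ->//|/(inv_outer iS) ->]; rewrite orbT.
- move=> s sf sv; rewrite validD expoD => /andP[vN vS]; apply: addr_ge0.
    by apply: eN => //; apply: nonneg.
  exact: (inv_ge0 iS).
- by apply: eq_summable sumG => s /stG.
rewrite (eq_fps_sum stG) (fps_sum_fiber (B := asg (newlab S) (fun=> 0)) (p := reset (newlab N)) sumG); last first.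
  by move=> s; apply: asg_reset.
rewrite (eq_fps_sum (G := fun s => K * sterm S s)); last first.
  move=> s sa; have [sm E] := inner s sa; rewrite mulrC -E -fps_sumM//.
  by apply: eq_fps_sum => s' [_ ->].
rewrite fps_sumM; last exact: inv_summable iS.
by rewrite size_cat exprD -wE -(inv_sum iS); ring.
Qed.

End Systems.

Lemma tri0 : tri 0 = 0. Proof. exact: tri_nat 0. Qed.

Lemma signz_sq z : (-1) ^ z * (-1) ^ z = 1 :> fps.
Proof.
case: z => n; first by rewrite -expr2 sqrr_sign.
by rewrite NegzE -exprnN -exprVn invrN invr1 -expr2 sqrr_sign.
Qed.

(** * The edge, the bigon and the polygon *)

Section Gluing.
Variables (L : choiceType) (f0 v0 : L).
Implicit Types (S N : system L) (s : L -> int).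

Definition edge_sys v1 : system L :=
  System [:: (f0, v0); (f0, v1)] [:: (v0, v1)] [:: f0] [:: v0; v1] [:: v1].

Lemma edge_inv v1 : uniq [:: f0; v0; v1] -> sys_inv f0 v0 (edge_sys v1) 1.
Proof.
move=> u3; have stE s : s f0 = 0 -> s v0 = 0 ->
    sterm (edge_sys v1) s = qz (s v1) * iqz (s v1).
  move=> sf sv; rewrite /sterm /expo /corner_prod /= !(big_cons, big_nil) /= sf sv.
  rewrite tri0 !(mul0r, mulr0, add0r, addr0, subr0) expr0z mul1r mulr1.
  by rewrite [iqz 0]iq0 mul1r.
have as0 s : asg [:: v1] (fun=> 0) s -> s f0 = 0 /\ s v0 = 0.
  move: u3; rewrite /= !inE negb_or => /and3P[/andP[_ f1] v01 _] a.
  by rewrite !a ?inE.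
pose F z := qz z * iqz z.
have F0 n : F (Negz n) = 0 by rewrite /F /= mul0r.
have sF : nsummable (fun n => F (Posz n)).
  by apply: ordge_nsummable => n; apply/ordgeMl/ordgeX.
have bij : set_bij [set: int]%classic (asg [:: v1] (fun=> 0)) (upd (fun=> 0) v1).
  split=> [x _ l|x y _ _ /(congr1 (fun s => s v1))|s a].
  - by rewrite inE /upd => /negbTE ->.
  - by rewrite /upd eqxx.
  - exists (s v1) => //; apply/funext => l; rewrite /upd; case: eqP => [-> //|/eqP l1].
    by rewrite a// inE.
have FE x : [set: int]%classic x -> F x = (sterm (edge_sys v1) \o upd (fun=> 0) v1) x.
  move=> _; have [|sf sv] := as0 (upd (fun=> 0) v1 x); first by case: bij => + _ _; apply.
  by rewrite /= stE// /upd eqxx.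
split=> //=.
- by move=> c; rewrite /labels /= !inE => /orP[] /eqP -> /=; rewrite !eqxx ?orbT.
- by move=> c; rewrite /labels /= !inE => /eqP -> /=; rewrite !eqxx ?orbT.
- by move=> c; rewrite /labels !inE => /eqP ->; rewrite eqxx.
- by move=> c; rewrite /labels !inE => /orP[] ->; rewrite ?orbT.
- by move=> v; rewrite !inE => /orP[] /eqP ->; rewrite eqxx ?orbT.
- move=> s sf sv; rewrite /valid /= sf sv !add0r lexx andbT /= => s1.
  rewrite /expo /= !(big_cons, big_nil) /= sf sv.
  by rewrite tri0 !(mul0r, mulr0, add0r, addr0, subr0).
- apply: (reindex_summable bij); apply: eq_summable FE _; exact: zsummable_nat.
rewrite (fps_sum_reindex _ bij) -(eq_fps_sum FE) zsum_nat// expr1.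
rewrite (eq_nsum (G := fun j => X (1 * j) * iq j)); last by move=> j; rewrite mul1n.
by rewrite (euler_sum 0) qpoch0 mul1r mulrV.
Qed.

Definition bigon_sys f u v : system L :=
  System [:: (f, u); (f, v)] [:: (u, v)] [:: f] [::] [:: f].

(** The new exponent is the product of the two corner values and the two signs cancel. What is left
    is the Durfee sum over the integer [s f], with the same value 1/(q)_oo for all values at [u] and
    [v]. *)
Lemma bigon_inv S W f u v : sys_inv f0 v0 S W -> u \in blab S -> v \in blab S ->
  f \notin labels f0 v0 S -> sys_inv f0 v0 (sysD (bigon_sys f u v) S) W.
Proof.
move=> iS uS vS fS.
have uL := inv_blab iS uS; have vL := inv_blab iS vS.
have uL' := uL; have vL' := vL; rewrite !inE in uL' vL'.
have uu : uniq (f :: labels f0 v0 S) by rewrite cons_uniq fS (inv_uniq iS).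
have fu : f != u by apply: contraNneq fS => ->.
have fv : f != v by apply: contraNneq fS => ->.
have expoE s : expo (bigon_sys f u v) s = (s f + s u) * (s f + s v).
  rewrite /expo /= !(big_cons, big_nil) /=; have E := triE (s f).
  transitivity (2 * tri (s f) + s f * (s u + s v) + s u * s v - s f); first by ring.
  by rewrite E; ring.
have stE s : sterm (bigon_sys f u v) s =
    qz ((s f + s u) * (s f + s v)) * iqz (s f + s u) * iqz (s f + s v).
  rewrite /sterm expoE /corner_prod /= !(big_cons, big_nil) /= addr0 mulr1.
  by rewrite signzD signz_sq mul1r mulrA.
rewrite -[W]mul1r; apply: (sys_invD (K := qoo^-1)) => //=.
- by move=> c; rewrite !inE => /orP[] /eqP -> /=; rewrite eqxx ?uL' ?vL' orbT.
- by move=> c; rewrite !inE => /eqP -> /=; rewrite uL' vL' !orbT.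
- by move=> c; rewrite !inE => /eqP ->; rewrite eqxx.
- by move=> s _ _ _; rewrite /valid /= andbT expoE => /andP[fu0 fv0]; apply: mulr_ge0.
- move=> s _ _ s0; have := s0 _ uS; have := s0 _ vS.
  case sv: (s v) => [y|//] _; case su: (s u) => [x|//] _.
  have [sm <-] := durfee_sum x y.
  have bij : set_bij [set: int]%classic (asg [:: f] s) (upd s f).
    split=> [z _ l|z z' _ _ /(congr1 (fun s => s f))|s' a].
    - by rewrite inE /upd => /negbTE ->.
    - by rewrite /upd eqxx.
    - exists (s' f) => //; apply/funext => l; rewrite /upd; case: eqP => [-> //|/eqP l1].
      by rewrite a// inE.
  have E z : [set: int]%classic z -> qz ((z + x%:Z) * (z + y%:Z)) * iqz (z + x%:Z) *
      iqz (z + y%:Z) = (sterm (bigon_sys f u v) \o upd s f) z.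
    move=> _; rewrite /= stE /upd eqxx eq_sym (negbTE fu) [v == f]eq_sym (negbTE fv).
    by rewrite su sv.
  split; first by apply: (reindex_summable bij); apply: eq_summable E _.
  by rewrite (fps_sum_reindex _ bij) -(eq_fps_sum E).
- by rewrite expr1 mulrV.
Qed.

(** The face f of size |ws| + 2 is glued along the edge from v to v0. *)
Definition polygon_sys f ws v : system L :=
  System ((f, v0) :: (f, v) :: [seq (f, w) | w <- ws] ++ [seq (f0, w) | w <- ws])
    (zip (v :: ws) (rcons ws v0)) [:: f] ws (f :: ws).

(** The share of the exponent that belongs to the path; [path_exp_cons] splits off one vertex in the
    way [chain] splits off one summation. *)
Definition path_exp (a : int) v ws s : int :=
  tri a + \sum_(w <- ws) (tri a + a * s w + s w) +
  \sum_(b <- zip (v :: ws) (rcons ws v0)) s b.1 * s b.2.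

Lemma path_exp_cons a v w ws s : path_exp a v (w :: ws) s =
  tri a + (s v + a + 1) * s w + path_exp a w ws s.
Proof. by rewrite /path_exp /= !big_cons /=; ring. Qed.

Lemma tri_ge0 a : 0 <= tri a.
Proof. by have := triE a; nia. Qed.

Lemma path_exp_ge0 a v ws s : 0 <= a -> 0 <= s v -> s v0 = 0 ->
  {in ws, forall w, 0 <= s w} -> 0 <= path_exp a v ws s.
Proof.
move=> a0 + sv0; elim: ws v => [|w ws IHws] v s0 sw.
  by rewrite /path_exp /= big_nil big_seq1 /= sv0 mulr0 !addr0 tri_ge0.
have w0 : 0 <= s w by apply: sw; rewrite inE eqxx.
rewrite path_exp_cons addr_ge0// ?IHws//; last by move=> x xw; apply: sw; rewrite inE xw orbT.
by rewrite addr_ge0 ?tri_ge0// mulr_ge0// !addr_ge0.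
Qed.

Lemma path_termE (a : nat) v ws s : 0 <= s v -> s v0 = 0 ->
  path_term a v ws s = (-1) ^+ (a * (size ws).+1) * qz (path_exp a v ws s) *
    \prod_(w <- ws) (iqz (a%:Z + s w) * iqz (s w)).
Proof.
move=> + sv0; elim: ws v => [|w ws IHws] v s0.
  rewrite /path_exp /= !big_nil big_seq1 /= sv0 mulr0 !addr0 muln1 mulr1.
  by rewrite /qtri tri_nat.
rewrite /= path_exp_cons big_cons; case sw: (s w) => [n|n]; last by rewrite /= !(mulr0, mul0r).
case: (boolP (all (fun w => 0 <= s w) ws)) => [/allP ws0|].
  have e0 : 0 <= path_exp a w ws s by apply: path_exp_ge0; rewrite ?sw.
  have e1 : 0 <= (s v + a%:Z + 1) * n%:Z by rewrite mulr_ge0// !addr_ge0.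
  have e2 := tri_ge0 a.
  rewrite (qzD (addr_ge0 e2 e1) e0) (qzD e2 e1) IHws ?sw//.
  have -> : qtri a = (-1) ^+ a * qz (tri a) by rewrite tri_nat.
  rewrite !mulnS !exprD; ring.
move=> /allPn[x xws]; case sx: (s x) => [//|m] _.
rewrite IHws ?sw// !(big_rem x xws) /= sx /=.
by rewrite !(mulr0, mul0r).
Qed.

(** Put a = s f. Of the |ws| + 2 corners of [f], the path takes |ws| + 1 terms tri a. The last one,
    together with -a for the face and a s(v) for the corner at [v], gives the exponent a(a-1)/2 + a
    s(v) of [polysum]. *)
Lemma polygon_expo f ws v s : s f0 = 0 -> s v0 = 0 ->
  expo (polygon_sys f ws v) s =
  tri (s f) + (tri (s f) - s f) + s f * s v - tri (s f) + path_exp (s f) v ws s.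
Proof.
move=> sf sv; rewrite /expo /path_exp /= !big_cons big_cat /= !big_map /= big_nil.
have -> : \sum_(w <- ws) (tri (s f0) + s f0 * s w) = 0.
  by apply: big1 => w _; rewrite sf tri0 mul0r addr0.
rewrite sv.
have -> : \sum_(w <- ws) (tri (s f) + s f * s w + s w) =
  \sum_(w <- ws) (tri (s f) + s f * s w) + \sum_(w <- ws) s w by rewrite -big_split.
ring.
Qed.

Lemma polygon_validE f ws v s : s f0 = 0 -> s v0 = 0 ->
  valid (polygon_sys f ws v) s = [&& 0 <= s f, 0 <= s f + s v,
    all (fun w => 0 <= s f + s w) ws & all (fun w => 0 <= s w) ws].
Proof.
move=> sf sv; rewrite /valid /= sv addr0 all_cat !all_map.
do 3!congr (_ && _); apply: eq_all => w /=; by rewrite sf add0r.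
Qed.

Lemma polygon_expo_ge0 f ws v s : s f0 = 0 -> s v0 = 0 -> 0 <= s v ->
  valid (polygon_sys f ws v) s -> 0 <= expo (polygon_sys f ws v) s.
Proof.
move=> sf sv s0; rewrite polygon_validE// => /and4P[a0 _ _ /allP w0].
rewrite polygon_expo//; have := path_exp_ge0 a0 s0 sv w0.
have := triE (s f); move: (tri _) (path_exp _ _ _ _) => t p.
have := mulr_ge0 a0 s0; move: (s f * s v) => m; nia.
Qed.

Lemma polygon_term f ws v s (t : nat) : s f0 = 0 -> s v0 = 0 -> s v = t ->
  sterm (polygon_sys f ws v) s =
    if s f is Posz a then
      qbin2 a * X (a * t) * iq (a + t) * iq a * path_term a v ws s
    else 0.
Proof.
move=> sf sv st; case fa: (s f) => [a|n]; last first.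
  by apply: sterm_eq0; rewrite polygon_validE// fa.
have v_ge0 : 0 <= s v by rewrite st.
rewrite path_termE//.
case: (boolP (all (fun w => 0 <= s w) ws)) => [/allP ws0|/allPn[x xws]]; last first.
  case sx: (s x) => [//|m] _; rewrite sterm_eq0 ?(big_rem x xws) /= ?sx ?mulr0 ?mul0r ?mulr0//.
  rewrite polygon_validE//; apply/and4P => -[_ _ _ /allP /(_ x xws)].
  by rewrite sx.
have e0 : 0 <= path_exp a v ws s by apply: path_exp_ge0.
(* Each of the |ws| + 2 corners of [f] gives a sign (-1)^a: one goes to [qbin2 a], the others to the
   factors [qtri a] of the path. *)
have sgn : \sum_(c <- corners (polygon_sys f ws v)) s c.1 = Posz (a * (size ws).+2)%N.
  rewrite /= !big_cons big_cat /= !big_map /=.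
  have -> : \sum_(w <- ws) s f0 = 0 by apply: big1.
  rewrite fa addr0 big_const_seq count_predT iter_addr_0.
  by rewrite -mulr_natr; lia.
have prodE : corner_prod (polygon_sys f ws v) s = iq a * iq (a + t) *
    \prod_(w <- ws) (iqz (a%:Z + s w) * iqz (s w)).
  rewrite /corner_prod /= !big_cons big_cat /= !big_map /= fa sv st addr0 -PoszD mulrA.
  congr (_ * _); rewrite big_split; congr (_ * _); apply: eq_bigr => w _.
  by rewrite sf add0r.
have eE : expo (polygon_sys f ws v) s = Posz ('C(a, 2) + a * t) + path_exp a v ws s.
  rewrite polygon_expo// fa st tri_nat binS bin1; lia.
rewrite /sterm sgn eE prodE qzD// /qbin2 -exprnP !mulnS !exprD [qz (Posz _)]/= fpsXD.
ring.
Qed.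

Lemma polygon_inv S W f ws v : sys_inv f0 v0 S W -> v \in blab S ->
  uniq (f :: ws ++ labels f0 v0 S) ->
  sys_inv f0 v0 (sysD (polygon_sys f ws v) S) (h (size ws).+2 * W).
Proof.
move=> iS vS uu; have vL := inv_blab iS vS.
have v0L : v0 \in labels f0 v0 S by rewrite !inE eqxx orbT.
have f0L : f0 \in labels f0 v0 S by rewrite !inE eqxx.
move: uu; rewrite cons_uniq cat_uniq => /andP[fN /and3P[uws /hasPn dis uL]].
have [fws fL] : f \notin ws /\ f \notin labels f0 v0 S.
  by apply/andP; rewrite -negb_or -mem_cat.
have vws : v \notin ws by exact: dis.
have ne x : x \in labels f0 v0 S -> x != f by move=> xL; apply: contraNneq fL => <-.
have inA x : x \in labels f0 v0 S -> x \in newlab (polygon_sys f ws v) ++ labels f0 v0 S.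
  by rewrite mem_cat => ->; rewrite orbT.
have inf : f \in newlab (polygon_sys f ws v) ++ labels f0 v0 S by rewrite mem_head.
have inw w : w \in ws -> w \in newlab (polygon_sys f ws v) ++ labels f0 v0 S.
  by move=> ww; rewrite mem_cat in_cons ww orbT.
apply: (sys_invD (K := qoo ^- (size ws).+1 * h (size ws).+2)) => //.
- apply/allP; set A := newlab _ ++ _ in inA inf inw *.
  rewrite /= all_cat !all_map inf !inA//=; apply/andP; split; apply/allP => w ww /=.
    by rewrite ?inf (inw w).
  by rewrite (inw w)// ?inA.
- move=> c; rewrite [bonds _]/= => cz.
  have c1 : c.1 \in v :: ws.
    by rewrite -(@unzip1_zip _ _ (v :: ws) (rcons ws v0)) ?size_rcons//; exact: map_f.
  have c2 : c.2 \in rcons ws v0.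
    by rewrite -(@unzip2_zip _ _ (v :: ws) (rcons ws v0)) ?size_rcons//; exact: map_f.
  rewrite mem_rcons in c2.
  by case/predU1P: c1 => [->|/inw->]; case/predU1P: c2 => [->|/inw->]; rewrite ?inA.
- by move=> x /predU1P[->|//]; rewrite inf.
- by rewrite cons_uniq cat_uniq fN uws uL andbT; apply/hasPn.
- by move=> w ww; rewrite !inE mem_cat (map_f (fun w => (f0, w)) ww) !orbT.
- by move=> s sf sv0 s0; apply: polygon_expo_ge0 => //; apply: s0.
- move=> s sf sv0 s0; have := s0 _ vS; case sv: (s v) => [t|//] _.
  rewrite /= in sv *.
  pose c (x : int) := if x is Posz a then qbin2 a * X (a * t) * iq (a + t) * iq a else 0.
  have stE s' : asg (f :: ws) s s' ->
      sterm (polygon_sys f ws v) s' = c (s' f) * path_term `|s' f|%N v ws s'.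
    move=> a; have nfw x : x \in labels f0 v0 S -> s' x = s x.
      by move=> xL; apply: a; rewrite in_cons negb_or ne// dis.
    rewrite (@polygon_term f ws v s' t) ?(nfw f0) ?(nfw v0) ?(nfw v)// /c.
    by case: (s' f) => n; rewrite ?mul0r.
  have pt (a : nat) := @path_sum _ a v ws (upd s f a) t uws vws
    (ltac:(by rewrite /upd (negbTE (ne v vL)))).
  have sc : fps_summable [set: int]%classic c.
    apply: zsummable_nat => //; apply: nsummable_shift; apply: ordge_nsummable => n.
    rewrite /c qbin2S; do 3!apply: ordgeMl; apply/ordgeN/ordgeMl.
    exact: ordgeX.
  have sF : fps_summable (asg (f :: ws) s) (fun s' => c (s' f) * path_term `|s' f|%N v ws s').
    apply: (@eq_summable _ _ (fun s' => c (s' f) * (if 0 <= s' f then path_term `|s' f|%N v ws s' else 0))).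
      by move=> s' _; case: (s' f) => // n; rewrite !mul0r.
    apply: (@summable_fiberM _ _ _ [set: int]%classic (fun s' => s' f)) => // -[] n _.
      rewrite asg_cons_fiber//; apply: eq_summable (pt n).1 => s' /(_ f fws).
      by rewrite /upd eqxx => ->.
    by move=> k; apply: sub_finite_set (finite_set0 _) => s' [[_ ->]] /eqP[].
  split; first by apply: eq_summable sF => s' /stE.
  rewrite (eq_fps_sum stE) (fps_sum_fiber (B := [set: int]%classic) (p := fun s' => s' f) sF)//.
  rewrite zsum_nat; last by move=> n; apply: fps_sum0 => s' [_ ->]; rewrite mul0r.
  (* Here the independence of the value [t] at [v] enters: [polysum_h] rewrites [h] as the polygon
     sum at this particular [t]. *)
  rewrite -(polysum_h (size ws) t) /polysum mulrA mulVr ?mul1r ?unitrX//.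
  apply: eq_nsum => n; have [si <-] := pt n.
  rewrite -fps_sumM// asg_cons_fiber//; apply: eq_fps_sum => s' /(_ f fws).
  by rewrite /upd eqxx => ->.
- by rewrite size_zip /= size_rcons minnn mulrA mulrV ?mul1r// unitrX.
Qed.

End Gluing.

(** * Systems built by successive gluing *)

Inductive glue_step (L : Type) :=
| Bigon of L & L & L
| Polygon of L & seq L & L.

Section Build.
Variables (L : choiceType) (f0 v0 : L).
Implicit Types (S : system L) (st : glue_step L) (sts : seq (glue_step L)).

Definition step_sys st : system L :=
  match st with
  | Bigon f u v => bigon_sys f u v
  | Polygon f ws v => polygon_sys f0 v0 f ws v
  end.

Definition step_ok st S : bool :=
  match st with
  | Bigon f u v => [&& u \in blab S, v \in blab S & f \notin labels f0 v0 S]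
  | Polygon f ws v => (v \in blab S) && uniq (f :: ws ++ labels f0 v0 S)
  end.

Definition step_val st : fps := if st is Polygon _ ws _ then h (size ws).+2 else 1.

(** The head of the list is the last piece glued. *)
Fixpoint build v1 sts : system L :=
  if sts is st :: sts' then sysD (step_sys st) (build v1 sts') else edge_sys f0 v0 v1.

Fixpoint build_ok v1 sts : bool :=
  if sts is st :: sts' then build_ok v1 sts' && step_ok st (build v1 sts')
  else uniq [:: f0; v0; v1].

Lemma build_inv v1 sts : build_ok v1 sts ->
  sys_inv f0 v0 (build v1 sts) (\prod_(st <- sts) step_val st).
Proof.
elim: sts => [|st sts IHsts]; first by rewrite big_nil => /edge_inv.
rewrite big_cons => /andP[/IHsts iS]; case: st => [f u v /and3P[uS vS fS]|f ws v /andP[vS uu]].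
  by rewrite /step_val mul1r; apply: bigon_inv.
exact: polygon_inv.
Qed.

(** The transfer to faces of a diagram needs, beyond [sys_inv], that every label has exactly one
    color and that the labels of either color are those found at the corners. *)
Lemma build_labels v1 sts : build_ok v1 sts ->
  [/\ perm_eq (alab (build v1 sts) ++ blab (build v1 sts)) (labels f0 v0 (build v1 sts)),
      f0 \in alab (build v1 sts), v0 \in blab (build v1 sts),
      alab (build v1 sts) =i unzip1 (corners (build v1 sts)) &
      blab (build v1 sts) =i unzip2 (corners (build v1 sts))].
Proof.
elim: sts => [|st sts IHsts] => [_|/andP[/IHsts[]]]; last rewrite [build v1 (_ :: _)]/=.
  by split=> [|||x|x] //; rewrite !inE ?eqxx ?orbb.
move: (build v1 sts) => S pS f0S v0S aS bS.
case: st => [f u v /and3P[uS vS fS]|f ws v /andP[vS uu]] /=.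
  split=> [|||x|x] /=.
  - rewrite perm_sym (perm_catCA [:: f0; v0] [:: f]) /= perm_cons perm_sym.
    exact: pS.
  - by rewrite inE f0S orbT.
  - by [].
  - by rewrite !inE aS orbA orbb.
  - rewrite !inE -bS; case: eqP => [->|_]; first by rewrite uS.
    by case: eqP => [->|_]; rewrite ?vS.
split=> [|||x|x] /=.
- rewrite perm_sym (perm_catCA [:: f0; v0] (f :: ws)) /= perm_cons perm_sym.
  by rewrite perm_catCA perm_cat2l.
- by rewrite inE f0S orbT.
- by rewrite mem_cat v0S orbT.
- rewrite /unzip1 !map_cat -!map_comp !(inE, mem_cat) -aS orbA orbb.
  case: eqP => //= xf; case: (boolP (x \in alab S)) => xa; rewrite ?orbT ?orbF//.
  apply/esym/norP; split; apply/negP => /mapP[w _ /= xE]; first exact: xf.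
  by rewrite xE f0S in xa.
- have E y : map snd [seq (y, w) | w <- ws] = ws.
    by rewrite -map_comp -[RHS]map_id; apply: eq_map.
  rewrite /unzip2 !map_cat !E !(inE, mem_cat) -bS.
  case: (boolP (x \in ws)) => xw /=; rewrite ?orbT//.
  case: eqP => [->|_] /=; first by rewrite v0S.
  by case: eqP => [->|_]; rewrite ?vS.
Qed.

End Build.

Lemma porbit_invol (U : finType) (p : {perm U}) x y : involutive p ->
  (y \in porbit p x) = (y == x) || (y == p x).
Proof.
move=> pK; apply/idP/orP => [/porbitP[n ->]|[/eqP->|/eqP->]]; last first.
- exact: (mem_porbit p 1).
- exact: porbit_id.
elim: n => [|n]; first by rewrite expg0 perm1; left.
by rewrite expgSr permM => -[/eqP ->|/eqP ->]; [right|left; rewrite pK].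
Qed.

(** * Edges, crossings and faces of the medial graph *)

Section Medial.
Variable T : tait.
Notation D := (medial T).
Implicit Types (x y : dart T) (d : dart D) (F G : face D).

Definition cf x (c : bool) : face D := face_of (D := D) (x, c).

Lemma face_ofP F : exists x c, F = cf x c.
Proof.
case: F => F FP; have /imsetP[[x c] _ e] := FP.
by exists x, c; apply: val_inj.
Qed.

Lemma porbit_mface_medial x c d :
  (d \in porbit (mface D) (x, c)) =
  (d.2 == c) && (d.1 \in porbit (if c then mnode T else mface T) x).
Proof.
have iterE n : (mface D ^+ n)%g (x, c) = (((if c then mnode T else mface T) ^+ n)%g x, c).
  elim: n => [|n IHn]; first by rewrite !expg0 !perm1.
  by rewrite !expgSr !permM IHn permE /= /med_face /=; case: c {IHn}.
apply/porbitP/andP => [[n ->]|[/eqP dc /porbitP[n dn]]].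
  by rewrite iterE /= eqxx; split=> //; apply: mem_porbit.
by exists n; rewrite iterE -dn -dc -surjective_pairing.
Qed.

Lemma cf_eq x c y c' : (cf x c == cf y c') =
  (c == c') && (x \in porbit (if c' then mnode T else mface T) y).
Proof.
rewrite -val_eqE /= eq_sym eq_porbit_mem porbit_sym.
exact: (porbit_mface_medial y c' (x, c)).
Qed.

Lemma on_faceP F (c : {set dart D}) :
  on_face F c = [exists d in c, face_of (D := D) d == F].
Proof.
rewrite /on_face; have [x [b ->]] := face_ofP F.
apply/set0Pn/exists_inP => [[d]|[d dc /eqP de]].
  rewrite inE => /andP[dF dc]; exists d => //.
  by rewrite -val_eqE /= eq_porbit_mem.
exists d; rewrite inE dc andbT -[cf x b]de /=; exact: porbit_id.
Qed.

(** The edges of D correspond to the corners of [T], hence to its darts; this one separates the face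
    [cf x false] from the vertex [cf x true]. *)
Definition cedge x : {set dart D} := porbit (medge D) (x, false).

Lemma mem_cedge x d : (d \in cedge x) = (d.1 == x).
Proof.
rewrite porbit_invol; last exact: medial_edgeK.
rewrite permE /med_edge /=; case: d => y c; rewrite !xpair_eqE /=.
by case: c; rewrite ?andbT ?andbF ?orbF.
Qed.

Lemma cedge_inj : injective cedge.
Proof.
by move=> x y /setP /(_ (x, false)); rewrite !mem_cedge /= eqxx => /esym/eqP.
Qed.

Lemma edgesE : edges D = [set cedge x | x in [set: dart T]].
Proof.
apply/setP => c; apply/imsetP/imsetP => -[]; last by move=> x _ ->; exists (x, false).
move=> [x b] _ ->; exists x => //; apply/eqP; rewrite eq_porbit_mem.
by rewrite mem_cedge.
Qed.

Lemma on_cedge F x : on_face F (cedge x) = (F == cf x false) || (F == cf x true).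
Proof.
rewrite on_faceP; apply/exists_inP/orP => [[[y c]]|].
  by rewrite mem_cedge /= => /eqP -> /eqP <-; case: c; [right|left].
by case=> /eqP ->; [exists (x, false)|exists (x, true)]; rewrite ?mem_cedge.
Qed.

Lemma mface_medge x : mface T (medge T x) = (mnode T)^-1%g x.
Proof. by apply/(canRL (permK _)); rewrite Defs.mapK. Qed.

Definition cvert x : {set dart D} := porbit (mnode D) (x, true).

(** The crossing on the edge of [x] has four outgoing medial darts. Turning around it meets [x],
    [mface (medge x)], [medge x] and [mface x] in this order, with flags alternating from [true];
    hence the exponents 0, 1, 2, 3 in the proof. *)
Lemma mem_cvert x d : (d \in cvert x) =
  (if d.2 then (d.1 == x) || (d.1 == medge T x)
   else (d.1 == mface T x) || (d.1 == mface T (medge T x))).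
Proof.
have st y : mnode D (y, true) = (mface T (medge T y), false).
  by rewrite permE /= /med_node /= mface_medge.
have sf y : mnode D (mface T y, false) = (y, true).
  by rewrite permE /= /med_node /= permK.
have eK := @medgeK T.
apply/porbitP/idP => [[n ->]|].
  elim: n => [|n]; first by rewrite expg0 perm1 /= eqxx.
  rewrite expgSr permM; case: (fun_of_perm (mnode D ^+ n)%g (x, true)) => y [] /=.
    by rewrite st /= => /orP[]/eqP->; rewrite ?eK eqxx ?orbT.
  by case/orP => /eqP ->; rewrite sf /= eqxx ?orbT.
case: d => y [] /= /orP[]/eqP->.
- by exists 0%N; rewrite expg0 perm1.
- by exists 2%N; rewrite expgS permM st expg1 sf.
- by exists 3%N; rewrite expgS permM st expgS permM sf expg1 st eK.
- by exists 1%N; rewrite expg1 st.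
Qed.

Lemma verticesE : vertices D = [set cvert x | x in [set: dart T]].
Proof.
apply/setP => c; apply/imsetP/imsetP => -[]; last by move=> x _ ->; exists (x, true).
move=> [x b] _ ->; case: b; first by exists x.
exists ((mface T)^-1%g x) => //; apply/eqP; rewrite eq_porbit_mem -/(cvert _).
by rewrite mem_cvert /= permKV eqxx.
Qed.

Lemma cvert_eq x y : (cvert x == cvert y) = (x == y) || (x == medge T y).
Proof. by rewrite eq_porbit_mem -/(cvert y) mem_cvert. Qed.

Lemma cf_mface x : cf (mface T x) false = cf x false.
Proof. by apply/eqP; rewrite cf_eq /= (mem_porbit _ 1). Qed.

Lemma on_cvert F x : on_face F (cvert x) =
  [|| F == cf x true, F == cf (medge T x) true, F == cf x false | F == cf (medge T x) false].
Proof.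
rewrite on_faceP; apply/exists_inP/or4P => [[[y c]]|].
  rewrite mem_cvert /=; case: c => /orP[]/eqP-> /eqP<-; rewrite -/(cf _ _) ?cf_mface.
  - by apply: Or41.
  - by apply: Or42.
  - by apply: Or43.
  - by apply: Or44.
have ex d c : face_of (D := D) d = cf d.1 d.2 by case: d.
case=> /eqP->.
- by exists (x, true); rewrite ?mem_cvert /= ?eqxx.
- by exists (medge T x, true); rewrite ?mem_cvert /= ?eqxx ?orbT.
- by exists (mface T x, false); rewrite ?mem_cvert /= ?eqxx// -/(cf _ _) cf_mface.
- by exists (mface T (medge T x), false); rewrite ?mem_cvert /= ?eqxx ?orbT// -/(cf _ _) cf_mface.
Qed.

End Medial.

Lemma qpow_int (z : int) : qpow z%:~R = qz z.
Proof.
case: z => n; first exact: qpow_nat.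
rewrite /qpow; case: ifPn => // /natrP[k /eqP].
by rewrite NegzE mulrNz -[n.+1%:~R]/(n.+1%:R) eqr_oppLR -subr_eq0 opprK -natrD pnatr_eq0 addSn.
Qed.

Lemma sum_face (R : pzRingType) (U : finType) (t : U -> R) F0 :
  \sum_F (F == F0)%:R * t F = t F0.
Proof.
rewrite (bigD1 F0)//= eqxx mul1r big1 ?addr0// => F /negbTE ->.
by rewrite mul0r.
Qed.

Lemma sum_face2 (R : comPzRingType) (U : finType) (t : U -> R) F0 G0 :
  \sum_F \sum_G ((F == F0) && (G == G0))%:R * t F * t G = t F0 * t G0.
Proof.
rewrite -(sum_face t F0) mulr_suml; apply: eq_bigr => F _.
rewrite -[in RHS](sum_face t G0) mulr_sumr; apply: eq_bigr => G _.
by rewrite -mulnb natrM; ring.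
Qed.

Lemma sum_quad (U : finType) (t : U -> rat) (u v w : U) :
  \sum_F \sum_G ((F == u) && (G == u) + (F == u) && (G == v) + (F == v) && (G == u) +
    (F == v) && (G == w))%N%:R * t F * t G = t u ^+ 2 + 2 * t u * t v + t v * t w.
Proof.
under eq_bigr => F _ do under eq_bigr => G _ do rewrite !natrD !mulrDl.
under eq_bigr => F _ do rewrite !big_split /=.
by rewrite !big_split /= !sum_face2; ring.
Qed.

(* Unfolding [cf] makes comparisons of faces very slow. *)
Opaque cf.

(** * The multisum of a medial graph *)

Section MultisumOfLabels.
Variables (T : tait) (la lb : dart T -> nat) (b : bool) (A : {set face (medial T)}).
Notation D := (medial T).
Implicit Types (x y : dart T) (F G : face D).

Definition lab x (c : bool) : nat := if c then lb x else la x.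

(* For b = false the A-faces are the faces of T, and for b = true its vertices. *)
Hypothesis AE : forall x c, (cf x c \in A) = (c == b).
Hypothesis laP : forall x y, (la x == la y) = (x \in porbit (mface T) y).
Hypothesis lbP : forall x y, (lb x == lb y) = (x \in porbit (mnode T) y).
Hypothesis lab_neq : forall x y, la x != lb y.
Hypothesis no_loop : forall x, lab x (~~ b) != lab (medge T x) (~~ b).

Lemma cf_lab x c y c' : (cf x c == cf y c') = (lab x c == lab y c').
Proof.
rewrite cf_eq /lab; case: c; case: c' => /=; rewrite ?lbP ?laP//.
  by rewrite eq_sym (negbTE (lab_neq _ _)).
by rewrite (negbTE (lab_neq _ _)).
Qed.

(** Every face has the form [cf x c] by [face_ofP], so one of the two searches succeeds and the
    default 0 is never taken. *)
Definition labF F : nat :=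
  if [pick x | F == cf x true] is Some x then lab x true
  else if [pick x | F == cf x false] is Some x then lab x false else 0.

Lemma labF_cf x c : labF (cf x c) = lab x c.
Proof.
rewrite /labF; case: pickP => [y|/(_ x)]; first by rewrite cf_lab => /eqP.
case: c => [|_]; first by rewrite eqxx.
case: pickP => [y|/(_ x)]; first by rewrite cf_lab => /eqP.
by rewrite eqxx.
Qed.

Lemma labF_inj : injective labF.
Proof.
move=> F G; have [x [c ->]] := face_ofP F; have [y [c' ->]] := face_ofP G.
by rewrite !labF_cf => /eqP; rewrite -cf_lab => /eqP.
Qed.

Notation ca x := (cf x b).
Notation cb x := (cf x (~~ b)).

Lemma ca_cb x y : (ca x == cb y) = false.
Proof. by rewrite cf_eq; case: (b). Qed.

Lemma cb_ca x y : (cb x == ca y) = false.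
Proof. by rewrite eq_sym ca_cb. Qed.

Lemma caA x : ca x \in A. Proof. by rewrite AE eqxx. Qed.
Lemma cbA x : cb x \notin A. Proof. by rewrite AE; case: (b). Qed.

Lemma Aface F : F \in A -> exists x, F = ca x.
Proof.
by have [x [c ->]] := face_ofP F; rewrite AE => /eqP ->; exists x.
Qed.

Lemma Bface F : F \notin A -> exists x, F = cb x.
Proof.
have [x [c ->]] := face_ofP F; rewrite AE => cb; exists x.
by congr cf; case: c (b) cb => [] [].
Qed.

Lemma cb_edge x : (cb x == cb (medge T x)) = false.
Proof. by rewrite cf_lab (negbTE (no_loop x)). Qed.

Lemma card_sum (U : finType) (p : pred U) : #|[set x | p x]| = (\sum_x p x)%N.
Proof. by rewrite cardsE -sum1_card big_mkcond; apply: eq_bigr => x _; rewrite -[x \in _]/(p x); case: (p x). Qed.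

Lemma card_edges (P : pred {set dart D}) :
  #|[set c in edges D | P c]| = (\sum_x P (cedge x))%N.
Proof.
rewrite -card_sum -(card_imset _ (@cedge_inj T)); congr #|pred_of_set _|.
apply/setP => c; rewrite inE edgesE; apply/andP/imsetP.
  by move=> [/imsetP[x _ ->] Pc]; exists x; rewrite ?inE.
by move=> [x]; rewrite inE => Px ->; split=> //; apply: imset_f.
Qed.

Lemma on_cedge_b F x : on_face F (cedge x) = (F == ca x) || (F == cb x).
Proof. rewrite on_cedge; case: (b); [exact: orbC|by []]. Qed.

Lemma nb_edgesE F : F \in A -> nb_edges F = (\sum_x (F == ca x))%N.
Proof.
move=> /Aface[y ->]; rewrite /nb_edges card_edges; apply: eq_bigr => x _.
by rewrite on_cedge_b ca_cb orbF.
Qed.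

Lemma ceE F G : F \in A -> G \notin A ->
  ce F G = (\sum_x ((F == ca x) && (G == cb x)))%N.
Proof.
move=> /Aface[y ->] /Bface[z ->]; rewrite /ce card_edges; apply: eq_bigr => x _.
by rewrite !on_cedge_b ca_cb cb_ca orbF.
Qed.

Lemma ceC F G : ce F G = ce G F.
Proof. by rewrite /ce; congr #|pred_of_set _|; apply/setP => c; rewrite !inE; congr (_ && _); rewrite andbC. Qed.

(** A common crossing of two distinct B-faces comes from an edge of [T], and exactly one of the two
    darts of this edge has [F] on its own side and [G] on the side of its reverse. *)
Lemma cvE F G : F \notin A -> G \notin A -> F != G ->
  cv F G = (\sum_x ((F == cb x) && (G == cb (medge T x))))%N.
Proof.
move=> FA GA FG; rewrite -card_sum /cv.
have onB H x : H \notin A -> on_face H (cvert x) = (H == cb x) || (H == cb (medge T x)).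
  move=> /Bface[z ->]; rewrite on_cvert !cf_eq.
  by case: (b); rewrite /= ?orbF.
rewrite -(card_in_imset (f := @cvert T)).
  congr #|pred_of_set _|; apply/setP => c; rewrite inE verticesE.
  apply/andP/imsetP => [[/imsetP[x _ ->]]|[x]].
    rewrite !onB// => /andP[/orP[Fx|Fx] /orP[Gx|Gx]].
    - by case/eqP: FG; rewrite (eqP Fx) (eqP Gx).
    - by exists x; rewrite ?inE ?Fx.
    - exists (medge T x); first by rewrite inE Fx medgeK.
      by apply/eqP; rewrite cvert_eq medgeK eqxx orbT.
    - by case/eqP: FG; rewrite (eqP Fx) (eqP Gx).
  rewrite inE => /andP[Fx Gx] ->; split; first exact: imset_f.
  by rewrite !onB// Fx Gx orbT.
move=> x y; rewrite !inE => /andP[/eqP Fx _] /andP[Fy _] /eqP.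
rewrite cvert_eq => /orP[/eqP//|/eqP xy].
by move: Fy; rewrite Fx xy eq_sym cb_edge.
Qed.

(** A single count over darts for all cases of [Q]: it turns the quadratic form into the sum over
    the edges of D that [expo] uses. The diagonal entries of B-faces vanish by [no_loop]. *)
Lemma QE F G : Q A F G = (\sum_x ((F == ca x) && (G == ca x) +
  (F == ca x) && (G == cb x) + (F == cb x) && (G == ca x) +
  (F == cb x) && (G == cb (medge T x))))%N.
Proof.
rewrite /Q; case: (eqVneq F G) => [->|FG].
  case: (boolP (G \in A)) => [GA|/Bface[y ->]].
    rewrite nb_edgesE//; have [y ->] := Aface GA; apply: eq_bigr => x _.
    by rewrite andbb !ca_cb !andbF /= !addn0.
  rewrite big1// => x _; rewrite !cb_ca !andbF /= !add0n.
  case: eqP => [->|//]; by rewrite cb_edge.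
case: (boolP (F \in A)) => FA; case: (boolP (G \in A)) => GA.
- have [y Fy] := Aface FA; have [z Gz] := Aface GA.
  rewrite big1// => x _; rewrite Gz !ca_cb !andbF !addn0 -Gz Fy ca_cb -Fy addn0.
  by case: eqP => //= Fx; rewrite -Fx eq_sym (negbTE FG).
- rewrite ceE//; have [y ->] := Aface FA; have [z ->] := Bface GA.
  by apply: eq_bigr => x _; rewrite !cb_ca !ca_cb !andbF /= !addn0.
- rewrite ceC ceE//; have [z ->] := Bface FA; have [y ->] := Aface GA.
  by apply: eq_bigr => x _; rewrite !cb_ca !ca_cb !andbF /= !addn0 andbC.
- rewrite cvE//; have [z ->] := Bface FA; have [y ->] := Bface GA.
  by apply: eq_bigr => x _; rewrite !cb_ca /= !andbF.
Qed.

Lemma sum_Q (t : face D -> rat) :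
  \sum_F \sum_G (Q A F G)%:R * t F * t G =
  \sum_x (t (ca x) ^+ 2 + 2 * t (ca x) * t (cb x) + t (cb x) * t (cb (medge T x))).
Proof.
under eq_bigr => F _ do under eq_bigr => G _ do
  rewrite QE natr_sum !mulr_suml.
under eq_bigr => F _ do rewrite exchange_big /=.
by rewrite exchange_big; apply: eq_bigr => x _; exact: sum_quad.
Qed.

Lemma sum_nb_edges (t : face D -> rat) :
  \sum_(F in A) (nb_edges F)%:R * t F = \sum_x t (ca x).
Proof.
under eq_bigr => F FA do rewrite nb_edgesE// natr_sum mulr_suml.
rewrite exchange_big; apply: eq_bigr => x _ /=.
rewrite (bigD1 (ca x)) ?caA//= eqxx mul1r big1 ?addr0// => F /andP[_ /negbTE ->].
by rewrite mul0r.
Qed.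

Lemma card_vertices : (#|vertices D| * 2)%N = #|dart T|.
Proof.
rewrite -sum1_card -[RHS]cardsT -[RHS]sum1_card.
rewrite (partition_big (@cvert T) (mem (vertices D))) => [|x _] /=; last first.
  by rewrite verticesE imset_f.
rewrite big_distrl /=; apply: eq_bigr => c; rewrite verticesE => /imsetP[x _ ->].
rewrite mul1n (eq_bigl (mem [set x; medge T x])); last first.
  by move=> y; rewrite !inE cvert_eq.
by rewrite sum1_card cards2 eq_sym medge_neq.
Qed.

(** * From labelled systems to the multisum of the diagram *)

Section Transfer.
Variables (Xf Fs : face D) (S : system nat) (f0 v0 : nat) (W : fps).
Hypothesis iS : sys_inv f0 v0 S W.
Hypothesis pS : perm_eq (alab S ++ blab S) (labels f0 v0 S).
Hypothesis aS : alab S =i unzip1 (corners S).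
Hypothesis bS : blab S =i unzip2 (corners S).
Hypothesis cS : perm_eq (corners S) [seq (lab x b, lab x (~~ b)) | x <- enum (dart T)].
(** A bond is listed once per crossing, while the darts of [T] give each crossing twice, once in
    either direction. *)
Hypothesis dS : perm_eq (bonds S ++ [seq (v.2, v.1) | v <- bonds S])
  [seq (lab x (~~ b), lab (medge T x) (~~ b)) | x <- enum (dart T)].
(** The A-colored label [f0] belongs to X for K and to F* for -K, so the order is left open. *)
Hypothesis zX : perm_eq [:: f0; v0] [:: labF Xf; labF Fs].
Implicit Types (s : {ffun face D -> int}) (u : nat -> int).

Definition pull u : {ffun face D -> int} := [ffun F => u (labF F)].

Lemma pull_cf u x c : pull u (cf x c) = u (lab x c).
Proof. by rewrite ffunE labF_cf. Qed.

Lemma perm_labels_uniq : uniq (alab S ++ blab S).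
Proof. by rewrite (perm_uniq pS); apply: inv_uniq iS. Qed.

Lemma perm_alab : perm_eq (alab S) (map labF (enum A)).
Proof.
apply: uniq_perm.
- by have := perm_labels_uniq; rewrite cat_uniq => /andP[].
- by rewrite map_inj_uniq ?enum_uniq//; exact: labF_inj.
move=> l; rewrite aS /unzip1 (perm_mem (perm_map _ cS)) -map_comp; apply/mapP/mapP.
  by move=> [x _ ->]; exists (ca x); rewrite ?mem_enum ?caA//= labF_cf.
move=> [F]; rewrite mem_enum => /Aface[x ->] ->; exists x; rewrite ?mem_enum//.
by rewrite labF_cf.
Qed.

Lemma perm_blab : perm_eq (blab S) (map labF (enum (~: A))).
Proof.
apply: uniq_perm.
- by have := perm_labels_uniq; rewrite cat_uniq => /and3P[].
- by rewrite map_inj_uniq ?enum_uniq//; exact: labF_inj.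
move=> l; rewrite bS /unzip2 (perm_mem (perm_map _ cS)) -map_comp; apply/mapP/mapP.
  by move=> [x _ ->]; exists (cb x); rewrite ?mem_enum ?inE ?cbA//= labF_cf.
move=> [F]; rewrite mem_enum inE => /Bface[x ->] ->; exists x; rewrite ?mem_enum//.
by rewrite labF_cf.
Qed.

Lemma sum_alab u : \sum_(l <- alab S) u l = \sum_(F in A) pull u F.
Proof.
rewrite (perm_big _ perm_alab) big_map big_enum.
by apply: eq_bigr => F _; rewrite ffunE.
Qed.

Lemma sum_blab u : \sum_(l <- blab S) u l = \sum_(F | F \notin A) pull u F.
Proof.
rewrite (perm_big _ perm_blab) big_map big_enum.
by apply: eq_big => [F|F _]; rewrite ?inE ?ffunE.
Qed.

Lemma sum_corners (R : nmodType) (g : nat * nat -> R) :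
  \sum_(c <- corners S) g c = \sum_x g (lab x b, lab x (~~ b)).
Proof. by rewrite (perm_big _ cS) big_map big_enum. Qed.

Lemma sum_bonds u : 2 * \sum_(c <- bonds S) u c.1 * u c.2 =
  \sum_x u (lab x (~~ b)) * u (lab (medge T x) (~~ b)).
Proof.
have <- : \sum_(c <- bonds S ++ [seq (v.2, v.1) | v <- bonds S]) u c.1 * u c.2 =
    \sum_x u (lab x (~~ b)) * u (lab (medge T x) (~~ b)).
  by rewrite (perm_big _ dS) big_map big_enum.
rewrite big_cat big_map /=.
rewrite mulr_natl mulr2n; congr (_ + _).
by apply: eq_bigr => c _; rewrite mulrC.
Qed.

Lemma expo_double u : 2 * expo S u =
  \sum_x (u (lab x b) ^+ 2 + 2 * u (lab x b) * u (lab x (~~ b)) +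
          u (lab x (~~ b)) * u (lab (medge T x) (~~ b))) +
  \sum_x u (lab x b) + 2 * \sum_(F | F \notin A) pull u F - 2 * \sum_(F in A) pull u F.
Proof.
rewrite /expo sum_alab sum_blab sum_corners /=.
rewrite mulrBr mulrDr mulrDr sum_bonds; congr (_ + _ - _).
rewrite mulr_sumr -!big_split /=; apply: eq_bigr => x _.
by rewrite mulrDr triE; ring.
Qed.

Lemma sum_neX (g : face D -> rat) : g Xf = 0 -> \sum_(F | F != Xf) g F = \sum_F g F.
Proof. by move=> g0; rewrite [RHS](bigD1 Xf)//= g0 add0r. Qed.

Lemma double_L' s : s Xf = 0 -> 2 * L' A Xf s =
  (\sum_x s (ca x) + 2 * \sum_(F | F \notin A) s F - 2 * \sum_(F in A) s F)%:~R.
Proof.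
move=> s0; rewrite /L' sum_neX; last by rewrite s0 mulr0.
rewrite (bigID (mem A)) /= !(rmorphB, rmorphD, rmorphM) /= !rmorph_sum /=.
rewrite (eq_bigr (fun F => 2^-1 * ((nb_edges F)%:R * (s F)%:~R) - (s F)%:~R)); last first.
  by move=> F FA; rewrite /L FA; field.
rewrite [X in _ * (_ + X)](eq_bigr (fun F => (s F)%:~R)); last first.
  by move=> F /negbTE FA; rewrite /L FA mul1r.
rewrite sumrB -mulr_sumr (sum_nb_edges (fun F => (s F)%:~R)).
by field.
Qed.

Lemma double_Q' s : s Xf = 0 -> 2 * Q' A Xf s =
  (\sum_x (s (ca x) ^+ 2 + 2 * s (ca x) * s (cb x) + s (cb x) * s (cb (medge T x))))%:~R.
Proof.
move=> s0; rewrite /Q' mulrA mulfV// mul1r sum_neX; last first.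
  by rewrite big1// => G _; rewrite s0 mulr0 mul0r.
under eq_bigr => F _ do rewrite sum_neX ?s0 ?mulr0//.
rewrite (sum_Q (fun F => (s F)%:~R)) rmorph_sum; apply: eq_bigr => x _ /=.
by rewrite !(rmorphD, rmorphM, rmorphXn).
Qed.

Lemma pull0 u : (pull u Xf = 0 /\ pull u Fs = 0) <-> (u f0 = 0 /\ u v0 = 0).
Proof.
have -> : (pull u Xf = 0 /\ pull u Fs = 0) <-> all (fun l => u l == 0) [:: labF Xf; labF Fs].
  by rewrite /= !ffunE andbT; split=> [[-> ->]|/andP[/eqP-> /eqP->]]; rewrite ?eqxx.
rewrite -(perm_all _ zX) /= andbT.
by split=> [/andP[/eqP-> /eqP->]|[-> ->]]; rewrite ?eqxx.
Qed.

Lemma expo_QL u : pull u Xf = 0 ->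
  Q' A Xf (pull u) + L' A Xf (pull u) = (expo S u)%:~R.
Proof.
move=> u0; have n2 : (2 : rat) != 0 by [].
apply: (mulfI n2); rewrite mulrDr double_L'// double_Q'//.
rewrite -rmorphD -[2 in RHS]/(2%:~R) -intrM expo_double; congr _%:~R.
rewrite !addrA; congr (_ + _ + _ - _); first by apply: eq_bigr => x _; rewrite !pull_cf.
by apply: eq_bigr => x _; rewrite pull_cf.
Qed.

Lemma pull_sign u : pull u Xf = 0 ->
  (-1 : fps) ^ (Num.floor (2 * L' A Xf (pull u))) = (-1) ^ (\sum_(c <- corners S) u c.1).
Proof.
move=> u0; rewrite double_L'// intrKfloor sum_corners /=.
under eq_bigr => x _ do rewrite pull_cf.
rewrite -addrA -mulrBr signzD.
rewrite [2 * _](_ : _ = (\sum_(F | F \notin A) pull u F - \sum_(F in A) pull u F) +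
  (\sum_(F | F \notin A) pull u F - \sum_(F in A) pull u F)); last by ring.
by rewrite signzD signz_sq mulr1.
Qed.

Lemma edge_val_pull u x : edge_val (pull u) (cedge x) = u (lab x b) + u (lab x (~~ b)).
Proof.
rewrite /edge_val (eq_bigl (mem [:: ca x; cb x])); last first.
  by move=> F; rewrite on_cedge_b !inE.
rewrite -big_uniq /=; last by rewrite inE ca_cb.
by rewrite big_cons big_seq1 !pull_cf.
Qed.

Lemma pull_prod u :
  \prod_(c in edges D) iqz (edge_val (pull u) c) = corner_prod S u.
Proof.
rewrite edgesE big_imset /=; last by move=> x y _ _ /cedge_inj.
rewrite /corner_prod (perm_big _ cS) big_map big_enum /=.
by apply: eq_big => [x|x _]; rewrite ?inE ?edge_val_pull.
Qed.

Lemma term_pull u : pull u Xf = 0 -> term A Xf (pull u) = sterm S u.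
Proof.
by move=> u0; rewrite /term /sterm pull_sign// expo_QL// qpow_int pull_prod.
Qed.

Lemma lambda_valid u : Lambda Xf Fs (pull u) <-> [/\ u f0 = 0, u v0 = 0 & valid S u].
Proof.
rewrite /Lambda /=; split=> [[uX uF ue]|[uf uv /allP ue]].
  have [uf uv] := (pull0 u).1 (conj uX uF); split=> //; apply/allP => c.
  rewrite (perm_mem cS) => /mapP[x _ ->] /=; rewrite -edge_val_pull; apply: ue.
  by rewrite edgesE imset_f.
have [uX uF] := (pull0 u).2 (conj uf uv); split=> // c.
rewrite edgesE => /imsetP[x _ ->]; rewrite edge_val_pull.
apply: (ue (lab x b, lab x (~~ b))); rewrite (perm_mem cS).
by apply/mapP; exists x; rewrite ?mem_enum.
Qed.

(** Unlike [Lambda], this set is the bijective image of all assignments to the new labels. The added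
    terms are 0, since 1/(q)_n = 0 for n < 0. *)
Definition zero_at : set {ffun face D -> int} := [set s | s Xf = 0 /\ s Fs = 0]%classic.

Lemma labF_labels F : labF F \in labels f0 v0 S.
Proof.
rewrite -(perm_mem pS) mem_cat (perm_mem perm_alab) (perm_mem perm_blab).
by apply/orP; case: (boolP (F \in A)) => FA; [left|right]; apply: map_f;
  rewrite mem_enum ?inE.
Qed.

Lemma labels_labF l : l \in labels f0 v0 S -> exists F, l = labF F.
Proof.
rewrite -(perm_mem pS) mem_cat (perm_mem perm_alab) (perm_mem perm_blab).
by case/orP => /mapP[F _ ->]; exists F.
Qed.

Lemma newlab0 l : l \notin newlab S -> l \in labels f0 v0 S -> l = f0 \/ l = v0.
Proof. by rewrite !inE => /negbTE -> /or3P[/eqP|/eqP|//]; [left|right]. Qed.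

Lemma pull_bij : set_bij (asg (newlab S) (fun=> 0)) zero_at pull.
Proof.
have /andP[f0N /andP[v0N _]] : (f0 \notin newlab S) && ((v0 \notin newlab S) && true).
  by have := inv_uniq iS; rewrite /= inE negb_or => /and3P[/andP[_ ->] ->].
split=> [u ua|u u' /set_mem ua /set_mem ua' uu|s [sX sF]].
- by apply/pull0; rewrite !ua.
- apply/funext => l; case: (boolP (l \in newlab S)) => [lN|lN]; last by rewrite ua// ua'.
  have [|F ->] := @labels_labF l; first by rewrite !inE lN !orbT.
  by have := congr1 (fun s : {ffun _ -> _} => s F) uu; rewrite !ffunE.
(* The default 0 is forced: [asg] requires the value 0 at numbers that label no face. *)
pose u l := if [pick F | labF F == l] is Some F then s F else 0.
have us : pull u = s.
  apply/ffunP => F; rewrite ffunE /u; case: pickP => [G /eqP/labF_inj -> //|/(_ F)].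
  by rewrite eqxx.
exists u => // l lN; rewrite /u; case: pickP => // F /eqP Fl.
have uz := (pull0 u).1; rewrite us in uz; have [uf uv] := uz (conj sX sF).
have sE : s F = u l by rewrite -us ffunE Fl.
by have := labF_labels F; rewrite Fl => /(newlab0 lN)[] le; rewrite sE le.
Qed.

Lemma size_bonds : size (bonds S) = #|vertices D|.
Proof.
have := perm_size dS; rewrite size_cat !size_map -enumT -cardT -card_vertices addnn muln2. exact: double_inj.
Qed.

Lemma Phi_transfer : Phi_defined A Xf Fs /\ Phi_series A Xf Fs = W.
Proof.
have LZ s : Lambda Xf Fs s -> zero_at s by case.
have [_ _ sur] := pull_bij.
have pullX u : zero_at (pull u) -> pull u Xf = 0 by case.
have term0 s : zero_at s -> ~ Lambda Xf Fs s -> term A Xf s = 0.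
  move=> sz; have [u _ us] := sur s sz; rewrite -us in sz *.
  move=> nL; rewrite term_pull ?sterm_eq0//; last exact: pullX.
  apply/negP => uv; apply: nL; apply/lambda_valid.
  by have [uf u0] := (pull0 u).1 sz.
have tE u : asg (newlab S) (fun=> 0) u -> sterm S u = (term A Xf \o pull) u.
  move=> ua; rewrite /= term_pull//; apply: pullX.
  by have [+ _ _] := pull_bij; apply.
have sumz : fps_summable zero_at (term A Xf).
  by apply: (reindex_summable pull_bij); apply: eq_summable tE _; apply: inv_summable iS.
split.
  split=> [s sL|]; last exact: sub_summable sumz.
  have [u _ us] := sur s (LZ s sL); rewrite -us in sL *.
  have [uf u0 uv] := (lambda_valid u).1 sL.
  rewrite expo_QL; last by case: (LZ _ sL).
  by have := inv_ge0 iS uf u0 uv; case: (expo S u) => // n _; rewrite -[_%:~R]/(n%:R) natr_nat.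
rewrite /Phi_series (fps_sum_widen LZ term0) (fps_sum_reindex _ pull_bij).
by rewrite -(eq_fps_sum tE) -size_bonds (inv_sum iS).
Qed.

End Transfer.

(** * The choice of F* *)

Lemma same_XE x y c : (cf x c \in same_X A (cf y false)) = ~~ c.
Proof. by rewrite inE !AE; case: (b); case: c. Qed.

Lemma opp_XE x y c : (cf x c \in opp_X A (cf y false)) = c.
Proof. by rewrite inE !AE; case: (b); case: c. Qed.

Lemma ce_gt0 x y :
  reflect (exists2 z, lb z = lb x & la z = la y) (0 < ce (cf x true) (cf y false))%N.
Proof.
rewrite /ce card_edges lt0n sum_nat_eq0 negb_forall; apply: (iffP existsP) => -[z].
  rewrite eqb0 negbK !on_cedge !cf_lab /lab /= eq_sym (negbTE (lab_neq _ _)) /=.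
  by rewrite [la y == lb z](negbTE (lab_neq _ _)) orbF => /andP[/eqP e1 /eqP e2]; exists z.
move=> zx zy; exists z; rewrite eqb0 negbK !on_cedge !cf_lab /lab /= zx zy.
by rewrite !eqxx orbT.
Qed.

(** A vertex lying on all faces of [T] attains the largest conceivable first count, so every
    maximizer of that count lies on all faces too. *)
Lemma admissibleP xo x0 Fs :
  (forall y, exists2 x, lb x = lb x0 & la x = la y) ->
  Fs \in admissible A (cf xo false) ->
  exists2 x1, Fs = cf x1 true & forall y, exists2 x, lb x = lb x1 & la x = la y.
Proof.
move=> x0P; rewrite inE => /andP[+ _]; rewrite inE => /andP[Fo /forall_inP Fmax].
have [x1 [c Fx]] := face_ofP Fs; move: Fo; rewrite Fx opp_XE => ct.
rewrite ct in Fx *; exists x1 => // y.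
have := Fmax (cf x0 true); rewrite opp_XE => /(_ isT) le.
have full : [set G in same_X A (cf xo false) | (0 < ce (cf x0 true) G)%N] = same_X A (cf xo false).
  apply/setP => G; rewrite inE; case: (boolP (G \in _)) => //=.
  have [z [c' ->]] := face_ofP G; rewrite same_XE => /negbTE ->.
  by apply/ce_gt0.
have sub : [set G in same_X A (cf xo false) | (0 < ce Fs G)%N] \subset same_X A (cf xo false).
  by apply/subsetP => G; rewrite inE => /andP[].
have /eqP/setP/(_ (cf y false)) : [set G in same_X A (cf xo false) | (0 < ce Fs G)%N] == same_X A (cf xo false).
  by rewrite eqEcard sub /=; move: le; rewrite /nb_adj full.
rewrite inE same_XE /= Fx => /ce_gt0 [z zx zy].
by exists z.
Qed.

End MultisumOfLabels.
(** * Face codes *)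

Definition poly_sizes (L : Type) (sts : seq (glue_step L)) : seq nat :=
  pmap (fun st => if st is Polygon _ ws _ then Some (size ws).+2 else None) sts.

Lemma poly_sizesE (L : choiceType) (sts : seq (glue_step L)) :
  \prod_(st <- sts) step_val st = \prod_(n <- poly_sizes sts) h n.
Proof.
elim: sts => [|[f u v|f ws v] sts IHsts]; rewrite ?big_nil// !big_cons IHsts.
  by rewrite /= mul1r.
by [].
Qed.

Lemma fcycle_iter (P : int -> int) (c : seq int) x y : fcycle P c ->
  x \in c -> y \in c -> exists k, y = iter k P x.
Proof.
move=> Pc xc; case/rot_to: (xc) => i c' ic; rewrite -(mem_rot i c) ic => yc.
move: Pc; rewrite -(rot_cycle i) ic /= => /fpathP[n cn].
have : y \in traject P x n.+1.
  move: yc; rewrite trajectS -cn !inE mem_rcons inE => /orP[->//|->].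
  by rewrite !orbT.
by case/trajectP => k _ ->; exists k.
Qed.

(** A certificate, decidable by computing with lists of integers, that [g] takes equal values
    exactly on the orbits of [P]; [cs] lists the orbits as cycles. *)
Definition orbit_labels (P : int -> int) (cs : seq (seq int)) (s : seq int) (g : int -> nat) :=
  [&& all (fun c => fcycle P c) cs, all (fun z => has (fun c => z \in c) cs) s &
    all (fun c => all (fun z => all (fun c' => all (fun w => (g z == g w) == (c == c')) c') cs) c) cs].

Lemma orbit_labelsP (s : seq int) (p : {perm (seq_sub s)}) P cs g :
  (forall x, val (p x) = P (val x)) -> orbit_labels P cs s g ->
  forall x y, (g (val x) == g (val y)) = (x \in porbit p y).
Proof.
move=> pP /and3P[/allP Pcs /allP scs /allP gcs] x y.
have vit k z : val ((p ^+ k)%g z) = iter k P (val z).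
  by elim: k => [|k IHk]; rewrite ?expg0 ?perm1// expgSr permM pP IHk.
have /hasP[c cc xc] := scs _ (valP x); have /hasP[c' cc' yc'] := scs _ (valP y).
have /allP/(_ _ xc)/allP/(_ _ cc')/allP/(_ _ yc')/eqP -> := gcs _ cc.
apply/eqP/porbitP => [e|[k xk]].
  rewrite -e in yc'; have [k kE] := fcycle_iter (Pcs _ cc) yc' xc.
  by exists k; apply: val_inj; rewrite vit.
have itc j : iter j P (val y) \in c'.
  elim: j => //= j IHj; have /eqP -> := next_cycle (Pcs _ cc') IHj.
  by rewrite mem_next.
have := itc k; rewrite -vit -xk => xc'.
by have /allP/(_ _ xc)/allP/(_ _ cc')/allP/(_ _ xc')/eqP := gcs _ cc; rewrite eqxx => /esym/eqP.
Qed.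

Definition nextf (l : seq (seq int)) (x : int) : int :=
  next (nth [::] l (find (fun c => x \in c) l)) x.

Section Codes.
Variables (fs : face_code) (vs : seq (seq int)) (laz lbz : int -> nat).

Definition labz (z : int) (c : bool) : nat := if c then lbz z else laz z.

(** The second test turns around a vertex by [mface] after [medge], which is the inverse of [mnode].
    The last test excludes loops in the dual of [T] and in [T], as [no_loop] demands for -K and K
    respectively. *)
Definition code_labels (l : seq (seq int)) : bool :=
  [&& orbit_labels (nextf l) l (flatten l) laz,
      orbit_labels (fun z => nextf l (- z)) vs (flatten l) lbz,
      all (fun z => all (fun w => laz z != lbz w) (flatten l)) (flatten l) &
      all (fun z => (laz z != laz (- z)) && (lbz z != lbz (- z))) (flatten l)].

(** The origin of [z] lies on every face of the graph. As soon as one such vertex exists, every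
    admissible F* is one, by [admissibleP]. *)
Definition full_vertex (l : seq (seq int)) (z : int) : bool :=
  all (fun y => has (fun w => (lbz w == lbz z) && (laz w == laz y)) (flatten l)) (flatten l).

Definition code_build (b : bool) (l : seq (seq int)) (z : int) v1 sts : bool :=
  let zo := head 0 (head [::] l) in
  let f0 := if b then lbz z else laz zo in let v0 := if b then laz zo else lbz z in
  [&& build_ok f0 v0 v1 sts,
      perm_eq (corners (build f0 v0 v1 sts)) [seq (labz z b, labz z (~~ b)) | z <- flatten l] &
      perm_eq (bonds (build f0 v0 v1 sts) ++ [seq (v.2, v.1) | v <- bonds (build f0 v0 v1 sts)])
        [seq (labz z (~~ b), labz (- z) (~~ b)) | z <- flatten l]].

Let T : tait := fs.
Let la (x : dart T) := laz (val x).
Let lb (x : dart T) := lbz (val x).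

Lemma perm_enum_darts (R : eqType) (g : int -> R) :
  perm_eq [seq g (val x) | x <- enum (dart T)] (map g (flatten fs)).
Proof.
rewrite (map_comp g val); apply: perm_map; apply: uniq_perm.
- by rewrite map_inj_uniq ?enum_uniq//; apply: val_inj.
- by case/and4P: (face_listP fs).
move=> z; apply/mapP/idP => [[x _ ->]|zl]; first exact: (valP x).
by exists (SeqSub zl : dart T); rewrite ?mem_enum.
Qed.

Lemma code_labelsP : code_labels fs -> [/\
  forall x y, (la x == la y) = (x \in porbit (mface T) y),
  forall x y, (lb x == lb y) = (x \in porbit (mnode T) y),
  forall x y, la x != lb y &
  forall x, (la x != la (medge T x)) && (lb x != lb (medge T x))].
Proof.
case/and4P => oa ob ab nl; split.
- by apply: (orbit_labelsP _ oa) => x; rewrite permE.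
- move=> x y; rewrite -porbitV; apply: (orbit_labelsP (p := (mnode T)^-1%g) _ ob) => z.
  transitivity (val (mface T (medge T z))); first by congr val; rewrite (mface_medge (T := T)).
  by rewrite !permE.
- by move=> x y; apply: (allP (allP ab _ (valP x)) _ (valP y)).
- by move=> x; have := allP nl _ (valP x); rewrite /la /lb permE.
Qed.

(** All possible choices of F* are covered by giving a gluing sequence for each full vertex; the
    sequences may differ as long as their values agree. *)
Lemma Phi_code (b : bool) (W : fps) : code_labels fs ->
  has (full_vertex fs) (flatten fs) ->
  (forall z, z \in flatten fs -> full_vertex fs z ->
     exists v1 sts, code_build b fs z v1 sts /\ \prod_(n <- poly_sizes sts) h n = W) ->
  Phi_is (if b then ~: tait_A T else tait_A T) (tait_X T) W.
Proof.
move=> /code_labelsP[laP lbP lab_neq nl] /hasP[z0 z0l z0f] bld.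
set A := if b then _ else _.
have AE x c : (cf x c \in A) = (c == b).
  by rewrite /A; case: (b); rewrite ?in_setC tait_AE; case: c.
have no_loop x : lab la lb x (~~ b) != lab la lb (medge T x) (~~ b).
  by rewrite /lab; case: (b); case/andP: (nl x).
have fullP (x0 : dart T) : full_vertex fs (val x0) <->
    (forall y : dart T, exists2 x, lb x = lb x0 & la x = la y).
  split=> [/allP f y|f].
    have /hasP[w wl /andP[/eqP e1 /eqP e2]] := f _ (valP y).
    by exists (SeqSub wl : dart T).
  apply/allP => y yl; have [x e1 e2] := f (SeqSub yl : dart T).
  by apply/hasP; exists (val x); [exact: (valP x)|apply/andP; split; apply/eqP].
move=> Fs Fadm.
have [x1 Fx /fullP x1f] := admissibleP AE laP lbP lab_neq
  ((fullP (SeqSub z0l : dart T)).1 z0f) Fadm.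
have [v1 [sts [/and3P[ok cS dS] <-]]] := bld _ (valP x1) x1f.
have iS := build_inv ok; have [pS _ _ aS bS] := build_labels ok.
rewrite -poly_sizesE.
apply: (Phi_transfer AE laP lbP lab_neq no_loop iS pS aS bS).
- apply: perm_trans cS _; rewrite perm_sym.
  by apply: perm_trans (perm_enum_darts _); apply: perm_refl.
- apply: perm_trans dS _; rewrite perm_sym.
  apply: perm_trans (perm_enum_darts (fun z => (labz z (~~ b), labz (- z) (~~ b)))).
  by rewrite (eq_map (g := fun x => (lab la lb x (~~ b), lab la lb (medge T x) (~~ b))))// => x;
     rewrite /lab /la /lb permE.
rewrite Fx !(labF_cf laP lbP lab_neq) /lab.
case: (b) => //; by rewrite (perm_catC [:: _] [:: _]).
Qed.

End Codes.
(** The list [progs] gives, for each admissible F* (as a vertex number), the second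
    end of the initial edge and a list of gluing steps; [vs] lists the darts around
    each vertex, in clockwise order. *)
Section Check.
Variables (l : seq (seq int)) (vs : seq (seq int)).

Definition find_face (z : int) : nat := find (fun c => z \in c) l.
Definition find_vertex (z : int) : nat := size l + find (fun c => z \in c) vs.

Definition code_check (b : bool) (progs : seq (nat * nat * seq (glue_step nat)))
    (ns : seq nat) : bool :=
  [&& code_labels vs find_face find_vertex l,
      has (full_vertex find_face find_vertex l) (flatten l) &
      all (fun z => full_vertex find_face find_vertex l z ==>
        has (fun pr => [&& pr.1.1 == find_vertex z,
             code_build find_face find_vertex b l z pr.1.2 pr.2 &
             perm_eq (poly_sizes pr.2) ns]) progs) (flatten l)].

End Check.

Lemma has_ex (U : Type) (p : pred U) s : has p s -> exists x, p x.
Proof. by elim: s => //= x s IHs /orP[px|/IHs//]; exists x. Qed.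

Lemma Phi_check (fs : face_code) (b : bool) l vs progs ns : face_list fs = l ->
  code_check l vs b progs ns ->
  Phi_is (if b then ~: tait_A fs else tait_A fs) (tait_X fs) (\prod_(n <- ns) h n).
Proof.
move=> fl /and3P[cl hf /allP bl].
apply: (Phi_code (vs := vs) (laz := find_face l) (lbz := find_vertex l vs)); rewrite ?fl//.
move=> z zl zf; have /implyP/(_ zf)/has_ex[[[k v1] sts] /and3P[_ cb pn]] := bl z zl.
by exists v1, sts; split=> //; apply: perm_big.
Qed.

Lemma Phi_K_check (fs : face_code) l vs progs ns : face_list fs = l ->
  code_check l vs false progs ns -> Phi_K_is fs (\prod_(n <- ns) h n).
Proof. exact: Phi_check. Qed.

Lemma Phi_mK_check (fs : face_code) l vs progs ns : face_list fs = l ->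
  code_check l vs true progs ns -> Phi_mK_is fs (\prod_(n <- ns) h n).
Proof. exact: Phi_check. Qed.

(** * Knots settled by computation *)

(** The faces are numbered from 0, the vertices after them. The initial edge is the common edge of
    the two cycles; its ends 3 and 5 are the vertices lying on all faces, hence the two entries of
    [progs]. *)
Lemma Phi_K_6_2 : Phi_K_is K6_2 (\prod_(n <- [:: 3%N; 4%N]) h n).
Proof.
apply: (Phi_K_check (erefl _) (vs := [:: [:: -3; 1; 4]; [:: -2; 3]; [:: -6; -1; 2]; [:: -5; 6]; [:: -4; 5]])
  (progs := [:: (3, 5, [:: Polygon 1 [:: 4] 5; Polygon 2 [:: 6; 7] 5]);
    (5, 3, [:: Polygon 1 [:: 4] 3; Polygon 2 [:: 7; 6] 3])]%N));
  by vm_compute.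
Qed.

(** In the dual, the vertices of degree 2 become bigons. Of the two ends of the common edge, one is
    F* and the other becomes the triangle on the faces 0, 1, 2. *)
Lemma Phi_mK_6_2 : Phi_mK_is K6_2 (\prod_(n <- [:: 3%N]) h n).
Proof.
apply: (Phi_mK_check (erefl _) (vs := [:: [:: -3; 1; 4]; [:: -2; 3]; [:: -6; -1; 2]; [:: -5; 6]; [:: -4; 5]])
  (progs := [:: (3, 2, [:: Bigon 4 0 1; Polygon 5 [:: 1] 2; Bigon 6 0 2; Bigon 7 0 2]);
    (5, 2, [:: Bigon 4 0 1; Polygon 3 [:: 1] 2; Bigon 6 0 2; Bigon 7 0 2])]%N));
  by vm_compute.
Qed.

Lemma Phi_K_6_3 : Phi_K_is K6_3 (\prod_(n <- [:: 3%N; 3%N]) h n).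
Proof.
apply: (Phi_K_check (erefl _) (vs := [:: [:: -3; 1; 4]; [:: -6; -2; 3]; [:: -5; -1; 2; 6]; [:: -4; 5]])
  (progs := [:: (6, 5, [:: Polygon 2 [:: 7] 4; Polygon 1 [:: 4] 5; Bigon 3 5 6])]%N));
  by vm_compute.
Qed.

Lemma Phi_mK_6_3 : Phi_mK_is K6_3 (\prod_(n <- [:: 3%N; 3%N]) h n).
Proof.
apply: (Phi_mK_check (erefl _) (vs := [:: [:: -3; 1; 4]; [:: -6; -2; 3]; [:: -5; -1; 2; 6]; [:: -4; 5]])
  (progs := [:: (6, 2, [:: Polygon 5 [:: 3] 1; Polygon 4 [:: 1] 2; Bigon 7 0 2])]%N));
  by vm_compute.
Qed.

Lemma Phi_K_7_3 : Phi_K_is K7_3 (\prod_(n <- [:: 5%N]) h n).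
Proof.
apply: (Phi_K_check (C_ok (n := 5) (m := 3) isT isT) (vs := [:: [:: -7; -6; -5; 1]; [:: -4; 5; 6; 7]; [:: -3; 4]; [:: -2; 3]; [:: -1; 2]])
  (progs := [:: (4, 5, [:: Polygon 1 [:: 6; 7; 8] 5; Bigon 2 4 5; Bigon 3 4 5]);
    (5, 4, [:: Polygon 1 [:: 8; 7; 6] 4; Bigon 2 4 5; Bigon 3 4 5])]%N));
  by vm_compute.
Qed.

Lemma Phi_mK_7_3 : Phi_mK_is K7_3 (\prod_(n <- [:: 4%N]) h n).
Proof.
apply: (Phi_mK_check (C_ok (n := 5) (m := 3) isT isT) (vs := [:: [:: -7; -6; -5; 1]; [:: -4; 5; 6; 7]; [:: -3; 4]; [:: -2; 3]; [:: -1; 2]])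
  (progs := [:: (4, 1, [:: Polygon 5 [:: 2; 3] 1; Bigon 6 0 1; Bigon 7 0 1; Bigon 8 0 1]);
    (5, 1, [:: Polygon 4 [:: 2; 3] 1; Bigon 6 0 1; Bigon 7 0 1; Bigon 8 0 1])]%N));
  by vm_compute.
Qed.

Lemma Phi_K_7_4 : Phi_K_is K7_4 (\prod_(n <- [:: 4%N; 4%N]) h n).
Proof.
apply: (Phi_K_check (erefl _) (vs := [:: [:: -4; 1; 5]; [:: -3; 4]; [:: -2; 3]; [:: -7; -1; 2]; [:: -6; 7]; [:: -5; 6]])
  (progs := [:: (3, 6, [:: Polygon 1 [:: 5; 4] 6; Polygon 2 [:: 7; 8] 6]);
    (6, 3, [:: Polygon 1 [:: 4; 5] 3; Polygon 2 [:: 8; 7] 3])]%N));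
  by vm_compute.
Qed.

Lemma Phi_mK_7_4 : Phi_mK_is K7_4 (\prod_(n <- [:: 3%N]) h n).
Proof.
apply: (Phi_mK_check (erefl _) (vs := [:: [:: -4; 1; 5]; [:: -3; 4]; [:: -2; 3]; [:: -7; -1; 2]; [:: -6; 7]; [:: -5; 6]])
  (progs := [:: (3, 2, [:: Bigon 4 0 1; Bigon 5 0 1; Polygon 6 [:: 1] 2; Bigon 7 0 2; Bigon 8 0 2]);
    (6, 2, [:: Bigon 4 0 1; Bigon 5 0 1; Polygon 3 [:: 1] 2; Bigon 7 0 2; Bigon 8 0 2])]%N));
  by vm_compute.
Qed.

Lemma Phi_K_7_5 : Phi_K_is K7_5 (\prod_(n <- [:: 3%N; 4%N]) h n).
Proof.
apply: (Phi_K_check (erefl _) (vs := [:: [:: -3; 1; 7; 4]; [:: -2; 3]; [:: -6; -7; -1; 2]; [:: -5; 6]; [:: -4; 5]])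
  (progs := [:: (4, 6, [:: Polygon 1 [:: 5] 6; Bigon 2 6 4; Polygon 3 [:: 7; 8] 6]);
    (6, 4, [:: Polygon 1 [:: 5] 4; Bigon 2 6 4; Polygon 3 [:: 8; 7] 4])]%N));
  by vm_compute.
Qed.

Lemma Phi_mK_7_5 : Phi_mK_is K7_5 (\prod_(n <- [:: 4%N]) h n).
Proof.
apply: (Phi_mK_check (erefl _) (vs := [:: [:: -3; 1; 7; 4]; [:: -2; 3]; [:: -6; -7; -1; 2]; [:: -5; 6]; [:: -4; 5]])
  (progs := [:: (4, 3, [:: Bigon 5 0 1; Polygon 6 [:: 2; 1] 3; Bigon 7 0 3; Bigon 8 0 3]);
    (6, 3, [:: Bigon 5 0 1; Polygon 4 [:: 2; 1] 3; Bigon 7 0 3; Bigon 8 0 3])]%N));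
  by vm_compute.
Qed.

Lemma Phi_K_7_6 : Phi_K_is K7_6 (\prod_(n <- [:: 3%N; 4%N]) h n).
Proof.
apply: (Phi_K_check (erefl _) (vs := [:: [:: -3; 1; 4; 7]; [:: -2; 3]; [:: -6; -1; 2]; [:: -5; 6]; [:: -7; -4; 5]])
  (progs := [:: (4, 8, [:: Polygon 1 [:: 5] 6; Polygon 2 [:: 7; 6] 8; Bigon 3 8 4])]%N));
  by vm_compute.
Qed.

Lemma Phi_mK_7_6 : Phi_mK_is K7_6 (\prod_(n <- [:: 3%N; 3%N]) h n).
Proof.
apply: (Phi_mK_check (erefl _) (vs := [:: [:: -3; 1; 4; 7]; [:: -2; 3]; [:: -6; -1; 2]; [:: -5; 6]; [:: -7; -4; 5]])
  (progs := [:: (4, 2, [:: Bigon 5 0 1; Polygon 6 [:: 1] 2; Bigon 7 0 2; Polygon 8 [:: 3] 2])]%N));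
  by vm_compute.
Qed.

Lemma Phi_K_7_7 : Phi_K_is K7_7 (\prod_(n <- [:: 3%N; 3%N; 3%N]) h n).
Proof.
apply: (Phi_K_check (erefl _) (vs := [:: [:: -5; 7; 6; 1]; [:: -4; 5]; [:: -3; -7; 4]; [:: -2; -6; 3]; [:: -1; 2]])
  (progs := [:: (4, 6, [:: Polygon 1 [:: 8] 7; Polygon 2 [:: 7] 6; Polygon 3 [:: 5] 6])]%N));
  by vm_compute.
Qed.

Lemma Phi_mK_7_7 : Phi_mK_is K7_7 (\prod_(n <- [:: 3%N; 3%N]) h n).
Proof.
apply: (Phi_mK_check (erefl _) (vs := [:: [:: -5; 7; 6; 1]; [:: -4; 5]; [:: -3; -7; 4]; [:: -2; -6; 3]; [:: -1; 2]])
  (progs := [:: (4, 1, [:: Bigon 5 0 3; Polygon 6 [:: 3] 2; Polygon 7 [:: 2] 1; Bigon 8 0 1])]%N));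
  by vm_compute.
Qed.

Lemma Phi_K_8_2 : Phi_K_is K8_2 (\prod_(n <- [:: 3%N; 6%N]) h n).
Proof.
apply: (Phi_K_check (erefl _) (vs := [:: [:: -3; 1; 4]; [:: -2; 3]; [:: -8; -1; 2]; [:: -7; 8]; [:: -6; 7]; [:: -5; 6]; [:: -4; 5]])
  (progs := [:: (3, 5, [:: Polygon 1 [:: 4] 5; Polygon 2 [:: 6; 7; 8; 9] 5]);
    (5, 3, [:: Polygon 1 [:: 4] 3; Polygon 2 [:: 9; 8; 7; 6] 3])]%N));
  by vm_compute.
Qed.

Lemma Phi_mK_8_2 : Phi_mK_is K8_2 (\prod_(n <- [:: 3%N]) h n).
Proof.
apply: (Phi_mK_check (erefl _) (vs := [:: [:: -3; 1; 4]; [:: -2; 3]; [:: -8; -1; 2]; [:: -7; 8]; [:: -6; 7]; [:: -5; 6]; [:: -4; 5]])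
  (progs := [:: (3, 2, [:: Bigon 4 0 1; Polygon 5 [:: 1] 2; Bigon 6 0 2; Bigon 7 0 2; Bigon 8 0 2; Bigon 9 0 2]);
    (5, 2, [:: Bigon 4 0 1; Polygon 3 [:: 1] 2; Bigon 6 0 2; Bigon 7 0 2; Bigon 8 0 2; Bigon 9 0 2])]%N));
  by vm_compute.
Qed.

Lemma Phi_K_8_3 : Phi_K_is K8_3 (\prod_(n <- [:: 5%N]) h n).
Proof.
apply: (Phi_K_check (C_ok (n := 5) (m := 4) isT isT) (vs := [:: [:: -8; -7; -6; -5; 1]; [:: -4; 5; 6; 7; 8]; [:: -3; 4]; [:: -2; 3]; [:: -1; 2]])
  (progs := [:: (5, 6, [:: Polygon 1 [:: 7; 8; 9] 6; Bigon 2 5 6; Bigon 3 5 6; Bigon 4 5 6]);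
    (6, 5, [:: Polygon 1 [:: 9; 8; 7] 5; Bigon 2 5 6; Bigon 3 5 6; Bigon 4 5 6])]%N));
  by vm_compute.
Qed.

Lemma Phi_mK_8_3 : Phi_mK_is K8_3 (\prod_(n <- [:: 5%N]) h n).
Proof.
apply: (Phi_mK_check (C_ok (n := 5) (m := 4) isT isT) (vs := [:: [:: -8; -7; -6; -5; 1]; [:: -4; 5; 6; 7; 8]; [:: -3; 4]; [:: -2; 3]; [:: -1; 2]])
  (progs := [:: (5, 1, [:: Polygon 6 [:: 2; 3; 4] 1; Bigon 7 0 1; Bigon 8 0 1; Bigon 9 0 1]);
    (6, 1, [:: Polygon 5 [:: 2; 3; 4] 1; Bigon 7 0 1; Bigon 8 0 1; Bigon 9 0 1])]%N));
  by vm_compute.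
Qed.

Lemma Phi_K_8_4 : Phi_K_is K8_4 (\prod_(n <- [:: 3%N]) h n).
Proof.
apply: (Phi_K_check (erefl _) (vs := [:: [:: -8; -7; -6; 1; 2; 3; 4]; [:: -5; 6; 7; 8]; [:: -4; -3; -2; -1; 5]])
  (progs := [:: (7, 8, [:: Bigon 2 9 7; Bigon 3 9 7; Bigon 4 9 7; Polygon 1 [:: 9] 8; Bigon 5 7 8; Bigon 6 7 8])]%N));
  by vm_compute.
Qed.

(** The three vertices have degrees 7, 4 and 5. The first is F*; the others become a quadrangle and
    a pentagon of the dual, glued along the edge between the faces 0 and 1. *)
Lemma Phi_mK_8_4 : Phi_mK_is K8_4 (\prod_(n <- [:: 4%N; 5%N]) h n).
Proof.
apply: (Phi_mK_check (erefl _) (vs := [:: [:: -8; -7; -6; 1; 2; 3; 4]; [:: -5; 6; 7; 8]; [:: -4; -3; -2; -1; 5]])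
  (progs := [:: (7, 1, [:: Polygon 8 [:: 5; 6] 1; Polygon 9 [:: 2; 3; 4] 1])]%N));
  by vm_compute.
Qed.

(** The dual is a triangle with edges of multiplicities 3, 3 and 2. The two vertices of degree 3 are
    F* and the triangle; the five inner vertices of the paths are bigons. *)
Lemma Phi_mK_8_5 : Phi_mK_is K8_5 (\prod_(n <- [:: 3%N]) h n).
Proof.
apply: (Phi_mK_check (erefl _) (vs := [:: [:: 7; 4; 1]; [:: 8; -7]; [:: -3; -6; -8]; [:: -2; 3]; [:: -1; 2]; [:: -5; 6]; [:: -4; 5]])
  (progs := [:: (3, 1, [:: Bigon 4 0 2; Bigon 6 0 1; Bigon 7 0 1; Bigon 8 1 2; Bigon 9 1 2; Polygon 5 [:: 2] 1]);
    (5, 1, [:: Bigon 4 0 2; Bigon 6 0 1; Bigon 7 0 1; Bigon 8 1 2; Bigon 9 1 2; Polygon 3 [:: 2] 1])]%N));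
  by vm_compute.
Qed.

Lemma Phi_mK_8_5_alt : Phi_mK_is K8_5_alt (\prod_(n <- [:: 3%N]) h n).
Proof.
apply: (Phi_mK_check (erefl _) (vs := [:: [:: 4; 7; 1]; [:: 5; -4]; [:: 6; -5]; [:: -3; -8; -6]; [:: -2; 3]; [:: -1; 2]; [:: -7; 8]])
  (progs := [:: (3, 1, [:: Bigon 4 0 2; Bigon 5 0 2; Bigon 7 0 1; Bigon 8 0 1; Bigon 9 1 2; Polygon 6 [:: 2] 1]);
    (6, 1, [:: Bigon 4 0 2; Bigon 5 0 2; Bigon 7 0 1; Bigon 8 0 1; Bigon 9 1 2; Polygon 3 [:: 2] 1])]%N));
  by vm_compute.
Qed.

(** * Cycles with at most one doubled edge *)

Lemma next_at (U : eqType) (x0 : U) s i : uniq s -> (i < size s)%N ->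
  next s (nth x0 s i) = nth x0 s (if i.+1 == size s then 0 else i.+1).
Proof.
move=> us isz; rewrite next_nth mem_nth// index_uniq//.
case: s us isz => [//|y s] us isz /=.
case: eqP => [[e]|ne]; first by rewrite nth_default ?e.
by apply: set_nth_default; move: isz ne; rewrite /= !ltnS; lia.
Qed.

Lemma size_up i n : size (Defs.up i n) = n. Proof. by rewrite size_map size_iota. Qed.
Lemma size_down i n : size (Defs.down i n) = n. Proof. by rewrite size_map size_rev size_iota. Qed.

Lemma nth_up i n j : (j < n)%N -> nth 0 (Defs.up i n) j = (i + j)%N%:Z.
Proof. by move=> jn; rewrite (nth_map 0%N) ?size_iota// nth_iota. Qed.

Lemma nth_down i n j : (j < n)%N -> nth 0 (Defs.down i n) j = - (i + (n - j.+1))%N%:Z.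
Proof.
move=> jn; rewrite (nth_map 0%N) ?size_rev ?size_iota// nth_rev ?size_iota//.
by rewrite nth_iota//; lia.
Qed.

Lemma mem_up i n z : (z \in Defs.up i n) = (i%:Z <= z < (i + n)%N%:Z).
Proof.
apply/mapP/idP => [[k]|]; first by rewrite mem_iota => kn ->; lia.
by case: z => [k|k] kn; [exists k; rewrite // mem_iota; lia|lia].
Qed.

Lemma mem_down i n z : (z \in Defs.down i n) = (i%:Z <= - z < (i + n)%N%:Z).
Proof.
rewrite -mem_up; apply/mapP/mapP => -[k]; rewrite ?mem_rev => ki e; exists k; rewrite ?mem_rev//.
  by rewrite e opprK.
by rewrite -e opprK.
Qed.

Lemma flatten_uniq_mem (U : eqType) (l : seq (seq U)) c c' x :
  uniq (flatten l) -> c \in l -> c' \in l -> x \in c -> x \in c' -> c = c'.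
Proof.
elim: l => //= a l IHl; rewrite cat_uniq => /and3P[_ /hasPn al ul] + + xc xc'.
have alF e : e \in l -> x \in e -> x \in a -> False.
  move=> el xe xa; have /negP := al x (introT flattenP (ex_intro2 _ _ e el xe)).
  by apply.
rewrite !inE => /predU1P[ca|cl] /predU1P[ca'|cl'].
- by rewrite ca ca'.
- by case: (alF _ cl' xc'); rewrite -ca.
- by case: (alF _ cl xc); rewrite -ca'.
- exact: IHl.
Qed.

Lemma flatten_uniq_in (U : eqType) (l : seq (seq U)) c :
  uniq (flatten l) -> c \in l -> uniq c.
Proof.
elim: l => //= a l IHl; rewrite cat_uniq => /and3P[ua _ ul].
by rewrite inE => /predU1P[->//|]; apply: IHl.
Qed.

Lemma nextf_in l c x : uniq (flatten l) -> c \in l -> x \in c -> nextf l x = next c x.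
Proof.
move=> ul cl xc; rewrite /nextf; congr (next _ x).
have hx : has (fun c => x \in c) l by apply/hasP; exists c.
apply: flatten_uniq_mem ul _ cl _ xc; first by rewrite mem_nth// -has_find.
exact: (nth_find [::] hx).
Qed.

(** If the label is the position in [cs] up to a shift, it separates the cycles by itself, and the
    double comparison of darts becomes unnecessary. *)
Lemma orbit_labels_intro P cs s g off :
  (forall c, c \in cs -> fcycle P c) ->
  (forall z, z \in s -> exists2 c, c \in cs & z \in c) ->
  (forall i z, (i < size cs)%N -> z \in nth [::] cs i -> g z = (i + off)%N) ->
  orbit_labels P cs s g.
Proof.
move=> cP sc gE; apply/and3P; split; first by apply/allP.
  by apply/allP => z /sc[c cc zc]; apply/hasP; exists c.
apply/allP => c /(nthP [::])[i isz <-]; apply/allP => z zc.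
apply/allP => c' /(nthP [::])[j jsz <-]; apply/allP => w wc'.
rewrite (gE i)// (gE j)// eqn_add2r; apply/eqP; apply/eqP/eqP => [-> //|e].
by have := gE j z jsz; rewrite -e => /(_ zc); rewrite (gE i)// => /addIn.
Qed.

Lemma face_orbit_labels l g : uniq (flatten l) ->
  (forall i z, (i < size l)%N -> z \in nth [::] l i -> g z = i) ->
  orbit_labels (nextf l) l (flatten l) g.
Proof.
move=> ul gE; apply: (orbit_labels_intro (off := 0)) => [c cl|z /flattenP[c]|i z isz zi].
- have := cycle_next (flatten_uniq_in ul cl); apply: sub_in_cycle (allss _) => x y xc _.
  by rewrite /= (nextf_in ul cl xc).
- by exists c.
- by rewrite addn0; apply: gE.
Qed.

Lemma zip_rot1 (U : eqType) (s : seq U) : uniq s ->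
  zip s (rot 1 s) = [seq (x, next s x) | x <- s].
Proof.
case: s => [//|x0 s] us; apply: (@eq_from_nth _ (x0, x0)).
  by rewrite size_zip size_rot size_map minnn.
move=> i; rewrite size_zip size_rot minnn => isz.
rewrite nth_zip ?size_rot// (nth_map x0)// next_at//; congr (_, _).
rewrite rot1_cons nth_rcons /= eqSS.
by move: isz; rewrite /= ltnS; case: (ltngtP i (size s)).
Qed.

Lemma mem_oppr (z : int) s : (z \in map -%R s) = (- z \in s).
Proof. by rewrite -{1}[z]opprK mem_map//; apply: oppr_inj. Qed.

Lemma map_constant (U W : eqType) (f : U -> W) s x :
  (forall z, z \in s -> f z = x) -> map f s = nseq (size s) x.
Proof.
move=> fx; rewrite -[size s](size_map f); apply/all_pred1P/allP => _ /mapP[z zs ->].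
by rewrite /= fx.
Qed.

Lemma code_build_K (laz lbz : int -> nat) l z f0 v1 sts :
  laz (head 0 (head [::] l)) = f0 -> build_ok f0 (lbz z) v1 sts ->
  perm_eq (corners (build f0 (lbz z) v1 sts)) [seq (laz z, lbz z) | z <- flatten l] ->
  perm_eq (bonds (build f0 (lbz z) v1 sts) ++ [seq (v.2, v.1) | v <- bonds (build f0 (lbz z) v1 sts)])
    [seq (lbz z, lbz (- z)) | z <- flatten l] ->
  code_build laz lbz false l z v1 sts.
Proof. by move=> <- ok cs bs; apply/and3P; split. Qed.

Lemma code_build_mK (laz lbz : int -> nat) l z v0 v1 sts :
  laz (head 0 (head [::] l)) = v0 -> build_ok (lbz z) v0 v1 sts ->
  perm_eq (corners (build (lbz z) v0 v1 sts)) [seq (lbz z, laz z) | z <- flatten l] ->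
  perm_eq (bonds (build (lbz z) v0 v1 sts) ++ [seq (v.2, v.1) | v <- bonds (build (lbz z) v0 v1 sts)])
    [seq (laz z, laz (- z)) | z <- flatten l] ->
  code_build laz lbz true l z v1 sts.
Proof. by move=> <- ok cs bs; apply/and3P; split. Qed.

Lemma build_bigons (L : choiceType) (f0 v0 v1 u v : L) ks sts :
  let S := build f0 v0 v1 sts in
  let B := build f0 v0 v1 ([seq Bigon k u v | k <- ks] ++ sts) in
  [/\ corners B = flatten [seq [:: (k, u); (k, v)] | k <- ks] ++ corners S,
      bonds B = nseq (size ks) (u, v) ++ bonds S, newlab B = ks ++ newlab S,
      blab B = blab S &
      poly_sizes ([seq Bigon k u v | k <- ks] ++ sts) = poly_sizes sts].
Proof.
by elim: ks => [//|k ks [c b nl bl ps]] /=; split; rewrite /= ?c ?b ?nl ?bl.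
Qed.

Lemma build_bigons_ok (L : choiceType) (f0 v0 v1 u v : L) ks sts :
  let S := build f0 v0 v1 sts in
  build_ok f0 v0 v1 sts -> u \in blab S -> v \in blab S ->
  uniq (ks ++ labels f0 v0 S) ->
  build_ok f0 v0 v1 ([seq Bigon k u v | k <- ks] ++ sts).
Proof.
move=> S ok uS vS; elim: ks => [//|k ks IHks] /andP[kks uks].
apply/andP; split; first exact: IHks.
have [_ _ nl bl _] := build_bigons f0 v0 v1 u v ks sts.
apply/and3P; split; [by rewrite bl|by rewrite bl|].
apply: contra kks; rewrite /labels nl !(inE, mem_cat).
by do !case: (_ == _); rewrite ?orbT.
Qed.

Lemma perm_flatten_pairs (U W : eqType) (u v : W) (ks : seq U) :
  perm_eq (flatten [seq [:: (k, u); (k, v)] | k <- ks])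
    ([seq (k, u) | k <- ks] ++ [seq (k, v) | k <- ks]).
Proof.
elim: ks => //= k ks IHks; rewrite perm_cons perm_sym.
by rewrite -cat1s perm_catCA perm_cons perm_sym.
Qed.

Section Cycles.
Variable n : nat.
Hypothesis n1 : (1 < n)%N.

(** The faces are numbered 0 (outer), 1 (inner), 2 (bigon), and the origin of the
    dart k, for 1 <= k <= n, is numbered k + 2. *)
Definition cyc_vert (z : int) : nat :=
  (match z with Posz k => minn k n | Negz k => if k.+1 < n then k.+2 else 1 end + 2)%N.

Lemma next_up k : (0 < k <= n)%N -> next (Defs.up 1 n) k%:Z = if (k < n)%N then k.+1 else 1%N.
Proof.
move=> kn; have u : uniq (Defs.up 1 n) by rewrite map_inj_uniq ?iota_uniq// => a b [].
have -> : k%:Z = nth 0 (Defs.up 1 n) k.-1 by rewrite nth_up; [congr Posz|]; lia.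
rewrite next_at ?size_up//; last by lia.
rewrite prednK; last by lia.
case: eqP => kE; rewrite nth_up; [|lia|..]; first by rewrite kE ltnn.
  by rewrite ifT; [congr Posz|]; lia.
lia.
Qed.

(** [N] is the edge seen from outside between the vertices n and 1: it is n for the simple cycle and
    n + 1 when the edge n is doubled. *)
Definition outer_face N := - N%:Z :: Defs.down 1 n.-1.

Lemma next_outer N k : (n <= N)%N -> (0 < k)%N -> (k < n)%N || (k == N) ->
  next (outer_face N) (- k%:Z) =
  if k == N then - n.-1%:Z else if k == 1%N then - N%:Z else - k.-1%:Z.
Proof.
move=> nN k0 kN.
have u : uniq (outer_face N).
  rewrite /= mem_down opprK; apply/andP; split; first by apply/negP; lia.
  by rewrite map_inj_uniq ?rev_uniq ?iota_uniq// => a b /oppr_inj[].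
have sz : size (outer_face N) = n by rewrite /= size_down; lia.
have nthS j : (j < n.-1)%N -> nth 0 (outer_face N) j.+1 = - (n.-1 - j)%N%:Z.
  by move=> jn; rewrite /= nth_down//; congr (- _%:Z); lia.
have nth0 : nth 0 (outer_face N) 0 = - N%:Z by [].
have [->|kneN] := eqVneq k N.
  rewrite -nth0 next_at ?sz//; last by lia.
  by rewrite ifF; [rewrite nthS; [congr (- _%:Z)|]|apply/eqP]; lia.
have -> : - k%:Z = nth 0 (outer_face N) (n.-1 - k).+1.
  by rewrite nthS; [congr (- _%:Z)|]; lia.
rewrite next_at ?sz//; last by lia.
have [->|k1] := eqVneq k 1%N; first by rewrite ifT ?nth0//; apply/eqP; lia.
rewrite ifF; last by apply/eqP; lia.
by rewrite nthS; [congr (- _%:Z)|]; lia.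
Qed.

(** Doubling moves the dart -n from the outer face to the bigon, whose other dart is n + 1; the dart
    -(n + 1) is then on the outer face. *)
Definition cyc_face (m : nat) (z : int) : nat :=
  match z with
  | Posz k => if (k <= n)%N then 1 else 2
  | Negz k => if (m == 2) && (k.+1 == n) then 2 else 0
  end.

Notation V := (iota 3 n).

Lemma C1E : C_faces n 1 = [:: outer_face n; Defs.up 1 n].
Proof. by rewrite /C_faces addn0. Qed.

Lemma C2E : C_faces n 2 = [:: outer_face n.+1; Defs.up 1 n; [:: - n%:Z; n.+1%:Z]].
Proof. by rewrite /C_faces addn1. Qed.

Lemma C_uniq m : (0 < m)%N -> uniq (flatten (C_faces n m)).
Proof.
by move=> m0; rewrite -C_ok ?(ltnW n1)//; case/and4P: (face_listP (C_ n m)).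
Qed.

Lemma mem_outer N z : (n <= N)%N ->
  (z \in outer_face N) = (z < 0) && ((- z == N%:Z) || (- z < n%:Z)).
Proof. by move=> nN; rewrite inE mem_down; apply/idP/idP; lia. Qed.

Lemma cyc_vert_up (k : nat) : (0 < k <= n)%N -> cyc_vert k = k.+2.
Proof. by rewrite /cyc_vert /minn /=; case: (ltnP k n); lia. Qed.

Lemma cyc_vert_down (k : nat) : (0 < k)%N ->
  cyc_vert (- k%:Z) = if (k < n)%N then k.+3 else 3%N.
Proof. by case: k => // k _; rewrite -NegzE /cyc_vert; case: (_ < n)%N; rewrite addn2. Qed.

Lemma perm_vert_outer N : (n <= N)%N -> perm_eq (map cyc_vert (outer_face N)) V.
Proof.
move=> nN; have -> : V = 3%N :: iota 4 n.-1 by rewrite -[n in LHS](ltn_predK n1).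
have -> : map cyc_vert (outer_face N) = 3%N :: rev (iota 4 n.-1); last first.
  by rewrite perm_cons perm_rev.
rewrite /= cyc_vert_down; last by lia.
rewrite ifF; last by lia.
congr (_ :: _); rewrite /Defs.down -map_comp map_rev (iotaDl 3 1); congr rev.
apply/eq_in_map => k; rewrite mem_iota => kn /=.
by rewrite cyc_vert_down ?ifT; lia.
Qed.

Lemma vert_up : map cyc_vert (Defs.up 1 n) = V.
Proof.
rewrite /Defs.up -map_comp (iotaDl 2 1); apply/eq_in_map => k; rewrite mem_iota => kn /=.
by rewrite cyc_vert_up; lia.
Qed.

Lemma next_V k : (0 < k <= n)%N -> next V k.+2 = cyc_vert (- k%:Z).
Proof.
move=> kn; have -> : k.+2 = nth 0%N V k.-1 by rewrite nth_iota; lia.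
rewrite next_at ?iota_uniq ?size_iota//; last by lia.
rewrite cyc_vert_down; last by lia.
rewrite prednK; last by lia.
case: eqP => kE; first by rewrite kE ltnn nth_iota; lia.
have kn' : (k < n)%N by lia.
by rewrite kn' nth_iota.
Qed.

Lemma bonds_up : [seq (cyc_vert z, cyc_vert (- z)) | z <- Defs.up 1 n] =
  [seq (x, next V x) | x <- V].
Proof.
rewrite -{2}vert_up -!map_comp; apply/eq_in_map => k; rewrite mem_iota => kn /=.
by rewrite cyc_vert_up ?next_V//; lia.
Qed.

Lemma cycle_bonds (v0 v : nat) ws : uniq (v0 :: v :: ws) ->
  perm_eq ((v0, v) :: zip (v :: ws) (rcons ws v0))
    [seq (x, next (v0 :: v :: ws) x) | x <- v0 :: v :: ws].
Proof. by move=> u; rewrite -zip_rot1// rot1_cons. Qed.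

(** Any vertex of the cycle serves as base vertex: the list of vertices is rotated to start there,
    and the next vertex [v] is the second end of the initial edge. *)
Lemma rot_V v0 : v0 \in V -> exists v ws,
  [/\ perm_eq (v0 :: v :: ws) V, uniq (v0 :: v :: ws) &
    perm_eq ((v0, v) :: zip (v :: ws) (rcons ws v0)) [seq (x, next V x) | x <- V]].
Proof.
move=> /rot_to[i s sE]; have uV : uniq V := iota_uniq _ _.
have sz : size (v0 :: s) = n by rewrite -sE size_rot size_iota.
case: s sE sz => [|v ws] sE sz; first by rewrite /= in sz; lia.
have u : uniq (v0 :: v :: ws) by rewrite -sE rot_uniq.
have pV : perm_eq (v0 :: v :: ws) V by rewrite -sE perm_rot.
exists v, ws; split=> //; apply: perm_trans (cycle_bonds u) _.
rewrite -sE (eq_map (g := fun x => (x, next V x))); last by move=> x; rewrite next_rot.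
by apply: perm_map; rewrite perm_rot.
Qed.

Lemma perm_flatten m : (0 < m)%N -> perm_eq (flatten (C_faces n m))
  (Defs.up 1 (n + m.-1) ++ map -%R (Defs.up 1 (n + m.-1))).
Proof.
move=> m0; apply: uniq_perm; first exact: C_uniq.
  have uu : uniq (Defs.up 1 (n + m.-1)) by rewrite map_inj_uniq ?iota_uniq// => a b [].
  rewrite cat_uniq (map_inj_uniq oppr_inj) uu andbT /=.
  apply/hasPn => z /mapP[y yu ->]; rewrite mem_up in yu; rewrite /= mem_up; lia.
move=> z; rewrite [RHS]mem_cat [X in _ = X || _]mem_up.
rewrite mem_oppr [X in _ = _ || X]mem_up /C_faces /= inE !mem_cat mem_up mem_down.
have -> : (z \in flatten [seq [:: - k%:Z; k.+1%:Z] | k <- iota n m.-1]) =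
    (n%:Z <= - z < (n + m.-1)%N%:Z) || (n%:Z < z <= (n + m.-1)%N%:Z).
  apply/flatten_mapP/orP => [[k]|].
    by rewrite mem_iota !inE => kn /orP[]/eqP->; [left|right]; lia.
  case=> zn; [exists `|z|%N|exists `|z|.-1]; rewrite ?mem_iota ?inE; lia.
by apply/idP/idP; lia.
Qed.

(** Clockwise around each vertex. Doubling the edge n inserts n + 1 at its origin and -(n + 1) at
    its end. *)
Definition cyc_vertices (m : nat) : seq (seq int) :=
  (if m == 2 then [:: 1; - n.+1%:Z; - n%:Z] else [:: 1; - n%:Z]) ::
  [seq if (m == 2) && (k.+1 == n) then [:: k.+1%:Z; n.+1%:Z; - k%:Z]
       else [:: k.+1%:Z; - k%:Z] | k <- iota 1 n.-1].

Lemma nextf_up m k : (0 < m)%N -> (0 < k <= n)%N ->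
  nextf (C_faces n m) k%:Z = if (k < n)%N then k.+1 else 1%N.
Proof.
move=> m0 kn; rewrite -next_up//; apply: nextf_in; first exact: C_uniq.
  by rewrite !inE eqxx orbT.
by rewrite mem_up; lia.
Qed.

Lemma nextf_outer m k : (0 < m)%N -> (0 < k)%N -> (k < n)%N || (k == n + m.-1)%N ->
  nextf (C_faces n m) (- k%:Z) = if (k == n + m.-1)%N then - n.-1%:Z
    else if k == 1%N then - (n + m.-1)%N%:Z else - k.-1%:Z.
Proof.
move=> m0 k0 kn; rewrite -next_outer ?leq_addr//; apply: nextf_in; first exact: C_uniq.
  by rewrite inE eqxx.
by rewrite mem_outer ?leq_addr//; lia.
Qed.

Lemma nextf_bigon : nextf (C_faces n 2) (- n%:Z) = n.+1 /\
  nextf (C_faces n 2) n.+1%:Z = - n%:Z.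
Proof.
have u : uniq (flatten (C_faces n 2)) by apply: C_uniq.
have c : [:: - n%:Z; n.+1%:Z] \in C_faces n 2 by rewrite C2E !inE eqxx !orbT.
split; rewrite (nextf_in u c) ?inE ?eqxx ?orbT //=; first by rewrite eqxx.
by rewrite eqxx; case: eqP.
Qed.

Lemma mem_C1 z : (z \in flatten (C_faces n 1)) = (0 < `|z| <= n)%N.
Proof.
rewrite (perm_mem (@perm_flatten 1 isT)) mem_cat mem_oppr addn0 !mem_up; lia.
Qed.

Lemma mem_C2 z : (z \in flatten (C_faces n 2)) = (0 < `|z| <= n.+1)%N.
Proof.
rewrite (perm_mem (@perm_flatten 2 isT)) mem_cat mem_oppr addn1 !mem_up; lia.
Qed.

Lemma cyc_face_down m (k : nat) : (0 < k)%N ->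
  cyc_face m (- k%:Z) = if (m == 2) && (k == n) then 2 else 0%N.
Proof. by case: k => // k _; rewrite -NegzE. Qed.

Lemma cyc_face_le m z : (cyc_face m z <= 2)%N.
Proof. by case: z => k /=; case: ifP. Qed.

Lemma cyc_vert_gt z : z != 0 -> (2 < cyc_vert z)%N.
Proof.
by case: z => [[//|k]|k] _; rewrite /cyc_vert /minn; case: (_ < n)%N; lia.
Qed.

Lemma C1_labels : code_labels (cyc_vertices 1) (cyc_face 1) cyc_vert (C_faces n 1).
Proof.
apply/and4P; split.
- apply: face_orbit_labels; first exact: C_uniq.
  rewrite C1E => -[|[|//]] z _ /=; first by rewrite mem_outer//; case: z.
  by rewrite mem_up; case: z => [k|k] kn /=; [rewrite ifT//; lia|lia].
(* The number 2 stays reserved for a bigon even when there is none, so that both kinds of cycles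
   share the vertex numbers. *)
- apply: (orbit_labels_intro (off := 3)).
  + move=> c; rewrite inE => /predU1P[->|/mapP[k + ->]] /=.
      have -> : nextf (C_faces n 1) (- 1) = - n%:Z.
        by rewrite (@nextf_outer 1 1)// addn0 ?n1// ifF//; lia.
      by rewrite opprK nextf_up ?(ltnW n1) ?leqnn// ltnn !eqxx.
    rewrite mem_iota => kn; rewrite andbT opprK nextf_up//; last by lia.
    rewrite nextf_outer//; last by lia.
    have kn' : (k < n)%N by lia.
    rewrite addn0 kn' eqxx andbT; case: (eqVneq k.+1 n) => [ke|_].
      by apply/eqP; congr (- _%:Z); lia.
    by rewrite ifF //; lia.
  + move=> z; rewrite mem_C1; case: z => k kn; rewrite ?NegzE in kn *.
      have [->|k1] := eqVneq k 1%N; first by exists [:: 1; - n%:Z]; rewrite inE eqxx.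
      exists [:: k%:Z; - k.-1%:Z]; rewrite ?inE ?eqxx//; apply/orP; right; apply/mapP.
      by exists k.-1; rewrite ?mem_iota ?prednK//; lia.
    have [->|k1] := eqVneq k.+1 n; first by exists [:: 1; - n%:Z]; rewrite !inE eqxx ?orbT.
    exists [:: k.+2%:Z; - k.+1%:Z]; rewrite ?inE ?eqxx ?orbT//; apply/orP; right; apply/mapP.
    by exists k.+1; rewrite ?mem_iota//; lia.
  + move=> [|i] z; rewrite /= ?size_map ?size_iota => isz.
      rewrite !inE => /orP[]/eqP->; first by rewrite cyc_vert_up//; lia.
      by rewrite cyc_vert_down ?ltnn//; lia.
    rewrite (nth_map 0%N) ?size_iota; last by lia.
    rewrite nth_iota; last by lia.
    rewrite /= !inE => /orP[]/eqP->; first by rewrite cyc_vert_up; lia.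
    by rewrite cyc_vert_down ?ifT; lia.
- apply/allP => z _; apply/allP => w; rewrite mem_C1 => /andP[w0 _].
  by rewrite neq_ltn (leq_ltn_trans (cyc_face_le 1 z)) // cyc_vert_gt; lia.
- apply/allP => z; rewrite mem_C1; case: z => [k|k] kn.
    case: k kn => [//|k] kn; rewrite -NegzE; apply/andP; split.
      by rewrite /cyc_face /=; case: ifP.
    by rewrite cyc_vert_up// /cyc_vert; case: ifP; lia.
  rewrite NegzE opprK; apply/andP; split; first by rewrite /cyc_face /=; case: ifP.
  by rewrite cyc_vert_up// -NegzE /cyc_vert; case: ifP; lia.
Qed.

Lemma cyc_vert_last : cyc_vert n.+1 = n.+2.
Proof. by rewrite /cyc_vert /minn; case: (ltnP n.+1 n); lia. Qed.

Lemma C2_labels : code_labels (cyc_vertices 2) (cyc_face 2) cyc_vert (C_faces n 2).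
Proof.
have [nb1 nb2] := nextf_bigon.
have nN : (n.+1 == n) = false by apply/eqP; lia.
have nn : (n == n.+1) = false by apply/eqP; lia.
apply/and4P; split.
- apply: face_orbit_labels; first exact: C_uniq.
  rewrite C2E => -[|[|[|//]]] z _ /=.
  + by rewrite mem_outer//; case: z => // k kn /=; rewrite ifF//; lia.
  + by rewrite mem_up; case: z => [k|k] kn /=; [rewrite ifT//; lia|lia].
  + rewrite !inE => /orP[]/eqP->; last by rewrite /cyc_face ltnn.
    by rewrite cyc_face_down ?eqxx //; lia.
- apply: (orbit_labels_intro (off := 3)).
  + move=> c; rewrite inE => /predU1P[->|/mapP[k + ->]] /=.
      have -> : nextf (C_faces n 2) (- 1) = - n.+1%:Z.
        by rewrite (@nextf_outer 2 1)// addn1 ?n1// ifF//; lia.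
      rewrite !opprK nb2 nextf_up ?(ltnW n1) ?leqnn// ltnn !eqxx //.
    rewrite mem_iota => kn; have kn' : (k < n)%N by lia.
    case: (eqVneq k.+1 n) => [ke|kne] /=.
      have -> : nextf (C_faces n 2) (- n.+1%:Z) = - k%:Z.
        by rewrite (@nextf_outer 2 n.+1)// addn1 ?eqxx ?orbT// -ke.
      by rewrite ke nb1 opprK nextf_up ?kn' ?ke ?eqxx//; lia.
    rewrite opprK nextf_up//; last by lia.
    rewrite nextf_outer//; last by lia.
    by rewrite addn1 kn' !eqxx andbT !ifF //; lia.
  + move=> z; rewrite mem_C2; case: z => k kn; rewrite ?NegzE in kn *.
      have [->|k1] := eqVneq k 1%N; first by exists [:: 1; - n.+1%:Z; - n%:Z]; rewrite inE eqxx.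
      have [->|kN] := eqVneq k n.+1.
        exists [:: n%:Z; n.+1%:Z; - n.-1%:Z]; rewrite ?inE ?eqxx ?orbT//.
        apply/orP; right; apply/mapP.
        by exists n.-1; rewrite ?mem_iota ?prednK ?eqxx//; lia.
      exists (if k == n then [:: k%:Z; n.+1%:Z; - k.-1%:Z] else [:: k%:Z; - k.-1%:Z]);
        last by case: ifP; rewrite inE eqxx.
      apply/orP; right; apply/mapP.
      by exists k.-1; rewrite ?mem_iota ?prednK//; lia.
    have [->|k1] := eqVneq k.+1 n; first by exists [:: 1; - n.+1%:Z; - n%:Z]; rewrite !inE eqxx ?orbT.
    have [->|k2] := eqVneq k n; first by exists [:: 1; - n.+1%:Z; - n%:Z]; rewrite !inE eqxx ?orbT.
    exists (if k.+2 == n then [:: k.+2%:Z; n.+1%:Z; - k.+1%:Z] else [:: k.+2%:Z; - k.+1%:Z]);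
      last by case: ifP; rewrite !inE eqxx ?orbT.
    apply/orP; right; apply/mapP.
    by exists k.+1; rewrite ?mem_iota//; lia.
  + move=> [|i] z; rewrite /= ?size_map ?size_iota => isz.
      rewrite !inE => /or3P[]/eqP->; first by rewrite cyc_vert_up//; lia.
        by rewrite cyc_vert_down ?ifF//; lia.
      by rewrite cyc_vert_down ?ltnn//; lia.
    rewrite (nth_map 0%N) ?size_iota; last by lia.
    rewrite nth_iota; last by lia.
    case: ifP => [/eqP ie|ie]; rewrite !inE; last first.
      move=> /orP[]/eqP->; first by rewrite cyc_vert_up; lia.
      by rewrite cyc_vert_down ?ifT; lia.
    move=> /or3P[]/eqP->; first by rewrite cyc_vert_up; lia.
      by rewrite cyc_vert_last; lia.
    by rewrite cyc_vert_down ?ifT; lia.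
- apply/allP => z _; apply/allP => w; rewrite mem_C2 => /andP[w0 _].
  by rewrite neq_ltn (leq_ltn_trans (cyc_face_le 2 z)) // cyc_vert_gt; lia.
- have key k : (0 < k <= n.+1)%N -> (cyc_face 2 k != cyc_face 2 (- k%:Z)) &&
      (cyc_vert k != cyc_vert (- k%:Z)).
    case: k => // k kn; rewrite cyc_vert_down// cyc_face_down// eqxx /=.
    have [ke|kN] := eqVneq k n.
      have nl : (n.+1 < n)%N = false by lia.
      by rewrite ke cyc_vert_last /cyc_face ltnn nN nl; lia.
    rewrite cyc_vert_up; last by lia.
    have kl : (k.+1 <= n)%N by lia.
    by rewrite /cyc_face kl; case: (eqVneq k.+1 n); case: (ltnP k.+1 n); lia.
  apply/allP => z; rewrite mem_C2; case: z => [k|k] kn; first exact: key.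
  rewrite NegzE opprK eq_sym [cyc_vert _ == _]eq_sym.
  exact: key.
Qed.

(** * Gluing sequences for the cycles and their duals *)

Notation swap B := [seq (c.2, c.1) | c <- B].

Lemma perm_swap (B B' : seq (nat * nat)) : perm_eq B B' ->
  perm_eq (B ++ swap B) (B' ++ swap B').
Proof. by move=> BB; rewrite perm_cat// perm_map. Qed.

Lemma perm_bonds m (g : int -> nat) : (0 < m)%N ->
  perm_eq [seq (g z, g (- z)) | z <- flatten (C_faces n m)]
    ([seq (g z, g (- z)) | z <- Defs.up 1 (n + m.-1)] ++
     swap [seq (g z, g (- z)) | z <- Defs.up 1 (n + m.-1)]).
Proof.
move=> m0; apply: perm_trans (perm_map _ (perm_flatten m0)) _.
have E (u : seq int) : [seq (g z, g (- z)) | z <- map -%R u] = swap [seq (g z, g (- z)) | z <- u].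
  by rewrite -!map_comp; apply: eq_map => z /=; rewrite opprK.
by rewrite map_cat E.
Qed.

Lemma up_rcons : Defs.up 1 n.+1 = rcons (Defs.up 1 n) n.+1%:Z.
Proof. by rewrite /Defs.up -cats1 -[n.+1 in LHS]addn1 iotaD map_cat. Qed.

Lemma corners_outer N m : (n <= N)%N ->
  {in outer_face N, cyc_face m =1 (fun=> 0%N)} ->
  perm_eq [seq (cyc_face m z, cyc_vert z) | z <- outer_face N] [seq (0%N, x) | x <- V].
Proof.
move=> nN f0.
have -> : [seq (cyc_face m z, cyc_vert z) | z <- outer_face N] =
    [seq (0%N, cyc_vert z) | z <- outer_face N].
  by apply/eq_in_map => z /f0 /= ->.
by rewrite (map_comp (pair 0%N) cyc_vert); apply/perm_map/perm_vert_outer.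
Qed.

Lemma corners_up m :
  [seq (cyc_face m z, cyc_vert z) | z <- Defs.up 1 n] = [seq (1%N, x) | x <- V].
Proof.
rewrite -vert_up -map_comp; apply/eq_in_map => z; rewrite mem_up /=.
by case: z => // k kn; rewrite /cyc_face ifT//; lia.
Qed.

Lemma corners_C1 : perm_eq [seq (cyc_face 1 z, cyc_vert z) | z <- flatten (C_faces n 1)]
  ([seq (0%N, x) | x <- V] ++ [seq (1%N, x) | x <- V]).
Proof.
rewrite C1E [flatten _]/= cats0 -[_ :: _ ++ _]/(outer_face n ++ _) map_cat corners_up.
rewrite perm_cat2r; apply: corners_outer => // z; rewrite mem_outer//.
by case: z.
Qed.

Lemma corners_C2 : perm_eq [seq (cyc_face 2 z, cyc_vert z) | z <- flatten (C_faces n 2)]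
  ([seq (0%N, x) | x <- V] ++ [seq (1%N, x) | x <- V] ++ [:: (2, 3); (2, n.+2)]%N).
Proof.
rewrite C2E -[flatten _]/(outer_face n.+1 ++ Defs.up 1 n ++ [:: - n%:Z; n.+1%:Z]).
rewrite !map_cat corners_up; apply: perm_cat.
  apply: corners_outer => // z; rewrite mem_outer//.
  by case: z => // k kn; rewrite /= ifF//; lia.
have n0 := ltnW n1.
have e1 : cyc_face 2 (- n%:Z) = 2 by rewrite cyc_face_down ?eqxx.
have e2 : cyc_vert (- n%:Z) = 3 by rewrite cyc_vert_down ?ltnn.
have e3 : cyc_face 2 n.+1%:Z = 2 by rewrite /cyc_face ltnn.
have -> : [seq (cyc_face 2 z, cyc_vert z) | z <- [:: - n%:Z; n.+1%:Z]] =
    [:: (2, 3); (2, n.+2)]%N by congr [:: (_, _); (_, _)]; rewrite ?cyc_vert_last.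
by rewrite perm_cat2l.
Qed.

Lemma face_bonds1 :
  [seq (cyc_face 1 z, cyc_face 1 (- z)) | z <- Defs.up 1 n] = nseq n (1, 0)%N.
Proof.
rewrite -[n in RHS](size_up 1 n); apply: map_constant => z; rewrite mem_up.
by case: z => // k kn; rewrite cyc_face_down /cyc_face ?ifT//; lia.
Qed.

Lemma face_bonds2 :
  [seq (cyc_face 2 z, cyc_face 2 (- z)) | z <- Defs.up 1 n.+1] =
  nseq n.-1 (1, 0)%N ++ [:: (1, 2); (2, 0)]%N.
Proof.
have -> : Defs.up 1 n.+1 = Defs.up 1 n.-1 ++ [:: n%:Z; n.+1%:Z].
  have {1}-> : n.+1 = (n.-1 + 2)%N by lia.
  by rewrite /Defs.up iotaD map_cat /=; congr (_ ++ [:: _%:Z; _%:Z]); lia.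
rewrite map_cat; congr (_ ++ _).
  rewrite -[n.-1 in RHS](size_up 1 n.-1); apply: map_constant => z; rewrite mem_up.
  case: z => // k kn; have kl : (k <= n)%N by lia.
  have ke : (k == n) = false by lia.
  by rewrite cyc_face_down ?ke /cyc_face ?kl//; lia.
rewrite /= !cyc_face_down ?(ltnW n1)// /cyc_face leqnn ltnn eqxx.
by rewrite ifF//; lia.
Qed.

Lemma cyc_vert_V z : z != 0 -> cyc_vert z \in V.
Proof.
move=> z0; rewrite mem_iota cyc_vert_gt//=; rewrite /cyc_vert /minn.
by case: z z0 => k _; case: (ltnP _ n); lia.
Qed.

Lemma C_outer m : head 0 (head [::] (C_faces n m)) = - (n + m.-1)%N%:Z.
Proof. by []. Qed.

Lemma cycle_ok v0 v ws : uniq (v0 :: v :: ws) -> perm_eq (v0 :: v :: ws) V ->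
  build_ok 0%N v0 v [:: Polygon 1%N ws v].
Proof.
move=> u pV; have big x : x \in v0 :: v :: ws -> (2 < x)%N.
  by rewrite (perm_mem pV) mem_iota => /andP[].
have b0 := big v0 (mem_head _ _); have bv : (2 < v)%N by apply: big; rewrite !inE eqxx orbT.
have bw x : x \in ws -> (2 < x)%N by move=> xw; apply: big; rewrite !inE xw !orbT.
have nw x : (x <= 2)%N -> x \notin ws by move=> x2; apply/negP => /bw; lia.
have [v0vw vw uw] : [/\ v0 \notin v :: ws, v \notin ws & uniq ws] by apply/and3P; exact: u.
have [v0v v0w] : v0 != v /\ v0 \notin ws.
  by apply/andP; rewrite -negb_or -in_cons.
have u3 : uniq [:: 0%N; v0; v].
  by rewrite /= !inE negb_or v0v !andbT; lia.
have u1 : uniq (1%N :: ws ++ [:: 0%N; v0; v]).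
  rewrite cons_uniq; apply/andP; split.
    by rewrite mem_cat negb_or nw//= !inE; lia.
  rewrite cat_uniq uw u3 andbT; apply/hasPn => x.
  by rewrite !in_cons in_nil orbF => /or3P[]/eqP->; [exact: nw|exact: v0w|exact: vw].
apply/andP; split; first exact: u3.
by apply/andP; split; first by rewrite !inE eqxx orbT.
Qed.

Lemma cycle_corners v0 v ws : perm_eq (v0 :: v :: ws) V ->
  perm_eq (corners (build 0%N v0 v [:: Polygon 1%N ws v]))
    ([seq (0%N, x) | x <- V] ++ [seq (1%N, x) | x <- V]).
Proof.
move=> pV.
have pm : perm_eq ([seq (0%N, x) | x <- V] ++ [seq (1%N, x) | x <- V])
    ([seq (0%N, x) | x <- v0 :: v :: ws] ++ [seq (1%N, x) | x <- v0 :: v :: ws]).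
  by apply: perm_cat; apply: perm_map; rewrite perm_sym.
rewrite perm_sym; apply: perm_trans pm _.
apply/seq.permP => p; rewrite /= !count_cat /= !count_map /=.
move: (nat_of_bool _) (nat_of_bool _) (nat_of_bool _) (nat_of_bool _) => b1 b2 b3 b4.
by move: (count _ _) (count _ _) => c1 c2; lia.
Qed.

Lemma cyc_face_outer m : (0 < m)%N -> cyc_face m (- (n + m.-1)%N%:Z) = if (m == 2) && (m == 1%N) then 2 else 0%N.
Proof.
move=> m0; rewrite cyc_face_down; last by lia.
by case: eqP => [->|//] /=; rewrite ifF//; lia.
Qed.

Lemma build_K_cycle z : z \in flatten (C_faces n 1) -> exists v1 sts,
  code_build (cyc_face 1) cyc_vert false (C_faces n 1) z v1 sts /\
  \prod_(k <- poly_sizes sts) h k = h n.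
Proof.
rewrite mem_C1 => /andP[z0 _]; have zV : cyc_vert z \in V by apply: cyc_vert_V; lia.
have [v [ws [pV u pb]]] := rot_V zV.
exists v, [:: Polygon 1%N ws v]; split; last first.
  by rewrite /= big_seq1; congr h; have := perm_size pV; rewrite size_iota.
apply: (code_build_K (f0 := 0%N)).
- by rewrite C_outer cyc_face_outer.
- exact: cycle_ok.
- by rewrite perm_sym; apply: perm_trans corners_C1 _; rewrite perm_sym; exact: cycle_corners.
- rewrite perm_sym; apply: perm_trans (perm_bonds _ _) _ => //.
  rewrite addn0 bonds_up perm_sym; apply: perm_swap.
  by rewrite perm_catC; exact: pb.
Qed.

(** The polygon is completed first, from any base vertex; the bigon is then attached at the ends n +
    2 and 3 of the edge n. *)
Lemma build_K_cycle2 z : z \in flatten (C_faces n 2) -> exists v1 sts,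
  code_build (cyc_face 2) cyc_vert false (C_faces n 2) z v1 sts /\
  \prod_(k <- poly_sizes sts) h k = h n.
Proof.
rewrite mem_C2 => /andP[z0 _]; have zV : cyc_vert z \in V by apply: cyc_vert_V; lia.
have [v [ws [pV u pb]]] := rot_V zV.
exists v, [:: Bigon 2 n.+2 3%N; Polygon 1%N ws v]; split; last first.
  by rewrite /= big_seq1; congr h; have := perm_size pV; rewrite size_iota.
set z0' := cyc_vert z in zV pV u pb.
have memS x : (x \in blab (build 0%N z0' v [:: Polygon 1%N ws v])) = (x \in V).
  by rewrite -(perm_mem pV) /= mem_cat !inE; do !case: (_ == _); rewrite ?orbT ?orbF.
apply: (code_build_K (f0 := 0%N)); rewrite -/z0'.
- by rewrite C_outer cyc_face_outer.
- apply/andP; split; first exact: cycle_ok.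
  apply/and3P; split; [by rewrite memS mem_iota; lia|by rewrite memS mem_iota; lia|].
  have b2 x : x \in z0' :: v :: ws -> x != 2.
    by rewrite (perm_mem pV) mem_iota => /andP[x2 _]; apply/eqP; lia.
  rewrite /labels /= !inE !negb_or !mem_cat !inE !negb_or /=.
  rewrite ![2 == _]eq_sym !b2 ?inE ?eqxx ?orbT//= andbT.
  by apply/negP => w2; have := b2 2; rewrite !inE w2 !orbT eqxx => /(_ isT).
- rewrite perm_sym; apply: perm_trans corners_C2 _; rewrite perm_sym catA.
  rewrite -[corners _]/([:: (2, n.+2); (2, 3)]%N ++ corners (build 0%N z0' v [:: Polygon 1%N ws v])).
  rewrite perm_catC; apply: perm_cat; first exact: cycle_corners.
  exact/permPl/(perm_catC [:: _] [:: _]).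
- rewrite perm_sym; apply: perm_trans (perm_bonds _ _) _ => //.
  rewrite addn1 up_rcons map_rcons bonds_up perm_sym; apply: perm_swap.
  have -> : (cyc_vert n.+1, cyc_vert (- n.+1%:Z)) = (n.+2, 3%N).
    by rewrite cyc_vert_last cyc_vert_down// ifF//; lia.
  rewrite perm_sym perm_rcons perm_cons perm_sym.
  by rewrite perm_catC; exact: pb.
Qed.

Lemma V_gt x : x \in V -> (2 < x)%N.
Proof. by rewrite mem_iota => /andP[]. Qed.

Lemma corners_C1_swap : perm_eq [seq (cyc_vert z, cyc_face 1 z) | z <- flatten (C_faces n 1)]
  ([seq (x, 0%N) | x <- V] ++ [seq (x, 1%N) | x <- V]).
Proof.
have -> : [seq (cyc_vert z, cyc_face 1 z) | z <- flatten (C_faces n 1)] =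
    swap [seq (cyc_face 1 z, cyc_vert z) | z <- flatten (C_faces n 1)] by rewrite -map_comp.
by apply: perm_trans (perm_map _ corners_C1) _; rewrite map_cat -!map_comp.
Qed.

Lemma corners_C2_swap : perm_eq [seq (cyc_vert z, cyc_face 2 z) | z <- flatten (C_faces n 2)]
  ([seq (x, 0%N) | x <- V] ++ [seq (x, 1%N) | x <- V] ++ [:: (3, 2); (n.+2, 2)]%N).
Proof.
have -> : [seq (cyc_vert z, cyc_face 2 z) | z <- flatten (C_faces n 2)] =
    swap [seq (cyc_face 2 z, cyc_vert z) | z <- flatten (C_faces n 2)] by rewrite -map_comp.
by apply: perm_trans (perm_map _ corners_C2) _; rewrite !map_cat -!map_comp.
Qed.

(** The dual of the cycle consists of n parallel edges between the faces 0 and 1: the initial edge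
    and n - 1 bigons, one for each vertex other than F*. *)
Lemma build_mK_cycle z : z \in flatten (C_faces n 1) -> exists v1 sts,
  code_build (cyc_face 1) cyc_vert true (C_faces n 1) z v1 sts /\
  \prod_(k <- poly_sizes sts) h k = 1.
Proof.
rewrite mem_C1 => /andP[z0 _]; have zV : cyc_vert z \in V by apply: cyc_vert_V; lia.
set f := cyc_vert z in zV.
have pV : perm_eq V (f :: rem f V) := perm_to_rem zV.
have gt x : x \in f :: rem f V -> (2 < x)%N by rewrite -(perm_mem pV); apply: V_gt.
have uV : uniq (f :: rem f V) by rewrite -(perm_uniq pV) iota_uniq.
have f2 : (2 < f)%N := V_gt zV.
have [c b _ _ ps] := build_bigons f 0%N 1%N 0%N 1%N (rem f V) [::].
exists 1%N, ([seq Bigon k 0%N 1%N | k <- rem f V] ++ [::]); split; last by rewrite ps big_nil.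
apply: (code_build_mK (v0 := 0%N)); rewrite -/f.
- by rewrite C_outer cyc_face_outer.
- apply: build_bigons_ok; rewrite ?inE//.
    by rewrite /= !inE !negb_or; lia.
  have [fr ur] : f \notin rem f V /\ uniq (rem f V) by apply/andP.
  have nr x : (x <= 2)%N -> x \notin rem f V.
    by move=> x2; apply/negP => xr; have := gt x; rewrite inE xr orbT => /(_ isT); lia.
  rewrite cat_uniq ur /=; apply/andP; split; last by rewrite !inE !negb_or; lia.
  by rewrite (negbTE fr) (negbTE (nr 0%N _)) ?(negbTE (nr 1%N _)).
- rewrite perm_sym; apply: perm_trans corners_C1_swap _; rewrite c perm_sym.
  have pm : perm_eq ([seq (x, 0%N) | x <- V] ++ [seq (x, 1%N) | x <- V])
      ([seq (x, 0%N) | x <- f :: rem f V] ++ [seq (x, 1%N) | x <- f :: rem f V]).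
    by apply: perm_cat; apply: perm_map.
  rewrite perm_sym; apply: perm_trans pm _; rewrite perm_sym.
  have := perm_flatten_pairs 0%N 1%N (f :: rem f V); apply: perm_trans.
  by rewrite perm_catC.
- rewrite b; have -> : nseq (size (rem f V)) (0, 1)%N ++ bonds (build f 0%N 1%N [::]) = nseq n (0, 1)%N.
    rewrite size_rem// size_iota -[n in RHS](ltn_predK n1) -[n.-1.+1]addn1 nseqD //.
  rewrite perm_sym; apply: perm_trans (perm_bonds _ _) _ => //.
  by rewrite addn0 face_bonds1 !map_nseq perm_catC.
Qed.

(** The dual is a triangle on the faces 0, 1, 2 with n - 1 parallel edges between 0 and 1. One end
    of the doubled edge is F*, the other end [f1] is the triangle, and the n - 2 remaining vertices
    are bigons. *)
Lemma build_mK_cycle2 z : z \in flatten (C_faces n 2) ->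
  full_vertex (cyc_face 2) cyc_vert (C_faces n 2) z -> exists v1 sts,
  code_build (cyc_face 2) cyc_vert true (C_faces n 2) z v1 sts /\
  \prod_(k <- poly_sizes sts) h k = h 3.
Proof.
move=> _ fz; set f := cyc_vert z.
(* A full vertex lies on the bigon, whose only darts are -n and n + 1, with origins 3 and n + 2. *)
have [f1 pf] : exists f1, perm_eq [:: f; f1] [:: 3; n.+2]%N.
  have nl : - n%:Z \in flatten (C_faces n 2) by rewrite mem_C2; lia.
  have /hasP[w wl /andP[/eqP fw]] := allP fz _ nl.
  rewrite -/f in fw; rewrite cyc_face_down ?(ltnW n1)// !eqxx /=.
  rewrite mem_C2 in wl; case: w wl fw => k wl fw.
    rewrite /cyc_face; case: ifP => // kn _; exists 3%N.
    have ke : k = n.+1 by lia.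
    by rewrite -fw ke cyc_vert_last; exact/permPl/(perm_catC [:: _] [:: _]).
  rewrite /cyc_face /=; case: ifP => // /eqP ke _; exists n.+2.
  by rewrite -fw NegzE cyc_vert_down// ke ltnn.
pose ks := iota 4 n.-2.
have pV : perm_eq V (f :: f1 :: ks).
  have -> : V = 3%N :: ks ++ [:: n.+2].
    have {1}-> : n = (1 + (n.-2 + 1))%N by lia.
    by rewrite !iotaD /=; congr (_ :: _ ++ [:: _]); lia.
  rewrite -[f :: _]/([:: f; f1] ++ ks) perm_sym; apply: perm_trans (perm_cat pf (perm_refl ks)) _.
  by rewrite /= perm_cons perm_sym perm_catC.
have gt x : x \in f :: f1 :: ks -> (2 < x)%N by rewrite -(perm_mem pV); apply: V_gt.
have uV : uniq (f :: f1 :: ks) by rewrite -(perm_uniq pV) iota_uniq.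
have f2 : (2 < f)%N by apply: gt; rewrite inE eqxx.
have f12 : (2 < f1)%N by apply: gt; rewrite !inE eqxx orbT.
have [ff1 ffk f1k uk] : [/\ f != f1, f \notin ks, f1 \notin ks & uniq ks].
  by move: uV; rewrite /= inE negb_or => /and3P[/andP[-> ->] -> ->].
have nk x : (x <= 2)%N -> x \notin ks.
  by move=> x2; apply/negP => xk; have := gt x; rewrite !inE xk !orbT => /(_ isT); lia.
pose sts := [:: Polygon f1 [:: 2%N] 1%N].
have [c b _ _ ps] := build_bigons f 0%N 1%N 0%N 1%N ks sts.
exists 1%N, ([seq Bigon k 0%N 1%N | k <- ks] ++ sts); split; last by rewrite ps big_seq1.
apply: (code_build_mK (v0 := 0%N)); rewrite -/f.
- by rewrite C_outer cyc_face_outer.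
- apply: build_bigons_ok; rewrite ?inE//.
    by rewrite /= !inE !negb_or [f1 == f]eq_sym ff1; lia.
  rewrite cat_uniq uk /=; apply/andP; split; last by rewrite !inE !negb_or ff1; lia.
  by rewrite (negbTE ffk) (negbTE f1k) !(negbTE (nk _ _)).
- rewrite perm_sym; apply: perm_trans corners_C2_swap _; rewrite c perm_sym.
  have pm : perm_eq ([seq (x, 0%N) | x <- V] ++ [seq (x, 1%N) | x <- V] ++ [:: (3, 2); (n.+2, 2)]%N)
      ([seq (x, 0%N) | x <- f :: f1 :: ks] ++ [seq (x, 1%N) | x <- f :: f1 :: ks] ++ [seq (x, 2%N) | x <- [:: f; f1]]).
    apply: perm_cat; first exact: perm_map.
    apply: perm_cat; first exact: perm_map.
    by rewrite perm_sym; exact: (perm_map (fun x => (x, 2%N)) pf).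
  rewrite perm_sym; apply: perm_trans pm _; rewrite perm_sym.
  apply: perm_trans (perm_cat (perm_flatten_pairs 0%N 1%N ks) (perm_refl _)) _.
  apply/seq.permP => p; rewrite /= !count_cat /= !count_cat /=.
  move: (nat_of_bool (p (f, 0%N))) (nat_of_bool (p (f, 1%N))) (nat_of_bool (p (f, 2%N))) => b1 b2 b3.
  move: (nat_of_bool (p (f1, 0%N))) (nat_of_bool (p (f1, 1%N))) (nat_of_bool (p (f1, 2%N))) => b4 b5 b6.
  by move: (count _ _) (count _ _) => c1 c2; lia.
- rewrite b perm_sym; apply: perm_trans (perm_bonds _ _) _ => //.
  rewrite addn1 face_bonds2 size_iota.
  have -> : n.-1 = n.-2.+1 by lia.
  apply/seq.permP => p; rewrite /= !(map_cat, map_nseq) /= !count_cat /= !count_cat /=.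
  move: (nat_of_bool (p (0, 1)%N)) (nat_of_bool (p (1, 0)%N)) (nat_of_bool (p (1, 2)%N)) => b1 b2 b3.
  move: (nat_of_bool (p (2, 0)%N)) (nat_of_bool (p (2, 1)%N)) (nat_of_bool (p (0, 2)%N)) => b4 b5 b6.
  by move: (count _ _) (count _ _) => c1 c2; lia.
Qed.

Lemma full_vertex_cycle m : (0 < m <= 2)%N ->
  has (full_vertex (cyc_face m) cyc_vert (C_faces n m)) (flatten (C_faces n m)).
Proof.
move=> m12; have m0 : (0 < m)%N by lia.
have memC z : (z \in flatten (C_faces n m)) = (0 < `|z| <= n + m.-1)%N.
  have [->|->] : m = 1%N \/ m = 2 by lia.
    by rewrite mem_C1 addn0.
  by rewrite mem_C2 addn1.
have v1 : cyc_vert 1%N = 3 by rewrite cyc_vert_up//; lia.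
(* The origin 3 of the dart 1 is also that of -(n + m - 1) on the outer face and of -n, which lies
   on the bigon if m = 2. *)
apply/hasP; exists 1%N%:Z; first by rewrite memC; lia.
have wit w y : w \in flatten (C_faces n m) -> cyc_vert w = 3 -> cyc_face m w = cyc_face m y ->
    has (fun w => (cyc_vert w == cyc_vert 1%N) && (cyc_face m w == cyc_face m y)) (flatten (C_faces n m)).
  by move=> wl wv wf; apply/hasP; exists w; rewrite // wv wf v1 !eqxx.
apply/allP => y yl.
have [f0|[f1|[m2 f2]]] : cyc_face m y = 0%N \/ cyc_face m y = 1%N \/ (m = 2 /\ cyc_face m y = 2).
  move: yl; rewrite memC; case: y => k yl; rewrite /cyc_face; case: ifP => //; try by [left|right; left].
    by move=> kn; right; right; split=> //; lia.
  by move=> /andP[/eqP -> _]; right; right.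
- apply: (wit (- (n + m.-1)%N%:Z)); rewrite ?f0 ?memC; first by lia.
    by rewrite cyc_vert_down ?ifF//; lia.
  by rewrite cyc_face_outer//; case: eqP => // ->.
- apply: (wit 1%N); rewrite ?f1 ?memC//; first by lia.
  by rewrite /cyc_face ifT//; lia.
- apply: (wit (- n%:Z)); rewrite ?f2 ?memC; first by lia.
    by rewrite cyc_vert_down ?ltnn//; lia.
  by rewrite m2 cyc_face_down ?eqxx//; lia.
Qed.

Lemma C_faces_ok m : (0 < m)%N -> face_list (C_ n m) = C_faces n m.
Proof. by move=> m0; rewrite C_ok//; lia. Qed.

Lemma Phi_K_cycle : Phi_K_is (C_ n 1) (h n).
Proof.
apply: (Phi_code (b := false) (vs := cyc_vertices 1) (laz := cyc_face 1) (lbz := cyc_vert));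
  rewrite C_faces_ok//; [exact: C1_labels|exact: full_vertex_cycle|].
by move=> z zl _; apply: build_K_cycle.
Qed.

Lemma Phi_mK_cycle : Phi_mK_is (C_ n 1) 1.
Proof.
apply: (Phi_code (b := true) (vs := cyc_vertices 1) (laz := cyc_face 1) (lbz := cyc_vert));
  rewrite C_faces_ok//; [exact: C1_labels|exact: full_vertex_cycle|].
by move=> z zl _; apply: build_mK_cycle.
Qed.

Lemma Phi_K_cycle2 : Phi_K_is (C_ n 2) (h n).
Proof.
apply: (Phi_code (b := false) (vs := cyc_vertices 2) (laz := cyc_face 2) (lbz := cyc_vert));
  rewrite C_faces_ok//; [exact: C2_labels|exact: full_vertex_cycle|].
by move=> z zl _; apply: build_K_cycle2.
Qed.

Lemma Phi_mK_cycle2 : Phi_mK_is (C_ n 2) (h 3).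
Proof.
apply: (Phi_code (b := true) (vs := cyc_vertices 2) (laz := cyc_face 2) (lbz := cyc_vert));
  rewrite C_faces_ok//; [exact: C2_labels|exact: full_vertex_cycle|].
exact: build_mK_cycle2.
Qed.

End Cycles.
Theorem theorem1p1 :
  (Phi_K_is K3_1 (h 3) /\ Phi_mK_is K3_1 1) /\
  (Phi_K_is K4_1 (h 3) /\ Phi_mK_is K4_1 (h 3)) /\
  (Phi_K_is K5_1 (h 5) /\ Phi_mK_is K5_1 1) /\
  (Phi_K_is K5_2 (h 4) /\ Phi_mK_is K5_2 (h 3)) /\
  (Phi_K_is K6_1 (h 5) /\ Phi_mK_is K6_1 (h 3)) /\
  (Phi_K_is K6_2 (h 3 * h 4) /\ Phi_mK_is K6_2 (h 3)) /\
  (Phi_K_is K6_3 (h 3 ^+ 2) /\ Phi_mK_is K6_3 (h 3 ^+ 2)) /\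
  (Phi_K_is K7_1 (h 7) /\ Phi_mK_is K7_1 1) /\
  (Phi_K_is K7_2 (h 6) /\ Phi_mK_is K7_2 (h 3)) /\
  (Phi_K_is K7_3 (h 5) /\ Phi_mK_is K7_3 (h 4)) /\
  (Phi_K_is K7_4 (h 4 ^+ 2) /\ Phi_mK_is K7_4 (h 3)) /\
  (Phi_K_is K7_5 (h 3 * h 4) /\ Phi_mK_is K7_5 (h 4)) /\
  (Phi_K_is K7_6 (h 3 * h 4) /\ Phi_mK_is K7_6 (h 3 ^+ 2)) /\
  (Phi_K_is K7_7 (h 3 ^+ 3) /\ Phi_mK_is K7_7 (h 3 ^+ 2)) /\
  (Phi_K_is K8_1 (h 7) /\ Phi_mK_is K8_1 (h 3)) /\
  (Phi_K_is K8_2 (h 3 * h 6) /\ Phi_mK_is K8_2 (h 3)) /\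
  (Phi_K_is K8_3 (h 5) /\ Phi_mK_is K8_3 (h 5)) /\
  (Phi_K_is K8_4 (h 3) /\ Phi_mK_is K8_4 (h 4 * h 5)) /\
  (Phi_mK_is K8_5 (h 3) /\ Phi_mK_is K8_5_alt (h 3)) /\
  (forall p : int, 0 < p ->
     Phi_K_is (twist p) (h (2 * `|p|)) /\ Phi_mK_is (twist p) (h 3)) /\
  (forall p : int, p < 0 ->
     Phi_K_is (twist p) (h (2 * `|p|).+1) /\ Phi_mK_is (twist p) (h 3)) /\
  (forall p : nat, (0 < p)%N ->
     Phi_K_is (torus2 p) (h (2 * p).+1) /\ Phi_mK_is (torus2 p) 1).
Proof.
have cyc n : (1 < n)%N -> Phi_K_is (C_ n 1) (h n) /\ Phi_mK_is (C_ n 1) 1.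
  by move=> n1; split; [apply: Phi_K_cycle|apply: Phi_mK_cycle].
have cyc2 n : (1 < n)%N -> Phi_K_is (C_ n 2) (h n) /\ Phi_mK_is (C_ n 2) (h 3).
  by move=> n1; split; [apply: Phi_K_cycle2|apply: Phi_mK_cycle2].
have prod1 n : \prod_(k <- [:: n]) h k = h n by rewrite big_seq1.
have prod2 m n : \prod_(k <- [:: m; n]) h k = h m * h n by rewrite big_cons prod1.
have prod3 k m n : \prod_(k <- [:: k; m; n]) h k = h k * (h m * h n) by rewrite big_cons prod2.
split; first exact: cyc.
split; first exact: cyc2.
split; first exact: cyc.
split; first exact: cyc2.
split; first exact: cyc2.
split; first by have := Phi_K_6_2; have := Phi_mK_6_2; rewrite prod1 prod2.
split; first by have := Phi_K_6_3; have := Phi_mK_6_3; rewrite !prod2 expr2.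
split; first exact: cyc.
split; first exact: cyc2.
split; first by have := Phi_K_7_3; have := Phi_mK_7_3; rewrite !prod1.
split; first by have := Phi_K_7_4; have := Phi_mK_7_4; rewrite prod1 prod2 expr2.
split; first by have := Phi_K_7_5; have := Phi_mK_7_5; rewrite prod1 prod2.
split; first by have := Phi_K_7_6; have := Phi_mK_7_6; rewrite !prod2 expr2.
split; first by have := Phi_K_7_7; have := Phi_mK_7_7; rewrite prod2 prod3 exprS !expr2.
split; first exact: cyc2.
split; first by have := Phi_K_8_2; have := Phi_mK_8_2; rewrite prod1 prod2.
split; first by have := Phi_K_8_3; have := Phi_mK_8_3; rewrite !prod1.
split; first by have := Phi_K_8_4; have := Phi_mK_8_4; rewrite prod1 prod2.
split; first by have := Phi_mK_8_5; have := Phi_mK_8_5_alt; rewrite !prod1.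
split; first by move=> p p0; rewrite /twist p0; apply: cyc2; lia.
split; first by move=> p p0; rewrite /twist ltNge ltW//=; apply: cyc2; lia.
by move=> p p0; apply: cyc; lia.
Qed.
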